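(* Let $M$ be a real $2n$-dimensional smooth manifold with a smooth almost complex structure $J$, and let $D=\{\rho<0\}$ be a relatively compact domain in $(M,J)$, where $\rho$ is a $\mathcal C^2$ defining function of $D$ which is strictly $J$-plurisubharmonic in a neighborhood of $\bar D$. Let $\|\cdot\|$ be the norm on tangent vectors given by a fixed Riemannian metric on $M$. Then there exists a positive constant $c$ such that $$K_{(D,J)}(p,v)\ \geq\ c\left[\frac{|\partial_J\rho(p)(v-iJ(p)v)|^2}{|\rho(p)|^2}+\frac{\|v\|^2}{|\rho(p)|}\right]^{1/2}$$ for every $p\in D$ and every $v\in T_pM$.
   Context: An almost complex structure on $M$ is a smooth bundle endomorphism $J$ of $TM$ with $J^2=-\mathrm{Id}$. $J_{st}$ denotes the standard complex structure on $\mathbb C^n$ (for every $n$), $\Delta\subset\mathbb C$ is the open unit disc with coordinate $\zeta=x+iy$. A smooth map $f:\Delta\to M$ is a $J$-holomorphic disc if $df\circ J_{st}=J\circ df$. A $\mathcal C^2$ defining function of $D$ is a real valued function $\rho$ of class $\mathcal C^2$ on a neighborhood of $\bar D$ such that $D=\{\rho<0\}$, $\partial D=\{\rho=0\}$ and $d\rho\neq 0$ on $\partial D$. Levi form: for a real valued $\mathcal C^2$ function $u$, a point $p$ and $v\in T_pM$, $\mathcal L^J(u)(p)(v):=-d(J^\star du)(X,JX)(p)$, where $X$ is any vector field with $X(p)=v$ and $J^\star du=du\circ J$. The function $u$ is strictly $J$-plurisubharmonic if $\mathcal L^J(u)(p)(v)>0$ for every $p$ and every $v\in T_pM\setminus\{0\}$.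 $\partial_J\rho$ is the $(1,0)$-part of $d\rho$: on the complexified tangent bundle, extending $d\rho$ and $J$ complex linearly, $\partial_J\rho(X)=\frac12\left(d\rho(X)-i\,d\rho(JX)\right)$. (It vanishes on $T^{(0,1)}M=\{X: JX=-iX\}$ and agrees with $d\rho$ on $T^{(1,0)}M=\{X:JX=iX\}$.) Kobayashi-Royden infinitesimal pseudometric: for an almost complex manifold $(N,J)$, $p\in N$, $v\in T_pN$, $K_{(N,J)}(p,v)$ is the infimum of all $\alpha>0$ such that there is a $J$-holomorphic disc $f:\Delta\to N$ with $f(0)=p$ and $df(0)(\partial/\partial x)=v/\alpha$. Here it is applied to $N=D$ with the restriction of $J$. *)

(* Defs.v *)
From HB Require Import structures.
From mathcomp Require Import all_boot all_order all_algebra.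
From mathcomp Require Import all_classical all_reals all_analysis.
From mathcomp Require Export complex.

Set Implicit Arguments.
Unset Strict Implicit.
Unset Printing Implicit Defensive.

Import Order.TTheory GRing.Theory Num.Theory.
Import numFieldNormedType.Exports.

Local Open Scope classical_set_scope.
Local Open Scope ring_scope.

(* For [U] open and [V] finite-dimensional this is the usual class C^k on [U]:
   differentiability at order k+1 makes the lower derivatives continuous. *)
Fixpoint Ck (R : realType) (V W : normedModType R) (k : nat) (U : set V)
    (f : V -> W) : Prop :=
  match k with
  | 0%N => forall x, U x -> {for x, continuous f}
  | k'.+1 => (forall x, U x -> differentiable f x) /\
             (forall v : V, Ck k' U (fun x => 'D_v f x))
  end.

Definition smooth (R : realType) (V W : normedModType R) (U : set V)
    (f : V -> W) : Prop := forall k, Ck k U f.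

(* [chart_inv] is the inverse of the chart, meaningful only on
   [chart_map @` chart_dom]. *)
Record chart (R : realType) (m : nat) (M : topologicalType) := Chart {
  chart_dom : set M ;
  chart_map :> M -> 'rV[R]_m ;
  chart_inv : 'rV[R]_m -> M ;
  chart_dom_open : open chart_dom ;
  chart_cod_open : open (chart_map @` chart_dom) ;
  chart_mapK : forall p, chart_dom p -> chart_inv (chart_map p) = p ;
  chart_map_cts : forall p, chart_dom p -> {for p, continuous chart_map} ;
  chart_inv_cts : forall y, (chart_map @` chart_dom) y ->
    {for y, continuous chart_inv} }.

(* A smooth manifold of dimension [m], without boundary.  The atlas need not be
   maximal.  [chart_at p] is a preferred chart around [p], used below to
   represent the tangent space at [p]. *)
Record manifold (R : realType) (m : nat) := Manifold {
  carrier :> topologicalType ;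
  atlas : set (chart R m carrier) ;
  chart_at : carrier -> chart R m carrier ;
  chart_at_atlas : forall p, atlas (chart_at p) ;
  chart_at_dom : forall p, chart_dom (chart_at p) p ;
  atlas_compatible : forall c d, atlas c -> atlas d ->
    smooth (c @` (chart_dom c `&` chart_dom d)) (d \o chart_inv c) ;
  manifold_hausdorff : hausdorff_space carrier ;
  manifold_second_countable : @second_countable carrier }.

(* A tangent vector at [p] is given by its components in the chart
   [chart_at p]; [to_chart] and [of_chart] change to and from the components in
   another chart around [p]. *)
Definition tangent (R : realType) (m : nat) (M : manifold R m) (p : M) : Type :=
  'rV[R]_m.

HB.instance Definition _ (R : realType) (m : nat) (M : manifold R m) (p : M) :=
  GRing.Lmodule.on (tangent p).

Definition to_chart (R : realType) (m : nat) (M : manifold R m)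
    (c : chart R m M) (p : M) (v : tangent p) : 'rV[R]_m :=
  'd (c \o chart_inv (chart_at p)) (chart_at p p) v.

Definition of_chart (R : realType) (m : nat) (M : manifold R m)
    (c : chart R m M) (p : M) (w : 'rV[R]_m) : tangent p :=
  'd (chart_at p \o chart_inv c) (c p) w.

Definition Ck_fun (R : realType) (m : nat) (M : manifold R m) (k : nat)
    (U : set M) (u : M -> R) : Prop :=
  forall c, atlas c -> Ck k (c @` (chart_dom c `&` U)) (u \o chart_inv c).

Definition dfun (R : realType) (m : nat) (M : manifold R m) (u : M -> R)
    (p : M) (v : tangent p) : R :=
  'd (u \o chart_inv (chart_at p)) (chart_at p p) v.

Definition smooth_into (R : realType) (V : normedModType R) (m : nat)
    (M : manifold R m) (U : set V) (f : V -> M) : Prop :=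
  (forall x, U x -> {for x, continuous f}) /\
  forall c, atlas c -> smooth (U `&` f @^-1` chart_dom c) (c \o f).

Definition dmap (R : realType) (V : normedModType R) (m : nat)
    (M : manifold R m) (f : V -> M) (x : V) (w : V) : tangent (f x) :=
  'd (chart_at (f x) \o f) x w.

(* Smoothness of a bundle map is smoothness of its matrix in every chart,
   expressed column by column; likewise for the metric below. *)
Record almost_complex (R : realType) (m : nat) (M : manifold R m) :=
  AlmostComplex {
  acs :> forall p : M, {linear tangent p -> tangent p} ;
  acs_sqr : forall (p : M) (v : tangent p), acs p (acs p v) = - v ;
  acs_smooth : forall c, atlas c -> forall w : 'rV[R]_m,
    smooth (c @` chart_dom c)
      (fun y => to_chart c (acs (chart_inv c y) (of_chart c (chart_inv c y) w)))
  }.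

Record riemannian_metric (R : realType) (m : nat) (M : manifold R m) :=
  RiemannianMetric {
  metric :> forall p : M, tangent p -> tangent p -> R ;
  metric_linear : forall (p : M) (a : R) (u v w : tangent p),
    metric (a *: u + v) w = a * metric u w + metric v w ;
  metric_sym : forall (p : M) (u v : tangent p), metric u v = metric v u ;
  metric_pos : forall (p : M) (v : tangent p), v <> 0 -> 0 < metric v v ;
  metric_smooth : forall c, atlas c -> forall v w : 'rV[R]_m,
    smooth (c @` chart_dom c)
      (fun y => metric (of_chart c (chart_inv c y) v)
                       (of_chart c (chart_inv c y) w))
  }.

Definition tnorm (R : realType) (m : nat) (M : manifold R m)
    (g : riemannian_metric M) (p : M) (v : tangent p) : R :=
  Num.sqrt (g p v v).

(* d alpha (v, w) for a 1-form alpha, computed in the chart [chart_at p] with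
   the fields of constant components [v] and [w], whose bracket vanishes:
   d alpha (X, Y) = X (alpha Y) - Y (alpha X) - alpha [X, Y]. *)
Definition ext_deriv (R : realType) (m : nat) (M : manifold R m)
    (alpha : forall p : M, tangent p -> R) (p : M) (v w : tangent p) : R :=
  let c := chart_at p in
  let alpha_c (y w : 'rV[R]_m) :=
    alpha (chart_inv c y) (of_chart c (chart_inv c y) w) in
  'D_(v : 'rV[R]_m) (alpha_c^~ w) (c p) - 'D_(w : 'rV[R]_m) (alpha_c^~ v) (c p).

Definition Jstar (R : realType) (m : nat) (M : manifold R m)
    (J : almost_complex M) (alpha : forall p : M, tangent p -> R)
    (p : M) (v : tangent p) : R := alpha p (J p v).

(* d (J^* du) is a 2-form, so its value at the fields (X, JX) depends only on
   X(p) = v. *)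
Definition levi (R : realType) (m : nat) (M : manifold R m)
    (J : almost_complex M) (u : M -> R) (p : M) (v : tangent p) : R :=
  - ext_deriv (Jstar J (@dfun R m M u)) v (J p v).

Definition strictly_psh (R : realType) (m : nat) (M : manifold R m)
    (J : almost_complex M) (U : set M) (u : M -> R) : Prop :=
  Ck_fun 2 U u /\
  forall p, U p -> forall v : tangent p, v <> 0 -> 0 < levi J u v.

Definition relatively_compact_domain (M : topologicalType) (D : set M) : Prop :=
  [/\ open D, connected D & compact (closure D)].

(* [rho] is a total function; only its values on the neighborhood [U] of the
   closure of [D] matter. *)
Definition defining_function (R : realType) (m : nat) (M : manifold R m)
    (D : set M) (rho : M -> R) : Prop :=
  exists U : set M,
    [/\ open U /\ closure D `<=` U,
        Ck_fun 2 U rho,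
        D = U `&` [set p | rho p < 0],
        closure D `\` interior D = U `&` [set p | rho p = 0] &
        forall p, (closure D `\` interior D) p ->
          exists v : tangent p, dfun rho v <> 0].

Definition strictly_psh_near_closure (R : realType) (m : nat)
    (M : manifold R m) (J : almost_complex M) (D : set M) (rho : M -> R) : Prop :=
  exists U : set M, [/\ open U, closure D `<=` U & strictly_psh J U rho].

(* [(a, b)] stands for the complexified tangent vector a + i b. *)
Definition ctangent (R : realType) (m : nat) (M : manifold R m) (p : M) : Type :=
  (tangent p * tangent p)%type.

Definition cdfun (R : realType) (m : nat) (M : manifold R m) (u : M -> R)
    (p : M) (X : ctangent p) : R[i] := (dfun u X.1 +i* dfun u X.2)%C.

Definition cJ (R : realType) (m : nat) (M : manifold R m)
    (J : almost_complex M) (p : M) (X : ctangent p) : ctangent p :=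
  (J p X.1, J p X.2).

Definition dJ (R : realType) (m : nat) (M : manifold R m)
    (J : almost_complex M) (u : M -> R) (p : M) (X : ctangent p) : R[i] :=
  2^-1 * (cdfun u X - 'i%C * cdfun u (cJ J X)).

(* The complexified vector v - i J v. *)
Definition v_sub_iJv (R : realType) (m : nat) (M : manifold R m)
    (J : almost_complex M) (p : M) (v : tangent p) : ctangent p :=
  (v, - J p v).

(* The complex line is [R * R], with (x, y) standing for x + i y. *)
Definition unit_disc (R : realType) : set (R * R) :=
  [set z | z.1 ^+ 2 + z.2 ^+ 2 < 1].

Definition Jst (R : realType) (z : R * R) : R * R := (- z.2, z.1).

Definition J_holomorphic_disc (R : realType) (m : nat) (M : manifold R m)
    (J : almost_complex M) (f : R * R -> M) : Prop :=
  smooth_into (@unit_disc R) f /\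
  forall z, unit_disc z -> forall w : R * R,
    dmap f z (Jst w) = J (f z) (dmap f z w).

(* The pseudometric of the open subset [N] of [M] with the restriction of [J].
   The infimum is taken in the extended reals (+oo if there is no disc).
   As f 0 = p, the equation on differentials is between vectors of the same
   tangent space. *)
Definition kobayashi_royden (R : realType) (m : nat) (M : manifold R m)
    (J : almost_complex M) (N : set M) (p : M) (v : tangent p) : \bar R :=
  ereal_inf [set a%:E | a in [set a : R | 0 < a /\
    exists f : R * R -> M,
      [/\ J_holomorphic_disc J f,
          f @` @unit_disc R `<=` N,
          f (0, 0) = p &
          dmap f (0, 0) (1, 0) = a^-1 *: v :> 'rV[R]_m]]].

(* Main.v *)
Require Import Defs.
From mathcomp Require Import all_boot all_order all_algebra.
From mathcomp Require Import all_classical all_reals all_analysis.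
From mathcomp Require Import ring lra.
Import Order.TTheory GRing.Theory Num.Theory.
Import numFieldNormedType.Exports.
Local Open Scope classical_set_scope.
Local Open Scope ring_scope.

Set Implicit Arguments.
Unset Strict Implicit.
Unset Printing Implicit Defensive.

(* Along a [J]-holomorphic disc [f] in [D], the function [u = rho o f] is negative
   and its Laplacian is the Levi form of [rho] at [f_x], hence comparable with
   [|f_x|^2].  Let [a] be a point of the disc and [delta = - u a].

   Tangential part (Sibony).  Near [p = f a], the logarithm of the squared distance
   to [p], corrected by a multiple of the distance because [J] is not constant
   (Chirka), and cut off at distance of order [sqrt delta], has Levi form bounded
   below by a multiple of [- 1 / delta].  Adding a multiple of [rho / delta] and
   subtracting [ln |z - a|^2], one obtains a function on the disc without interior
   maximum; its value at [a] yields [|f_x a|^2 <= C * delta].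

   Normal part.  The tangential estimate at every point of a smaller disc shows that
   the Laplacian of [- u] lies between [C * u] and [0].  A positive function with
   this property satisfies a Harnack inequality and then a gradient estimate
   [|grad u| <= C * |u|] at the origin; both are deduced from the maximum principle
   alone, as [u] is only of class C^2.  The components of the gradient are
   [drho (f_x)] and [drho (J f_x)], whose squares add up to the square of the
   modulus of [dJ rho (X - i J X)], with [X = f_x]. *)

(** * Second-order jets and the maximum principle *)

(** The obstacle is uniformity as [p] approaches the boundary. A cut-off at distance [s] from [p]
    costs a Laplacian of order [|f_x|^2 / s^2], while strict plurisubharmonicity gives [rho o f] a
    Laplacian of at least a multiple of [|f_x|^2]. The multiple of [rho] that compensates is of
    order [1 / s^2], with value of order [delta / s^2] at the pole: bounded precisely because [s^2]
    is proportional to [delta]. The factor [s^2] then becomes the [delta] of the estimate.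

    The squared distance is that of an inner product invariant under [J p]. For a constant structure
    its gradient satisfies the inequality that makes its logarithm subharmonic; variation of [J]
    adds an error which is small relative to these terms, of the order of the distance, and a
    correction in the square root of the squared distance absorbs it.

    Superharmonicity of [- u] alone would not bound its gradient; hence the tangential estimate has
    to be available at all points of a smaller disc before the normal one at the origin. *)

Section Jets.
Context {R : realType}.
Implicit Types (h : R -> R) (t a b : R).

Lemma near_all (T : topologicalType) (t : T) (P : T -> Prop) :
  (forall s, P s) -> \forall s \near t, P s.
Proof. exact: (@nearW T (nbhs t)). Qed.

Lemma near_comp (T U : topologicalType) (f : T -> U) (t : T) (P : U -> Prop) :
  {for t, continuous f} -> (\forall y \near f t, P y) ->
  \forall s \near t, P (f s).
Proof. by move=> fc /fc. Qed.

(** The second derivative exists at the single point [t], without continuity: this is what the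
    second-derivative test uses, and it is stable under composition. *)
Definition jet h t a b : Prop :=
  exists h' : R -> R, [/\ \forall s \near t, is_derive (s : R) 1 h (h' s),
    h' t = a & is_derive t 1 h' b].

Lemma is_derive_continuous h t a : is_derive t 1 h a -> {for t, continuous h}.
Proof.
by move=> [d _]; apply: differentiable_continuous; apply/derivable1_diffP.
Qed.

Lemma jet_is_derive h t a b : jet h t a b -> is_derive t 1 h a.
Proof. by move=> [h' [/nbhs_singleton d <- _]]. Qed.

Lemma jet_near_eq h g t a b :
  (\forall s \near t, h s = g s) -> jet h t a b -> jet g t a b.
Proof.
move=> hg [h' [d ha d2]]; exists h'; split=> //.
near=> s; have hgs : \forall s' \near s, h s' = g s' by near: s; exact: nbhs_interior.
apply: near_eq_is_derive hgs _; near: s; exact: d.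
Unshelve. all: by end_near. Qed.

Lemma jet_eq h t a b a' b' : jet h t a b -> a = a' -> b = b' -> jet h t a' b'.
Proof. by move=> ? <- <-. Qed.

Lemma jet_cst c t : jet (fun=> c) t 0 0.
Proof.
exists (fun=> 0); split=> //; last exact: is_derive_cst.
by apply: near_all => s; exact: is_derive_cst.
Qed.

Lemma jet_id t : jet id t 1 0.
Proof.
exists (fun=> 1); split=> //; last exact: is_derive_cst.
by apply: near_all => s; exact: is_derive_id.
Qed.

Lemma jetD h g t a b a' b' : jet h t a b -> jet g t a' b' ->
  jet (fun s => h s + g s) t (a + a') (b + b').
Proof.
move=> [h' [d ha d2]] [g' [e ga e2]]; exists (fun s => h' s + g' s); split.
- near=> s; apply: (is_deriveD (f := h) (g := g)); near: s; [exact: d|exact: e].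
- by rewrite ha ga.
- exact: (is_deriveD (f := h') (g := g')).
Unshelve. all: by end_near. Qed.

Lemma jet_comp (k k' : R -> R) h t a b k2 : jet h t a b ->
  (\forall s \near h t, is_derive (s : R) 1 k (k' s)) -> is_derive (h t) 1 k' k2 ->
  jet (k \o h) t (k' (h t) * a) (k2 * a ^+ 2 + k' (h t) * b).
Proof.
move=> jh dk dk2; have dh := jet_is_derive jh.
case: jh => h' [d ha d2]; exists (fun s => k' (h s) * h' s); split.
- have dkh : \forall s \near t, is_derive (h s) 1 k (k' (h s)).
    exact: near_comp (is_derive_continuous dh) dk.
  near=> s.
  have ds : is_derive (s : R) 1 h (h' s) by near: s; exact: d.
  have dks : is_derive (h s) 1 k (k' (h s)) by near: s; exact: dkh.
  exact: is_derive1_comp.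
- by rewrite ha.
- rewrite (_ : (fun s : R => _) = (k' \o h) * h') //.
  have dkh : is_derive t 1 (k' \o h) (k2 * a) by exact: is_derive1_comp.
  apply: is_derive_eq (is_deriveM dkh d2) _.
  by rewrite /= ha /GRing.scale /=; ring.
Unshelve. all: by end_near. Qed.

Lemma jet_sqr h t a b : jet h t a b ->
  jet (fun s => h s ^+ 2) t (2 * h t * a) (2 * a ^+ 2 + 2 * h t * b).
Proof.
move=> jh.
have d1 s : is_derive (s : R) 1 (fun x : R => x ^+ 2) (2 * s).
  apply: (is_derive_eq (f := (id : R -> R) * id)).
  by rewrite /GRing.scale /=; ring.
have d2 s : is_derive (s : R) 1 (fun x : R => 2 * x) 2.
  apply: (is_derive_eq (f := (cst 2 : R -> R) * id)).
  by rewrite /GRing.scale /=; ring.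
by apply: (jet_comp (k := fun x => x ^+ 2) (k' := fun x => 2 * x) jh);
  first exact: near_all.
Qed.

Lemma jetZ c h t a b : jet h t a b -> jet (fun s => c * h s) t (c * a) (c * b).
Proof.
move=> jh.
have d2 s : is_derive (s : R) 1 (fun x : R => c * x) c.
  apply: (is_derive_eq (f := (cst c : R -> R) * id)).
  by rewrite /GRing.scale /=; ring.
have := jet_comp (k := fun x => c * x) (k' := fun=> c) (k2 := 0) jh.
move=> /(_ (near_all _ d2)) /(_ (is_derive_cst _ _ _)) jc.
by apply: jet_eq jc _ _; ring.
Qed.

Lemma mean_value h h' (x y : R) : x < y ->
  (forall z, x <= z <= y -> is_derive z 1 h (h' z)) ->
  exists2 z, x < z < y & h y - h x = h' z * (y - x).
Proof.
move=> xy dh; have [| |z] := @MVT R h h' x y xy.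
- by move=> z; rewrite in_itv /= => /andP[zx zy]; apply: dh; rewrite !ltW.
- apply: derivable_within_continuous => z; rewrite in_itv /= => zxy.
  by have [] := dh z zxy.
- by rewrite in_itv /=; exists z.
Qed.

(** If [b > 0], then [h'] exceeds [a] just to the right of [t] and is below [a] just to the left.
    The mean value theorem gives a larger value on the right when [0 <= a], on the left when
    [a < 0]; so [a = 0] need not be proved first. *)
Lemma jet_max_le0 h t a b : jet h t a b ->
  (\forall s \near t, h s <= h t) -> b <= 0.
Proof.
move=> [h' [d ha [d2 b_eq]]] hmax; rewrite leNgt; apply/negP => b0.
have /cvgrPdist_lt /(_ _ b0) : h^-1 *: (h' (h *: 1 + t) - h' t) @[h --> 0^'] --> b.
  by rewrite -b_eq; exact: d2.
move=> [e /= e0 He].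
have [e1 /= e10 He1] : exists2 e1 : R, 0 < e1 & forall s, `|s - t| < e1 ->
    is_derive (s : R) 1 h (h' s) /\ h s <= h t.
  have [e1 /= e10 He1] := (nbhs_ballP _ _).1 (filterI d hmax).
  exists e1 => // s st.
  by apply: He1; rewrite /ball /= distrC.
have slope s : `|s - t| < e -> s != t -> 0 < (s - t)^-1 * (h' s - h' t).
  move=> st nst; have := He (s - t); rewrite /ball /= sub0r normrN => /(_ st).
  rewrite subr_eq0 => /(_ nst); rewrite /GRing.scale /= mulr1 subrK.
  by move=> /ltr_distlBl; rewrite subrr.
pose m := Num.min e e1 / 2.
have m0 : 0 < m by rewrite divr_gt0 // lt_min e0 e10.
have [me me1] : m < e /\ m < e1.
  have : m < Num.min e e1 by rewrite /m; move: m0; rewrite /m; lra.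
  by rewrite lt_min => /andP.
have [ha0|ha0] := leP 0 a.
- have [|z|z /andP[z1 z2] hz] := @mean_value h h' t (t + m).
  + by lra.
  + by move=> z12; apply: (He1 _ _).1; rewrite ger0_norm; lra.
  + have zt : 0 < z - t by lra.
    have : 0 < (z - t)^-1 * (h' z - h' t).
      by apply: slope; [rewrite gtr0_norm; lra|rewrite -subr_eq0 gt_eqF].
    rewrite pmulr_rgt0 ?invr_gt0 // ha => hz'.
    have : h (t + m) <= h t by apply: (He1 _ _).2; rewrite ger0_norm; lra.
    have : 0 < h' z * (t + m - t) by apply: mulr_gt0; lra.
    by lra.
- have [|z|z /andP[z1 z2] hz] := @mean_value h h' (t - m) t.
  + by lra.
  + by move=> z12; apply: (He1 _ _).1; rewrite ler0_norm; lra.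
  + have zt : z - t < 0 by lra.
    have : 0 < (z - t)^-1 * (h' z - h' t).
      by apply: slope; [rewrite ltr0_norm; lra|rewrite -subr_eq0 lt_eqF].
    rewrite nmulr_rgt0 ?invr_lt0 // ha => hz'.
    have : h (t - m) <= h t by apply: (He1 _ _).2; rewrite ler0_norm; lra.
    have : h' z * (t - (t - m)) < 0 by rewrite nmulr_rlt0; lra.
    by lra.
Qed.

End Jets.

Section PlanarJets.
Context {R : realType}.
Implicit Types (u w : R * R -> R) (z a : R * R).

(** The two pure second derivatives stay existential, as only their sum, the Laplacian, enters the
    maximum principle. *)
Definition pjet u z gx gy l : Prop := exists lx ly,
  [/\ jet (fun x => u (x, z.2)) z.1 gx lx, jet (fun y => u (z.1, y)) z.2 gy ly
    & lx + ly = l].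

Lemma near_row z (P : R * R -> Prop) :
  (\forall z' \near z, P z') -> \forall x \near z.1, P (x, z.2).
Proof.
case: z => x y [[A B] /= [nA nB] AB]; apply: filterS nA => s As.
by apply: AB; split=> //=; exact: nbhs_singleton nB.
Qed.

Lemma near_column z (P : R * R -> Prop) :
  (\forall z' \near z, P z') -> \forall y \near z.2, P (z.1, y).
Proof.
case: z => x y [[A B] /= [nA nB] AB]; apply: filterS nB => s Bs.
by apply: AB; split=> //=; exact: nbhs_singleton nA.
Qed.

Lemma pjet_near_eq u w z gx gy l : (\forall z' \near z, u z' = w z') ->
  pjet u z gx gy l -> pjet w z gx gy l.
Proof.
move=> uw [lx [ly [jx jy e]]]; exists lx, ly; split=> //.
- by apply: jet_near_eq jx; exact: near_row uw.
- by apply: jet_near_eq jy; exact: near_column uw.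
Qed.

Lemma pjet_eq u z gx gy l gx' gy' l' : pjet u z gx gy l ->
  gx = gx' -> gy = gy' -> l = l' -> pjet u z gx' gy' l'.
Proof. by move=> ? <- <- <-. Qed.

Lemma pjet_cst c z : pjet (fun=> c) z 0 0 0.
Proof.
by exists 0, 0; split; [exact: jet_cst|exact: jet_cst|rewrite addr0].
Qed.

Lemma pjetD u w z gx gy l gx' gy' l' : pjet u z gx gy l ->
  pjet w z gx' gy' l' ->
  pjet (fun z => u z + w z) z (gx + gx') (gy + gy') (l + l').
Proof.
move=> [lx [ly [jx jy <-]]] [lx' [ly' [jx' jy' <-]]].
exists (lx + lx'), (ly + ly'); split; [exact: jetD|exact: jetD|].
by rewrite addrACA.
Qed.

Lemma pjetZ c u z gx gy l : pjet u z gx gy l ->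
  pjet (fun z => c * u z) z (c * gx) (c * gy) (c * l).
Proof.
move=> [lx [ly [jx jy <-]]]; exists (c * lx), (c * ly).
by split; [exact: jetZ|exact: jetZ|rewrite mulrDr].
Qed.

Lemma pjet_comp (k k' : R -> R) u z gx gy l k2 : pjet u z gx gy l ->
  (\forall s \near u z, is_derive (s : R) 1 k (k' s)) ->
  is_derive (u z) 1 k' k2 ->
  pjet (fun z => k (u z)) z (k' (u z) * gx) (k' (u z) * gy)
    (k2 * (gx ^+ 2 + gy ^+ 2) + k' (u z) * l).
Proof.
case: z => x y [lx [ly [/= jx jy <-]]] dk dk2.
have jx' := jet_comp jx dk dk2; have jy' := jet_comp jy dk dk2.
by eexists _, _; split; [exact: jx'|exact: jy'|ring].
Qed.

Lemma pjet_sqr u z gx gy l : pjet u z gx gy l ->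
  pjet (fun z => u z ^+ 2) z (2 * u z * gx) (2 * u z * gy)
    (2 * (gx ^+ 2 + gy ^+ 2) + 2 * u z * l).
Proof.
case: z => x y [lx [ly [/= jx jy <-]]].
have jx' := jet_sqr jx; have jy' := jet_sqr jy.
by eexists _, _; split; [exact: jx'|exact: jy'|rewrite /=; ring].
Qed.

Lemma pjet_fst z : pjet fst z 1 0 0.
Proof.
by exists 0, 0; split; [exact: jet_id|exact: jet_cst|rewrite addr0].
Qed.

Lemma pjet_snd z : pjet snd z 0 1 0.
Proof.
by exists 0, 0; split; [exact: jet_cst|exact: jet_id|rewrite addr0].
Qed.

Lemma pjet_max_le0 u z gx gy l : pjet u z gx gy l ->
  (\forall z' \near z, u z' <= u z) -> l <= 0.
Proof.
case: z => x y [lx [ly [jx jy <-]]] umax.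
have lx0 := jet_max_le0 jx (near_row umax).
have ly0 := jet_max_le0 jy (near_column umax).
by lra.
Qed.

Definition sqdist a z : R := (z.1 - a.1) ^+ 2 + (z.2 - a.2) ^+ 2.

Lemma pjet_sqdist a z :
  pjet (sqdist a) z (2 * (z.1 - a.1)) (2 * (z.2 - a.2)) 4.
Proof.
have jx := pjet_sqr (pjetD (pjet_fst z) (pjet_cst (- a.1) z)).
have jy := pjet_sqr (pjetD (pjet_snd z) (pjet_cst (- a.2) z)).
by apply: pjet_eq (pjetD jx jy) _ _ _; ring.
Qed.

Lemma sqdist_ge0 a z : 0 <= sqdist a z.
Proof. by rewrite addr_ge0 ?sqr_ge0. Qed.

Lemma sqdist_continuous a : continuous (sqdist a).
Proof.
move=> z; apply: cvgD; apply: (@cvgM R _ (nbhs z)).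
all: by apply: cvgB; [first [exact: cvg_fst|exact: cvg_snd]|exact: cvg_cst].
Qed.

Lemma closed_sub_disc_compact (K : set (R * R)) a r : closed K ->
  (forall z, K z -> sqdist a z <= r ^+ 2) -> compact K.
Proof.
move=> Kcl Kr.
apply: (subclosed_compact Kcl (compact_setX
  (@segment_compact _ (a.1 - `|r|) (a.1 + `|r|))
  (@segment_compact _ (a.2 - `|r|) (a.2 + `|r|)))).
move=> [x y] /Kr; rewrite /sqdist /= => xyr.
have main (t : R) : t ^+ 2 <= r ^+ 2 -> - `|r| <= t <= `|r|.
  by move=> tr; rewrite -ler_norml -(@ler_pXn2r _ 2) ?nnegrE // !real_normK ?num_real.
have /main/andP[? ?] : (x - a.1) ^+ 2 <= r ^+ 2.
  by apply: le_trans xyr; rewrite lerDl sqr_ge0.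
have /main/andP[? ?] : (y - a.2) ^+ 2 <= r ^+ 2.
  by apply: le_trans xyr; rewrite lerDr sqr_ge0.
by split; rewrite /= in_itv /=; lra.
Qed.

(** The boundary condition is encoded by requiring that points where [u] is positive be interior to
    [K]: a positive maximum over [K] is then a local maximum in the plane. *)
Lemma compact_no_max_le0 (K : set (R * R)) u : compact K ->
  (forall z, K z -> {for z, continuous u}) ->
  (forall z, K z -> 0 < u z ->
     nbhs z K /\ ~ (\forall z' \near z, u z' <= u z)) ->
  forall z, K z -> u z <= 0.
Proof.
move=> Kc uc H z Kz.
have [||c /set_mem Kcc cmax] := @compact_EVT_max _ _ u K _ Kc.
- by exists z.
- by apply: continuous_in_subspaceT => x /set_mem /uc.
rewrite leNgt; apply/negP => uz0.
have uc0 : 0 < u c by apply: lt_le_trans uz0 _; apply: cmax; exact/mem_set.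
have [Kn] := H c Kcc uc0; apply.
by apply: filterS Kn => z' Kz'; apply: cmax; exact/mem_set.
Qed.

Lemma max_principle (K : set (R * R)) u : compact K ->
  (forall z, K z -> {for z, continuous u}) ->
  (forall z, K z -> 0 < u z ->
     nbhs z K /\ exists gx gy l, pjet u z gx gy l /\ 0 < l) ->
  forall z, K z -> u z <= 0.
Proof.
move=> Kc uc H; apply: compact_no_max_le0 => // z Kz uz.
have [Kn [gx [gy [l [jl l0]]]]] := H z Kz uz; split=> // umax.
by move: (pjet_max_le0 jl umax); rewrite leNgt l0.
Qed.

End PlanarJets.

(** * Gradient and Harnack estimates in the plane *)

Section GradientEstimate.
Context {R : realType}.
Implicit Types (u w : R * R -> R) (z a : R * R).

Lemma closed_sublevel (T : topologicalType) (f : T -> R) (c : R) :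
  continuous f -> closed [set z | f z <= c].
Proof.
move=> fc; apply: (preimage_closed _ (@closed_le R c)) => z _; exact: fc.
Qed.

Lemma closed_superlevel (T : topologicalType) (f : T -> R) (c : R) :
  continuous f -> closed [set z | c <= f z].
Proof.
move=> fc; apply: (preimage_closed _ (@closed_ge R c)) => z _; exact: fc.
Qed.

Lemma near_lt (T : topologicalType) (f : T -> R) (z : T) (c : R) :
  {for z, continuous f} -> f z < c -> \forall z' \near z, f z' < c.
Proof. by move=> fc fz; exact: (cvgr_lt _ fc _ fz). Qed.

Lemma near_gt (T : topologicalType) (f : T -> R) (z : T) (c : R) :
  {for z, continuous f} -> c < f z -> \forall z' \near z, c < f z'.
Proof. by move=> fc fz; exact: (cvgr_gt _ fc _ fz). Qed.

Lemma is_derive_right_le0 (h : R -> R) (t c d : R) : 0 < d -> is_derive t 1 h c ->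
  (forall s, t < s < t + d -> h s <= h t) -> c <= 0.
Proof.
move=> d0 [dh dc] hle; rewrite leNgt; apply/negP => c0.
have /cvgrPdist_lt /(_ _ c0) : s^-1 *: (h (s *: 1 + t) - h t) @[s --> 0^'] --> c.
  by rewrite -dc; exact: dh.
move=> [e /= e0 He].
pose m := Num.min e d / 2.
have m0 : 0 < m by rewrite divr_gt0 // lt_min e0 d0.
have [me md] : m < e /\ m < d.
  have : m < Num.min e d by rewrite /m; move: m0; rewrite /m; lra.
  by rewrite lt_min => /andP.
have := He m; rewrite /ball /= sub0r normrN gtr0_norm // => /(_ me).
rewrite gt_eqF // => /(_ isT); rewrite /GRing.scale /= mulr1.
move=> /ltr_distlBl; rewrite subrr pmulr_rgt0 ?invr_gt0 //.
by have := hle (m + t); lra.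
Qed.

Lemma pjet_reflect u z gx gy l c : pjet u (z.1, c - z.2) gx gy l ->
  pjet (fun z => u (z.1, c - z.2)) z gx (- gy) l.
Proof.
case: z => x y [lx [ly [/= jx jy e]]]; exists lx, ly; split => //=.
have ji : jet (fun s : R => c - s) y (-1) 0.
  have := jetD (jet_cst c y) (jetZ (-1) (jet_id y)).
  rewrite (_ : (fun s : R => c + -1 * s) = (fun s => c - s)); last first.
    by apply/funext => s; rewrite mulN1r.
  by move=> j; apply: jet_eq j _ _; ring.
have [h' [d ha d2]] := jy.
have := jet_comp ji d d2; rewrite /= ha => j.
by apply: jet_eq j _ _; ring.
Qed.

Lemma pjet_swap u z gx gy l : pjet u (z.2, z.1) gx gy l ->
  pjet (fun z => u (z.2, z.1)) z gy gx l.
Proof.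
case: z => x y [lx [ly [/= jx jy e]]]; exists ly, lx; split => //=.
by rewrite addrC.
Qed.

Lemma continuous_reflect u z c : {for (z.1, c - z.2), continuous u} ->
  {for z, continuous (fun z => u (z.1, c - z.2))}.
Proof.
move=> uc; apply: (continuous_comp (f := fun z : R * R => (z.1, c - z.2))) => //.
apply: (@cvg_pair _ _ _ (nbhs z) (nbhs z.1) (nbhs (c - z.2))); first exact: cvg_fst.
by apply: cvgB; [exact: cvg_cst|exact: cvg_snd].
Qed.

Definition bounded_pjet u (M N : R) z : Prop :=
  [/\ {for z, continuous u}, `|u z| <= M &
    exists gx gy l, pjet u z gx gy l /\ `|l| <= N].

(* Comparison on the upper half disc: the odd part of [u] in the vertical
   direction vanishes on the diameter and is dominated by the barrier [psi]. *)
Lemma vertical_gradient_le u a (d M N gx gy l : R) : 0 < d -> 0 < M ->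
  (forall z, sqdist a z <= d ^+ 2 -> bounded_pjet u M N z) ->
  pjet u a gx gy l -> 2 * gy <= 5 * M / d + N * d.
Proof.
move=> d0 M0 H ja.
have N0 : 0 <= N.
  have [|_ _ [? [? [l' [_ /(le_trans _)->]]]]] := H a; last by [].
    by rewrite /sqdist !subrr expr0n /= addr0 sqr_ge0.
  by [].
(* With this [b] the Laplacian of [psi] is [- 2 * M / d ^+ 2 - 2 * N], strictly below that of the
   odd part [phi]. With [L = b * d], the term [L * y - b * y ^+ 2] is nonnegative for [0 <= y <= d],
   whence [psi >= 2 * M >= phi] on the arc. *)
pose b := 5 * M / d ^+ 2 + N; pose L := b * d.
have d20 : 0 < d ^+ 2 by rewrite exprn_gt0.
have Md : 0 < M / d ^+ 2 by rewrite divr_gt0.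
have Mdd : M / d ^+ 2 * d ^+ 2 = M by rewrite divfK ?gt_eqF.
have bE : b = 5 * (M / d ^+ 2) + N by rewrite /b; ring.
pose c := 2 * a.2.
pose psi z := 2 * (M / d ^+ 2) * sqdist a z + L * (z.2 - a.2) +
  (- b) * (z.2 - a.2) ^+ 2.
pose phi z := u z + -1 * u (z.1, c - z.2).
pose K : set (R * R) := [set z | sqdist a z <= d ^+ 2 /\ a.2 <= z.2].
have refl z : sqdist a (z.1, c - z.2) = sqdist a z.
  by rewrite /sqdist /c /=; ring.
have phicont z : sqdist a z <= d ^+ 2 -> {for z, continuous phi}.
  move=> zd; have [uc _ _] := H z zd.
  have [uc' _ _] := H (z.1, c - z.2) (eq_ind_r (fun x => x <= _) zd (refl z)).
  apply: cvgD => //; apply: (@cvgM R _ (nbhs z)); first exact: cvg_cst.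
  exact: continuous_reflect.
have psijet z : exists gx gy, pjet psi z gx gy (8 * (M / d ^+ 2) - 2 * b).
  have j1 := pjetZ (2 * (M / d ^+ 2)) (pjet_sqdist a z).
  have j2 := pjetD (pjet_snd z) (pjet_cst (- a.2) z).
  have j := pjetD (pjetD j1 (pjetZ L j2)) (pjetZ (- b) (pjet_sqr j2)).
  by eexists _, _; apply: pjet_eq j erefl erefl _; ring.
have psicont : continuous psi.
  have c2 : continuous (fun z : R * R => z.2 - a.2).
    by move=> z; apply: cvgB; [exact: cvg_snd|exact: cvg_cst].
  move=> z; apply: cvgD; first apply: cvgD.
  - apply: (@cvgM R _ (nbhs z)); first exact: cvg_cst.
    exact: sqdist_continuous.
  - by apply: (@cvgM R _ (nbhs z)); [exact: cvg_cst|exact: c2].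
  - apply: (@cvgM R _ (nbhs z)); first exact: cvg_cst.
    by apply: (@cvgM R _ (nbhs z)); exact: c2.
have snd_continuous : continuous (fun z : R * R => z.2).
  by move=> z; exact: cvg_snd.
have Kcl : closed K.
  rewrite (_ : K = [set z | sqdist a z <= d ^+ 2] `&` [set z | a.2 <= z.2]) //.
  apply: closedI.
    exact: (closed_sublevel (@sqdist_continuous R a)).
  exact: (closed_superlevel snd_continuous).
have Kc : compact K by apply: (closed_sub_disc_compact Kcl (a := a) (r := d)) => z [].
have main z : K z -> phi z - psi z <= 0.
  pose G z := phi z + -1 * psi z.
  suff : forall z, K z -> G z <= 0.
    by move=> HG /HG; rewrite /G mulN1r.
  apply: max_principle => // {}z [zd za].
    apply: cvgD; first exact: phicont.
    by apply: (@cvgM R _ (nbhs z)); [exact: cvg_cst|exact: psicont].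
  move=> Gz.
  have [uc uM [ux [uy [ul [uj uN]]]]] := H z zd.
  have [_ uM' [ux' [uy' [ul' [uj' uN']]]]] :=
    H (z.1, c - z.2) (eq_ind_r (fun x => x <= _) zd (refl z)).
  have y0 : 0 <= z.2 - a.2 by lra.
  have yd : z.2 - a.2 <= d.
    rewrite -(@ler_pXn2r _ 2) ?nnegrE //; last exact: ltW.
    by apply: le_trans zd; rewrite /sqdist lerDr sqr_ge0.
  have Lb : b * (z.2 - a.2) ^+ 2 <= L * (z.2 - a.2).
    rewrite /L expr2 mulrA; apply: ler_wpM2r => //; apply: ler_wpM2l => //.
    by rewrite bE; lra.
  have z2 : a.2 < z.2.
    rewrite lt_neqAle za andbT; apply/eqP => az.
    have : phi z = 0.
      rewrite /phi /c -az (_ : 2 * a.2 - a.2 = a.2); last by ring.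
      by rewrite [in u (_, _)]az -surjective_pairing; ring.
    have : 0 <= 2 * (M / d ^+ 2) * sqdist a z.
      by apply: mulr_ge0; [lra|exact: sqdist_ge0].
    by move: Gz; rewrite /G /psi; lra.
  have zlt : sqdist a z < d ^+ 2.
    rewrite lt_neqAle zd andbT; apply/eqP => zde.
    have : phi z <= 2 * M.
      by rewrite /phi; have := ler_norm (u z); have := ler_norm (- u (z.1, c - z.2));
         rewrite normrN; lra.
    by move: Gz; rewrite /G /psi zde -mulrA Mdd; lra.
  split.
    apply: filterI.
      apply: (@filterS _ _ _ (fun z => sqdist a z < d ^+ 2)); first by move=> ? /ltW.
      exact: near_lt (@sqdist_continuous R a z) zlt.
    apply: (@filterS _ _ _ (fun z : R * R => a.2 < z.2)); first by move=> ? /ltW.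
    exact: near_gt (snd_continuous z) z2.
  have [px [py pj]] := psijet z.
  have j := pjetD (pjetD uj (pjetZ (-1) (pjet_reflect uj'))) (pjetZ (-1) pj).
  do 3!eexists; split; first exact: j.
  move: uN uN'; rewrite !ler_norml => /andP[? ?] /andP[? ?].
  by rewrite bE; lra.
have [|_ _ [_ [_ [_ [_ _]]]]] := H a; first by rewrite /sqdist !subrr expr0n addr0 sqr_ge0.
have jr : pjet (fun z => u (z.1, c - z.2)) a gx (- gy) l.
  by apply: pjet_reflect; rewrite /c (_ : 2 * a.2 - a.2 = a.2) -?surjective_pairing; last ring.
have j1 := pjetD (pjetD ja (pjetZ (-1) jr))
  (pjetZ (- L) (pjetD (pjet_snd a) (pjet_cst (- a.2) a))).
have [lx [ly [_ /jet_is_derive dy _]]] := j1.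
(* On the vertical segment above [a], [phi <= psi] and [b > 2 * M / d ^+ 2] give [phi <= L * y],
   with equality at [a]; so the derivative [2 * gy - L] is nonpositive. *)
have : gy + -1 * (- gy) + - L * (1 + 0) <= 0.
  apply: (is_derive_right_le0 d0 dy) => s /andP[s1 s2] /=.
  have Ks : K (a.1, s).
    split; last by rewrite /= ltW.
    rewrite /sqdist /= subrr expr0n add0r /=.
    by rewrite ler_pXn2r ?nnegrE //; lra.
  have := main _ Ks; rewrite /phi /psi /= /sqdist /= subrr expr0n add0r /=.
  have : 0 <= (b - 2 * (M / d ^+ 2)) * (s - a.2) ^+ 2.
    by apply: mulr_ge0; [rewrite bE; lra|exact: sqr_ge0].
  rewrite /c (_ : 2 * a.2 - a.2 = a.2); last by ring.
  by lra.
have -> : 5 * M / d + N * d = L.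
  by rewrite /L /b; field; rewrite gt_eqF.
by lra.
Qed.

End GradientEstimate.

Section PlanarEstimates.
Context {R : realType}.
Implicit Types (u w : R * R -> R) (z a : R * R).

(** The upper bound for the vertical derivative, applied also to [-1 * u] and to [u] with its
    coordinates exchanged, yields the four inequalities. *)
Lemma gradient_le u a (d M N gx gy l : R) : 0 < d -> 0 < M ->
  (forall z, sqdist a z <= d ^+ 2 -> bounded_pjet u M N z) ->
  pjet u a gx gy l ->
  2 * `|gx| <= 5 * M / d + N * d /\ 2 * `|gy| <= 5 * M / d + N * d.
Proof.
move=> d0 M0 H ja.
pose B := 5 * M / d + N * d.
have vert w b (hx hy k : R) :
    (forall z, sqdist b z <= d ^+ 2 -> bounded_pjet w M N z) ->
    pjet w b hx hy k -> 2 * `|hy| <= B.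
  move=> Hw jb.
  have up : 2 * hy <= B by exact: vertical_gradient_le jb.
  have dn : 2 * (-1 * hy) <= B.
    apply: (vertical_gradient_le d0 M0 _ (pjetZ (-1) jb)) => z zd.
    have [wc wM [wx [wy [wl [wj wN]]]]] := Hw z zd; split.
    - by apply: (@cvgM R _ (nbhs z)); [exact: cvg_cst|exact: wc].
    - by rewrite mulN1r normrN.
    - by do 3!eexists; split; [exact: pjetZ wj|rewrite mulN1r normrN].
  by case: (ger0P hy) => _; lra.
split; last exact: vert H ja.
have js : pjet (fun z => u (z.2, z.1)) (a.2, a.1) gy gx l.
  by apply: pjet_swap; rewrite /= -surjective_pairing.
apply: vert js => z zd.
have [|uc uM [ux [uy [ul [uj uN]]]]] := H (z.2, z.1).
  by move: zd; rewrite /sqdist /= addrC.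
split=> //.
- apply: (continuous_comp (f := fun z : R * R => (z.2, z.1))) => //.
  apply: (@cvg_pair _ _ _ (nbhs z) (nbhs z.2) (nbhs z.1)).
    exact: cvg_snd.
  exact: cvg_fst.
- by do 3!eexists; split; [exact: pjet_swap uj|].
Qed.

Lemma derivative_bound (h h' : R -> R) (x y B : R) :
  (forall s, `|s - x| <= `|y - x| ->
    is_derive (s : R) 1 h (h' s) /\ `|h' s| <= B) ->
  `|h y - h x| <= B * `|y - x|.
Proof.
move=> H; have [xy|yx|->] := ltgtP x y; last by rewrite !subrr normr0 mulr0.
- have [z zxy|z /andP[z1 z2] ->] := @mean_value R h h' x y xy.
    by apply: (H z _).1; rewrite !ger0_norm; lra.
  rewrite normrM; apply: ler_wpM2r => //.
  by apply: (H z _).2; rewrite !ger0_norm; lra.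
- have [z zxy|z /andP[z1 z2] e] := @mean_value R h h' y x yx.
    by apply: (H z _).1; rewrite !ler0_norm; lra.
  rewrite distrC e normrM (distrC y x); apply: ler_wpM2r => //.
  by apply: (H z _).2; rewrite !ler0_norm; lra.
Qed.

(** The path runs horizontally, then vertically, through the corner [(z.1, a.2)]; along both legs
    [sqdist a] stays at most its value at [z]. *)
Lemma segment_bound u a (s B : R) : 0 <= B ->
  (forall z, sqdist a z <= s -> exists gx gy l,
     [/\ pjet u z gx gy l, `|gx| <= B & `|gy| <= B]) ->
  forall z, sqdist a z <= s ->
  `|u z - u a| <= B * (`|z.1 - a.1| + `|z.2 - a.2|).
Proof.
move=> B0 H [x y] /=; case: a H => a1 a2; rewrite /sqdist /= => H zs.
have sq (t t' : R) : `|t| <= `|t'| -> t ^+ 2 <= t' ^+ 2.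
  by move=> tt; rewrite -(real_normK (num_real t)) -(real_normK (num_real t'))
    ler_pXn2r ?nnegrE.
have {}H z : sqdist (a1, a2) z <= s -> exists g : R * R,
    [/\ is_derive z.1 1 (fun t => u (t, z.2)) g.1,
     is_derive z.2 1 (fun t => u (z.1, t)) g.2, `|g.1| <= B & `|g.2| <= B].
  move=> /H [gx [gy [l [[lx [ly [/jet_is_derive jx /jet_is_derive jy _]]] bx byy]]]].
  by exists (gx, gy).
(* The mean value theorem needs the derivatives as functions along each leg; they are selected by
   choice. *)
have {}H z : { g : R * R | sqdist (a1, a2) z <= s ->
    [/\ is_derive z.1 1 (fun t => u (t, z.2)) g.1,
     is_derive z.2 1 (fun t => u (z.1, t)) g.2, `|g.1| <= B & `|g.2| <= B]}.
  apply: cid; have [zs'|zs'] := pselect (sqdist (a1, a2) z <= s).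
    by have [g gP] := H z zs'; exists g.
  by exists 0 => /zs'.
have horiz : `|u (x, a2) - u (a1, a2)| <= B * `|x - a1|.
  apply: (@derivative_bound (fun t => u (t, a2)) (fun t => (sval (H (t, a2))).1)).
  move=> t tx; have [] := svalP (H (t, a2)); last by [].
  rewrite /sqdist /= subrr expr0n addr0; apply: le_trans zs.
  by apply: (le_trans (sq _ _ tx)); rewrite lerDl sqr_ge0.
have vert : `|u (x, y) - u (x, a2)| <= B * `|y - a2|.
  apply: (@derivative_bound (fun t => u (x, t)) (fun t => (sval (H (x, t))).2)).
  move=> t tx; have [] := svalP (H (x, t)); last by [].
  rewrite /sqdist /=; apply: le_trans zs.
  by rewrite lerD2l; exact: sq.
rewrite mulrDr [leRHS]addrC -(subrKA (u (x, a2))).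
by apply: (le_trans (ler_normD _ _)); exact: lerD.
Qed.

Lemma sqdistC a z : sqdist a z = sqdist z a.
Proof. by rewrite /sqdist; ring. Qed.

Lemma sqdist_triangle_le (a w z : R * R) (r t : R) : 0 <= r -> 0 <= t ->
  sqdist a w <= r ^+ 2 -> sqdist w z <= t ^+ 2 -> sqdist a z <= (r + t) ^+ 2.
Proof.
move=> r0 t0 aw wz.
pose p := (w.1 - a.1) * (z.1 - w.1) + (w.2 - a.2) * (z.2 - w.2).
have cs : p ^+ 2 <= sqdist a w * sqdist w z.
  rewrite -subr_ge0 (_ : _ - _ =
    ((w.1 - a.1) * (z.2 - w.2) - (w.2 - a.2) * (z.1 - w.1)) ^+ 2) ?sqr_ge0 //.
  by rewrite /p /sqdist; ring.
have p2 : p ^+ 2 <= (r * t) ^+ 2.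
  by apply: (le_trans cs); rewrite exprMn; apply: ler_pM => //; exact: sqdist_ge0.
have prt : p <= r * t.
  apply: (le_trans (ler_norm _)).
  by rewrite -(@ler_pXn2r _ 2) ?nnegrE ?mulr_ge0 // real_normK ?num_real.
have -> : sqdist a z = sqdist a w + 2 * p + sqdist w z.
  by rewrite /p /sqdist; ring.
rewrite sqrrD; lra.
Qed.

End PlanarEstimates.

(** * A Harnack inequality from the maximum principle *)

Section WeightedHarnack.
Context {R : realType}.
Implicit Types (u w : R * R -> R) (z a : R * R).
Let O : R * R := (0, 0).

Definition harmonic_like (C : R) u z : Prop :=
  [/\ 0 < u z, {for z, continuous u} &
    exists gx gy l, [/\ pjet u z gx gy l, - C * u z <= l & l <= 0]].

Lemma harmonic_like_bounded C u (M : R) z : 0 <= C -> harmonic_like C u z ->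
  u z <= M -> bounded_pjet u M (C * M) z.
Proof.
move=> C0 [u0 uc [gx [gy [l [j l1 l2]]]]] uM; split=> //.
  by rewrite gtr0_norm.
exists gx, gy, l; split=> //; rewrite ler0_norm //.
have : C * u z <= C * M by exact: ler_wpM2l.
by lra.
Qed.

Lemma pjet_inv u z gx gy l : u z != 0 -> pjet u z gx gy l ->
  pjet (fun z => (u z)^-1) z (- (u z) ^- 2 * gx) (- (u z) ^- 2 * gy)
    (2 * (u z) ^- 3 * (gx ^+ 2 + gy ^+ 2) - (u z) ^- 2 * l).
Proof.
move=> uz0 j.
have d1 (s : R) : s != 0 -> is_derive (s : R) 1 (fun x : R => x^-1) (- s ^- 2).
  move=> s0; apply: is_derive_eq; first exact: is_deriveV.
  by rewrite /GRing.scale /= mulr1.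
have d2 (s : R) : s != 0 -> is_derive (s : R) 1 (fun x : R => - x ^- 2) (2 * s ^- 3).
  move=> s0; rewrite (_ : (fun x : R => - x ^- 2) =
    - ((fun x : R => x^-1) * (fun x : R => x^-1))); last first.
    by apply/funext => x; rewrite /= -exprVn expr2.
  apply: is_derive_eq; first exact: is_deriveN (is_deriveM (d1 s s0) (d1 s s0)).
  by rewrite /GRing.scale /=; field.
apply: pjet_eq; first apply: (pjet_comp (k := fun x => x^-1)
  (k' := fun x => - x ^- 2) j _ (d2 _ uz0)).
- have n0 : \forall s \near u z, s != 0 by exact: (cvgr_neq0 _ (@cvg_id _ (nbhs (u z)))).
  by apply: filterS n0 => s; exact: d1.
- by [].
- by [].
- by rewrite mulNr.
Qed.

(* Subharmonicity of [1 / sqdist a] away from [a] gives the barrier. *)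
Lemma superharmonic_lower C u a (M t : R) : 0 < M -> 0 < t -> t < 1 / 12 ->
  sqdist a O <= 1 / 16 ->
  (forall z, sqdist a z <= 1 / 4 -> harmonic_like C u z) ->
  (forall z, sqdist a z <= t -> M / 2 <= u z) -> 6 * M * t <= u O.
Proof.
move=> M0 t0 t12 aO H Ht.
(* If the origin lies in the small disc, then [u O >= M / 2], which is at least [6 * M * t] because
   [t < 1 / 12]. *)
have [aOt|taO] := leP (sqdist a O) t.
  have Mt : M * t <= M * (1 / 12) by rewrite ler_wpM2l // ltW.
  by have := Ht O aOt; lra.
(* Normalisation of the barrier [b]: it equals [M / 2] where [sqdist a = t] and vanishes where
   [sqdist a = 1 / 4]. *)
pose g := M / 2 * t / (1 - 4 * t).
have t4 : 0 < 1 - 4 * t by lra.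
have g0 : 0 < g by rewrite /g divr_gt0 // mulr_gt0 // divr_gt0.
have gt : g * (t^-1 - 4) = M / 2.
  by rewrite /g; field; rewrite !gt_eqF.
pose b z := g * ((sqdist a z)^-1 + -4).
pose K : set (R * R) := [set z | t <= sqdist a z] `&` [set z | sqdist a z <= 1 / 4].
have Kcl : closed K.
  apply: closedI.
    exact: (closed_superlevel (@sqdist_continuous R a)).
  exact: (closed_sublevel (@sqdist_continuous R a)).
have Kc : compact K.
  apply: (closed_sub_disc_compact Kcl (a := a) (r := 1 / 2)) => z [_ /=].
  by rewrite (_ : (1 / 2 : R) ^+ 2 = 1 / 4) //; field.
have main : forall z, K z -> b z + -1 * u z <= 0.
  apply: max_principle => // z [/= tz z4]; have [u0 uc [gx [gy [l [j l1 l2]]]]] := H z z4.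
    apply: cvgD; last by apply: (@cvgM R _ (nbhs z)); [exact: cvg_cst|exact: uc].
    apply: (@cvgM R _ (nbhs z)); first exact: cvg_cst.
    apply: cvgD; last exact: cvg_cst.
    by apply: cvgV; [rewrite gt_eqF // (lt_le_trans t0)|exact: sqdist_continuous].
  move=> bu.
  have s0 : 0 < sqdist a z by exact: lt_le_trans tz.
  have tlt : t < sqdist a z.
    rewrite lt_neqAle tz andbT; apply/eqP => te.
    have := Ht z; rewrite -te lexx => /(_ isT).
    by move: bu; rewrite /b -te gt; lra.
  have lt4 : sqdist a z < 1 / 4.
    rewrite lt_neqAle z4 andbT; apply/eqP => te.
    by move: bu; rewrite /b te (_ : (1 / 4 : R)^-1 = 4) ?subrr; [lra|field].
  split.
    apply: filterI.
      apply: filterS (near_gt (@sqdist_continuous R a z) tlt) => z' /=.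
      exact: ltW.
    apply: filterS (near_lt (@sqdist_continuous R a z) lt4) => z' /=.
    exact: ltW.
  have sn0 : sqdist a z != 0 by rewrite gt_eqF.
  have ji := pjet_inv sn0 (pjet_sqdist a z).
  have jb := pjetD (pjetZ g (pjetD ji (pjet_cst (-4) z))) (pjetZ (-1) j).
  do 3!eexists; split; first exact: jb.
  rewrite addr0 (_ : 2 * sqdist a z ^- 3 * _ - _ = 4 * sqdist a z ^- 2); last first.
    rewrite (_ : _ + _ = 4 * sqdist a z); last by rewrite /sqdist; ring.
    by field.
  have : 0 < g * (4 * sqdist a z ^- 2).
    by rewrite mulr_gt0 // mulr_gt0 // invr_gt0 exprn_gt0.
  by lra.
have KO : K O by split => /=; [exact: ltW|lra].
have := main O KO; rewrite /b.
have i16 : 16 <= (sqdist a O)^-1.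
  rewrite -[leLHS]invrK lef_pV2 ?posrE ?invr_gt0 //; last exact: lt_trans taO.
  by rewrite (_ : (16 : R)^-1 = 1 / 16) //; field.
have : g * 12 <= g * ((sqdist a O)^-1 - 4) by apply: ler_wpM2l; [exact: ltW|lra].
have : M / 2 * t <= g.
  rewrite /g ler_peMr //; first by rewrite ltW // mulr_gt0 // divr_gt0.
  by rewrite invf_ge1 //; lra.
by lra.
Qed.

(* The maximum [a] of [q ^+ 2 * u], with [q z = 1 / 16 - sqdist O z], controls
   [u] and hence its gradient near [a], at the scale [q a]; the barrier then
   carries the resulting lower bound to the origin. *)
Lemma weighted_harnack C u : 0 <= C ->
  (forall z, sqdist O z <= 9 / 16 -> harmonic_like C u z) ->
  forall z, sqdist O z <= 1 / 16 ->
    (1 / 16 - sqdist O z) ^+ 2 * u z <= (80 + C) ^+ 2 * u O.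
Proof.
move=> C0 H z0 z0B.
pose q z := 1 / 16 + -1 * sqdist O z; pose W z := q z ^+ 2 * u z.
pose B : set (R * R) := [set z | sqdist O z <= 1 / 16].
have HB z : B z -> harmonic_like C u z by rewrite /B /= => zB; apply: H; lra.
have qc z : {for z, continuous q}.
  apply: cvgD; first exact: cvg_cst.
  by apply: (@cvgM R _ (nbhs z)); [exact: cvg_cst|exact: sqdist_continuous].
have Bc : compact B.
  apply: (closed_sub_disc_compact (closed_sublevel (@sqdist_continuous R O))
    (a := O) (r := 1 / 4)) => z /=.
  by rewrite (_ : (1 / 4 : R) ^+ 2 = 1 / 16) //; field.
have [||a /set_mem aB amax] := @compact_EVT_max _ _ W B _ Bc.
- by exists z0.
- apply: continuous_in_subspaceT => z /set_mem zB.
  have [_ uc _] := HB z zB.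
  apply: (@cvgM R _ (nbhs z)); last exact: uc.
  by apply: (@cvgM R _ (nbhs z)); exact: qc.
have {}amax z : B z -> W z <= W a by move=> zB; apply: amax; exact/mem_set.
have [u0 _ _] := HB a aB.
have BO : B O by rewrite /B /= /sqdist !subrr expr0n /= addr0; lra.
have [uO _ _] := HB O BO.
have Wa : 0 < W a.
  apply: lt_le_trans (amax O BO); rewrite /W mulr_gt0 // exprn_gt0 //.
  by rewrite /q /sqdist !subrr expr0n /=; lra.
have qa0 : 0 < q a.
  have : 0 <= q a by rewrite /q; move: aB; rewrite /B /=; lra.
  rewrite le_eqVlt => /orP[/eqP e|//].
  by move: Wa; rewrite /W -e expr0n /= mul0r ltxx.
have qa1 : q a <= 1 / 16 by rewrite /q; have := sqdist_ge0 O a; lra.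
pose M := u a; pose k := q a; rewrite -/k in qa0 qa1.
have k0 : k != 0 by rewrite gt_eqF.
have Oa : sqdist O a = 1 / 16 - k by rewrite /k /q; ring.
(* Within [k / 2] of [a] the weight [q] keeps at least half of its value [k], because [a] is within
   [1 / 4] of the origin and [k <= 1 / 16]; maximality of [q ^+ 2 * u] gives the factor [4]. *)
have upper z : sqdist a z <= (k / 2) ^+ 2 -> harmonic_like C u z /\ u z <= 4 * M.
  move=> az.
  have Oz : sqdist O z <= 1 / 16 - k / 2.
    pose p := a.1 * (z.1 - a.1) + a.2 * (z.2 - a.2).
    have p2 : p ^+ 2 <= (k / 8) ^+ 2.
      have : p ^+ 2 <= sqdist O a * sqdist a z.
        rewrite -subr_ge0 (_ : _ - _ =
          (a.1 * (z.2 - a.2) - a.2 * (z.1 - a.1)) ^+ 2) ?sqr_ge0 //.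
        by rewrite /p /sqdist /=; ring.
      move=> /le_trans; apply.
      rewrite (_ : (k / 8) ^+ 2 = 1 / 16 * (k / 2) ^+ 2); last by field.
      apply: ler_pM => //; try exact: sqdist_ge0.
    have pk : p <= k / 8.
      apply: (le_trans (ler_norm _)).
      rewrite -(@ler_pXn2r _ 2) ?nnegrE ?real_normK ?num_real //.
      by rewrite divr_ge0 // ltW.
    have -> : sqdist O z = sqdist O a + 2 * p + sqdist a z.
      by rewrite /p /sqdist /=; ring.
    have : (k / 2) ^+ 2 <= k / 64.
      rewrite (_ : (k / 2) ^+ 2 = k * (k / 4)); last by field.
      by rewrite ler_wpM2l; lra.
    by rewrite Oa; lra.
  have zB : B z by rewrite /B /=; lra.
  have hz := HB z zB; split=> //; have [uz0 _ _] := hz.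
  have := amax z zB; rewrite /W -/k -/M => Wz.
  have qz : k / 2 <= q z by rewrite /q; lra.
  have : (k / 2) ^+ 2 * u z <= k ^+ 2 * M.
    apply: le_trans Wz; apply: ler_wpM2r; first exact: ltW.
    by rewrite ler_pXn2r // ?nnegrE; lra.
  rewrite (_ : (k / 2) ^+ 2 * u z = k ^+ 2 * (u z / 4)); last by field.
  by rewrite ler_pM2l ?exprn_gt0 //; lra.
have M0 : 0 < M by [].
(* Twice the bound for each partial derivative, from [gradient_le] on discs of radius [k / 4] where
   [u <= 4 * M]: [5 * (4 * M) / (k / 4)] is [80 * M / k], and the other term is at most
   [C * M / k]. *)
pose A := (80 + C) * M / k.
have A0 : 0 < A by rewrite /A divr_gt0 // mulr_gt0 //; lra.
have grad z : sqdist a z <= (k / 4) ^+ 2 -> exists gx gy l,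
    [/\ pjet u z gx gy l, `|gx| <= A / 2 & `|gy| <= A / 2].
  move=> az; have k4 : 0 < k / 4 by lra.
  have [|[_ _ [gx [gy [l [j _ _]]]]] _] := upper z.
    by apply: (le_trans az); rewrite ler_pXn2r // ?nnegrE; lra.
  have [||gx2 gy2] := gradient_le (M := 4 * M) (N := C * (4 * M)) k4 _ _ j.
  - by lra.
  - move=> w zw; have [|hw uw] := upper w.
      have := @sqdist_triangle_le _ a z w (k / 4) (k / 4) (ltW k4) (ltW k4) az zw.
      by rewrite (_ : k / 4 + k / 4 = k / 2) //; field.
    exact: harmonic_like_bounded.
  have bA : 5 * (4 * M) / (k / 4) + C * (4 * M) * (k / 4) <= A.
    rewrite /A (_ : 5 * (4 * M) / (k / 4) = 80 * M / k); last by field.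
    rewrite (_ : C * (4 * M) * (k / 4) = C * M * k); last by field.
    rewrite (_ : (80 + C) * M / k = 80 * M / k + C * M / k); last by field.
    rewrite lerD2l; apply: ler_wpM2l.
      by apply: mulr_ge0 => //; exact: ltW.
    apply: (@le_trans _ _ 1); first by lra.
    by rewrite invf_ge1 //; lra.
  by exists gx, gy, l; split=> //; lra.
(* Chosen so that the bound [A / 2 * (2 * s)] for the variation of [u] within [s] of [a] equals
   [M / 2]. *)
pose s := k / (2 * (80 + C)).
have s0 : 0 < s by rewrite divr_gt0 //; lra.
have sk : s <= k / 4.
  rewrite /s ler_pM2l // lef_pV2 ?posrE; lra.
have lower z : sqdist a z <= s ^+ 2 -> M / 2 <= u z.
  move=> az.
  have sq (t r : R) : 0 <= r -> t ^+ 2 <= r ^+ 2 -> `|t| <= r.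
    by move=> r0; rewrite -(@ler_pXn2r _ 2 _ `|t|) ?nnegrE // real_normK ?num_real.
  have z1 : `|z.1 - a.1| <= s.
    by apply: (sq _ _ (ltW s0)); apply: le_trans az; rewrite lerDl sqr_ge0.
  have z2 : `|z.2 - a.2| <= s.
    by apply: (sq _ _ (ltW s0)); apply: le_trans az; rewrite lerDr sqr_ge0.
  have := @segment_bound _ u a (s ^+ 2) (A / 2) _ _ z az.
  have A2 : 0 <= A / 2 by lra.
  move=> /(_ A2) sb.
  have {}sb : `|u z - u a| <= A / 2 * (`|z.1 - a.1| + `|z.2 - a.2|).
    apply: sb => w aw; apply: grad; apply: (le_trans aw).
    by rewrite ler_pXn2r // ?nnegrE; lra.
  have : A / 2 * (`|z.1 - a.1| + `|z.2 - a.2|) <= A / 2 * (2 * s).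
    by apply: ler_wpM2l => //; lra.
  have -> : A / 2 * (2 * s) = M / 2.
    by rewrite /A /s; field; rewrite k0 /= gt_eqF //; lra.
  by move: sb; rewrite ler_norml -/M => /andP[? ?] ?; lra.
(* Origin of [9 / 16] in the hypothesis: the barrier needs the disc of radius [1 / 2] about [a], and
   [a] is within [1 / 4] of the origin. *)
have dom z : sqdist a z <= 1 / 4 -> harmonic_like C u z.
  move=> az; apply: H.
  have := @sqdist_triangle_le _ O a z (1 / 4) (1 / 2).
  rewrite (_ : (1 / 4 + 1 / 2 : R) ^+ 2 = 9 / 16); last by field.
  rewrite (_ : (1 / 4 : R) ^+ 2 = 1 / 16); last by field.
  rewrite (_ : (1 / 2 : R) ^+ 2 = 1 / 4); last by field.
  by apply=> //; lra.
have aO : sqdist O a <= 1 / 16 by [].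
have s12 : s ^+ 2 < 1 / 12.
  have s1 : s <= 1 / 64 by lra.
  have : s ^+ 2 <= (1 / 64) ^+ 2 by rewrite ler_pXn2r // ?nnegrE; lra.
  by rewrite (_ : (1 / 64 : R) ^+ 2 = 1 / 4096); [lra|field].
have s20 : 0 < s ^+ 2 by rewrite exprn_gt0.
rewrite sqdistC in aO.
have := superharmonic_lower M0 s20 s12 aO dom lower => low.
have := amax z0 z0B; rewrite /W /q => le0.
rewrite (_ : 1 / 16 - sqdist O z0 = 1 / 16 + -1 * sqdist O z0); last by ring.
apply: (le_trans le0); rewrite -/(q a) -/k -/M.
have : (80 + C) ^+ 2 * (6 * M * s ^+ 2) <= (80 + C) ^+ 2 * u O.
  by apply: ler_wpM2l; rewrite ?sqr_ge0.
apply: le_trans.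
rewrite (_ : (80 + C) ^+ 2 * (6 * M * s ^+ 2) = 3 / 2 * (k ^+ 2 * M)); last first.
  by rewrite /s; field; rewrite gt_eqF //; lra.
have : 0 <= k ^+ 2 * M by rewrite mulr_ge0 ?sqr_ge0 // ltW.
by lra.
Qed.

End WeightedHarnack.

Section PositiveGradient.
Context {R : realType}.
Implicit Types (u w : R * R -> R) (z a : R * R).
Let O : R * R := (0, 0).

Lemma positive_gradient C : 0 <= C -> exists2 C' : R, 0 < C' &
  forall u, (forall z, sqdist O z <= 9 / 16 -> harmonic_like C u z) ->
  forall gx gy l, pjet u O gx gy l -> `|gx| <= C' * u O /\ `|gy| <= C' * u O.
Proof.
(* On the disc of radius [1 / 8] the weight is at least [1 / 16 - 1 / 64 = 3 / 64], so the weighted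
   inequality gives [u z <= C2 * u O]; [gradient_le] on this disc then produces [40 + C / 8]. *)
move=> C0; pose C2 := (64 / 3) ^+ 2 * (80 + C) ^+ 2.
have C20 : 0 < C2 by rewrite mulr_gt0 ?exprn_gt0 //; lra.
exists ((40 + C / 8) * C2).
  by rewrite mulr_gt0 //; lra.
move=> u H gx gy l j.
have BO : sqdist O O <= 9 / 16 by rewrite /sqdist !subrr expr0n /= addr0; lra.
have [uO _ _] := H O BO.
have d0 : 0 < 1 / 8 :> R by lra.
have M0 : 0 < C2 * u O by exact: mulr_gt0.
have [z|gx2 gy2] := gradient_le (N := C * (C2 * u O)) d0 M0 _ j.
  rewrite (_ : (1 / 8 : R) ^+ 2 = 1 / 64); last by field.
  move=> Oz; apply: harmonic_like_bounded => //; first by apply: H; lra.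
  have [|uz _ _] := H z; first by lra.
  have le := @weighted_harnack R C u C0 H z.
  have {}le : (1 / 16 - sqdist O z) ^+ 2 * u z <= (80 + C) ^+ 2 * u O.
    by apply: le; lra.
  have : (3 / 64) ^+ 2 * u z <= (80 + C) ^+ 2 * u O.
    apply: le_trans le; apply: ler_wpM2r; first exact: ltW.
    by rewrite ler_pXn2r // ?nnegrE; lra.
  move=> le2.
  have : (64 / 3) ^+ 2 * ((3 / 64) ^+ 2 * u z) <=
      (64 / 3) ^+ 2 * ((80 + C) ^+ 2 * u O).
    by apply: ler_wpM2l le2; exact: sqr_ge0.
  rewrite (_ : (64 / 3) ^+ 2 * ((3 / 64) ^+ 2 * u z) = u z); last by field.
  by rewrite mulrA.
have e : 5 * (C2 * u O) / (1 / 8) + C * (C2 * u O) * (1 / 8) =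
    (40 + C / 8) * C2 * u O by field.
rewrite e in gx2 gy2.
have : 0 < (40 + C / 8) * C2 * u O by rewrite !mulr_gt0 //; lra.
by split; lra.
Qed.

End PositiveGradient.

(** * The localized logarithm of the distance to a point *)

Section Pole.
Context {R : realType}.
Implicit Types (u w : R * R -> R) (z a : R * R).

Lemma pjet_ln u z gx gy l : 0 < u z -> pjet u z gx gy l ->
  pjet (fun z => ln (u z)) z ((u z)^-1 * gx) ((u z)^-1 * gy)
    (- (u z) ^- 2 * (gx ^+ 2 + gy ^+ 2) + (u z)^-1 * l).
Proof.
move=> uz0 j.
apply: (@pjet_comp R (@ln R) (fun x => x^-1) u z gx gy l (- (u z) ^- 2) j).
  have n0 : \forall s \near u z, 0 < s by exact: lt_nbhsr.
  by apply: filterS n0 => s; exact: is_derive1_ln.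
have uz : u z != 0 by rewrite gt_eqF.
apply: is_derive_eq; first exact: is_deriveV.
by rewrite /GRing.scale /= mulr1.
Qed.

Lemma pjet_ln_sqdist a z : 0 < sqdist a z -> exists gx gy,
  pjet (fun z => ln (sqdist a z)) z gx gy 0.
Proof.
move=> s0; have j := pjet_ln s0 (pjet_sqdist a z).
do 2!eexists; apply: pjet_eq j erefl erefl _.
rewrite (_ : _ + _ = 4 * sqdist a z); last by rewrite /sqdist; ring.
by field; rewrite gt_eqF.
Qed.

(* Maximum principle for [ln (T z) + kappa (T z) + lam * u z - ln (sqdist a z)],
   regular at [a] because [T] vanishes there to second order; subharmonicity is
   only assumed in the viscosity sense, through lower test functions. *)
Lemma pole_principle a (r tau lam k1 K Cst : R) (kappa : R -> R) (T u : R * R -> R) :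
  0 < r -> 0 < tau -> 0 <= lam ->
  (forall z, sqdist a z <= r ^+ 2 ->
    [/\ {for z, continuous T}, {for z, continuous u}, 0 <= T z <= 1 & u z <= 0]) ->
  continuous kappa ->
  (forall t, 0 <= t <= 1 -> -1 <= kappa t <= K) ->
  (forall t, 0 < t <= 1 -> ln t + kappa t <= k1) ->
  (forall z, sqdist a z <= r ^+ 2 -> T z <= Cst * sqdist a z) ->
  (forall tau' e, tau' < tau -> 0 < e ->
     exists2 x, 0 < x < e & tau' * x ^+ 2 <= T (a.1 + x, a.2)) ->
  (forall z, 0 < sqdist a z < r ^+ 2 -> 0 < T z ->
     exists theta gx gy l, [/\ pjet theta z gx gy l, 0 <= l,
       theta z = ln (T z) + kappa (T z) + lam * u z &
       \forall z' \near z, theta z' <= ln (T z') + kappa (T z') + lam * u z']) ->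
  tau * r ^+ 2 <= expR (k1 + 1 - lam * u a).
Proof.
move=> r0 tau0 lam0 reg kc kb kle TC Ttau test.
have r20 : 0 < r ^+ 2 by rewrite exprn_gt0.
have tr0 : 0 < tau * r ^+ 2 by exact: mulr_gt0.
rewrite -[leLHS]lnK // ler_expR lnM ?posrE //.
rewrite leNgt; apply/negP => gap.
pose L := ln (r ^+ 2).
(* One third of the gap pays for lowering [tau] to [tau * expR (- g)], one for the variation of [u]
   near [a]; the last is the margin at [z1] over the outer circle. The [1] in the conclusion covers
   [kappa >= -1]. *)
pose g := (ln tau + L - (k1 + 1 - lam * u a)) / 3.
have g0 : 0 < g by rewrite divr_gt0 // subr_gt0.
have gE : 3 * g = ln tau + L - (k1 + 1 - lam * u a) by rewrite /g; field.
have sa : sqdist a a = 0 by rewrite /sqdist !subrr expr0n /= addr0.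
have [_ ua _ _] : [/\ {for a, continuous T}, {for a, continuous u},
  0 <= T a <= 1 & u a <= 0] by apply: reg; rewrite sa ltW.
have [x [x0 xr Tx ux]] : exists x, [/\ 0 < x, x < r,
    tau * expR (- g) * x ^+ 2 <= T (a.1 + x, a.2) &
    lam * u a - g < lam * u (a.1 + x, a.2)].
  have lua : {for a, continuous (fun z => lam * u z)}.
    by apply: (@cvgM R _ (nbhs a)); [exact: cvg_cst|exact: ua].
  have nu : \forall z \near a, lam * u a - g < lam * u z.
    by apply: (near_gt lua); lra.
  have [e /= e0 He] := (nbhs_ballP _ _).1 (near_row nu).
  have m0 : 0 < Num.min e r by rewrite lt_min e0 r0.
  have [|x /andP[x0]] := Ttau (tau * expR (- g)) (Num.min e r) _ m0.
    rewrite -[ltRHS]mulr1 ltr_pM2l // -[ltRHS]expR0 ltr_expR; lra.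
  rewrite lt_min => /andP[xe xr] Tx; exists x; split=> //.
  apply: He; rewrite /ball /= opprD addrA subrr sub0r normrN gtr0_norm //.
pose z1 := (a.1 + x, a.2).
have s1 : sqdist a z1 = x ^+ 2 by rewrite /sqdist /z1 /=; ring.
have x20 : 0 < x ^+ 2 by rewrite exprn_gt0.
have xr2 : x ^+ 2 <= r ^+ 2 by rewrite ler_pXn2r // ?nnegrE ltW.
have [_ _ /andP[_ T1] _] := reg z1 (eq_ind_r (fun y => y <= _) xr2 s1).
have Tz1 : 0 < T z1.
  by apply: lt_le_trans Tx; rewrite !mulr_gt0 ?expR_gt0.
have C0 : 0 < Cst.
  have := TC z1 (eq_ind_r (fun y => y <= _) xr2 s1); rewrite s1 => TCx.
  by rewrite -(pmulr_lgt0 _ x20); exact: lt_le_trans TCx.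
pose Phi z := ln (T z) + kappa (T z) + lam * u z.
have Phi1 : k1 - L + g <= Phi z1 - ln (x ^+ 2).
  have : ln (tau * expR (- g) * x ^+ 2) <= ln (T z1).
    by rewrite ler_ln // posrE // !mulr_gt0 ?expR_gt0.
  rewrite !lnM ?posrE ?mulr_gt0 ?expR_gt0 // expRK.
  have /andP[kz _] : -1 <= kappa (T z1) <= K by apply: kb; rewrite ltW.
  by rewrite /Phi; move: ux; rewrite -/z1; lra.
pose D := ln (x ^+ 2) - L.
have D0 : D <= 0 by rewrite /D subr_le0 ler_ln // posrE.
(* The logarithm with factor [eta] forces the function to minus infinity at the pole, and lowers it
   at [z1] by at most [g / 4]. The term in [mu] makes the Laplacian strictly positive, and adds
   [g / 4] on the outer circle. *)
pose eta := g / (4 * (1 - D)).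
have eta0 : 0 < eta by rewrite divr_gt0 // mulr_gt0 //; lra.
have etaD : - (g / 4) <= eta * D.
  have : eta * (1 - D) = g / 4 by rewrite /eta; field; rewrite gt_eqF //; lra.
  by lra.
pose mu := g / (4 * r ^+ 2).
have mu0 : 0 < mu by rewrite divr_gt0 // mulr_gt0.
have mur : mu * r ^+ 2 = g / 4 by rewrite /mu; field; rewrite gt_eqF.
pose m := k1 - L + g / 2.
(* The inner circle [sqdist a = s0] is so close to the pole that [eta * A] absorbs [Cst], however
   large; the term in [D] keeps [z1] outside it. *)
pose A := `|ln Cst + K + g / 4 - m| / eta + `|D| + 1.
pose s0 := expR (L - A).
have A0 : 0 < A by rewrite ltr_wpDl // addr_ge0 // divr_ge0 // ltW.
have s00 : 0 < s0 by exact: expR_gt0.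
have lns0 : ln s0 = L - A by rewrite expRK.
have s0x : s0 <= x ^+ 2.
  rewrite -[leRHS]lnK // ler_expR.
  have : - D <= `|D| by rewrite -normrN ler_norm.
  have : 0 <= `|ln Cst + K + g / 4 - m| / eta by rewrite divr_ge0 // ltW.
  by rewrite /A /D; lra.
pose S z := kappa (T z) + lam * u z + ((eta - 1) * ln (sqdist a z) - eta * L
  + mu * sqdist a z).
pose B : set (R * R) :=
  [set z | s0 <= sqdist a z] `&` [set z | sqdist a z <= r ^+ 2].
have Bcl : closed B.
  apply: closedI.
    exact: (closed_superlevel (@sqdist_continuous R a)).
  exact: (closed_sublevel (@sqdist_continuous R a)).
have Bc : compact B by apply: (closed_sub_disc_compact Bcl (a := a) (r := r)) => z [].
(* Exponential form of the comparison of [ln T + S] with [m]: it stays continuous at the zeros of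
   [T], where it is negative. *)
pose P z := T z * expR (S z) + - expR m.
have lncont z : 0 < sqdist a z -> {for z, continuous (fun z => ln (sqdist a z))}.
  move=> s; apply: (continuous_comp (f := sqdist a) (g := @ln R)).
    exact: sqdist_continuous.
  exact: continuous_ln.
have Pcont z : B z -> {for z, continuous P}.
  move=> [/= zs zr]; have [Tc uc _ _] := reg z zr.
  have s : 0 < sqdist a z by exact: lt_le_trans zs.
  apply: cvgD; last exact: cvg_cst.
  apply: (@cvgM R _ (nbhs z)); first exact: Tc.
  apply: (continuous_comp (f := S) (g := @expR R)); last exact: continuous_expR.
  apply: cvgD; first apply: cvgD.
  - apply: (continuous_comp (f := T) (g := kappa)) => //; exact: kc.
  - by apply: (@cvgM R _ (nbhs z)); [exact: cvg_cst|exact: uc].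
  - apply: cvgD; first apply: cvgB.
    + apply: (@cvgM R _ (nbhs z)); [exact: cvg_cst|exact: lncont].
    + exact: cvg_cst.
    + by apply: (@cvgM R _ (nbhs z)); [exact: cvg_cst|exact: sqdist_continuous].
have PT z : 0 < T z -> P z = expR (ln (T z) + S z) + - expR m.
  by move=> Tz; rewrite /P expRD lnK.
have main : forall z, B z -> P z <= 0.
  apply: compact_no_max_le0 => // z Bz Pz; have [/= zs zr] := Bz.
  have [Tc uc /andP[Tz0 Tz1'] uz0] := reg z zr.
  have s : 0 < sqdist a z by exact: lt_le_trans zs.
  have Tz : 0 < T z.
    rewrite lt_neqAle Tz0 andbT; apply/eqP => T0; move: Pz.
    by rewrite /P -T0 mul0r add0r oppr_gt0 ltNge expR_ge0.
  have big : m < ln (T z) + S z by move: Pz; rewrite PT // subr_gt0 ltr_expR.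
  have lu0 : lam * u z <= 0 by rewrite mulr_ge0_le0.
  have zr' : sqdist a z < r ^+ 2.
    rewrite lt_neqAle zr andbT; apply/eqP => e; move: big.
    have := kle (T z); rewrite Tz Tz1' => /(_ isT).
    by rewrite /S e mur -/L /m; lra.
  have zs' : s0 < sqdist a z.
    rewrite lt_neqAle zs andbT; apply/eqP => e; move: big.
    have /andP[_ kK] := kb (T z) (introT andP (conj Tz0 Tz1')).
    have : ln (T z) <= ln Cst + ln (sqdist a z).
      by rewrite -lnM // ler_ln ?posrE ?mulr_gt0 //; exact: TC.
    have mus : mu * sqdist a z <= g / 4 by rewrite -mur ler_pM2l.
    rewrite /S -e lns0; rewrite -e in mus.
    have : eta * A >= `|ln Cst + K + g / 4 - m|.
      rewrite (_ : eta * A = `|ln Cst + K + g / 4 - m| + eta * (`|D| + 1)).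
        by rewrite lerDl mulr_ge0 ?addr_ge0 // ltW.
      by rewrite /A; field; rewrite gt_eqF.
    by have := ler_norm (ln Cst + K + g / 4 - m); lra.
  split.
    apply: filterI.
      apply: filterS (near_gt (@sqdist_continuous R a z) zs') => z' /=.
      exact: ltW.
    apply: filterS (near_lt (@sqdist_continuous R a z) zr') => z' /=.
    exact: ltW.
  move=> Pmax.
  have [|theta [gx [gy [l [jt l0 te tn]]]]] := test z _ Tz; first by rewrite s zr'.
  have [hx [hy jl]] := pjet_ln_sqdist s.
  have j := pjetD (pjetD jt (pjetZ (eta - 1) jl)) (pjetZ mu (pjet_sqdist a z)).
  (* As [theta] touches the possibly non-smooth part from below at [z], substituting it preserves
     the local maximum and gives a function that has a Laplacian there. *)
  have : l + (eta - 1) * 0 + mu * 4 <= 0.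
    apply: pjet_max_le0 j _.
    have nT : \forall z' \near z, 0 < T z' by exact: near_gt.
    near=> z'.
    have Tz' : 0 < T z' by near: z'; exact: nT.
    have : P z' <= P z by near: z'.
    rewrite !PT // lerD2r ler_expR /S.
    have : theta z' <= ln (T z') + kappa (T z') + lam * u z' by near: z'.
    by rewrite te; lra.
  by move=> lmu; lra.
have := main z1; rewrite /B /= s1 s0x xr2 => /(_ (conj isT isT)).
rewrite PT // subr_le0 ler_expR; apply/negP; rewrite -ltNge.
have : 0 < mu * x ^+ 2 by exact: mulr_gt0.
by move: Phi1 etaD; rewrite /S s1 /Phi /D /m; lra.
Unshelve. all: by end_near. Qed.

End Pole.

(** * The radial profile correcting the logarithm *)

Section Radial.
Context {R : realType}.
Implicit Types (b t : R).

(* [ln t + kappa b t] has derivative [(1 - t) * (1 + b * sqrt t) / t]: it is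
   logarithmic at 0 and critical at 1, where it is glued to a constant; the term
   in [b] compensates for the deviation of [J] from a constant structure. *)
Definition kappa b t : R :=
  - t + 2 * b * Num.sqrt t - 2 * b / 3 * (t * Num.sqrt t).

Definition kappa1 b t : R := t^-1 - 1 + b * (Num.sqrt t)^-1 - b * Num.sqrt t.

Definition kappa2 b t : R :=
  - t ^- 2 - b / 2 * Num.sqrt t ^- 3 - b / 2 * (Num.sqrt t)^-1.

Lemma kappa_continuous b : continuous (kappa b).
Proof.
move=> t; have sc := @sqrt_continuous R t.
apply: (@cvgB _ _ _ (nbhs t)); first apply: (@cvgD _ _ _ (nbhs t)).
- by apply: cvgN; exact: cvg_id.
- by apply: (@cvgM R _ (nbhs t)); [exact: cvg_cst|exact: sc].
- apply: (@cvgM R _ (nbhs t)); first exact: cvg_cst.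
  by apply: (@cvgM R _ (nbhs t)); [exact: cvg_id|exact: sc].
Qed.

Lemma kappa_bounds b t : 0 <= b -> 0 <= t <= 1 -> -1 <= kappa b t <= 2 * b.
Proof.
move=> b0 /andP[t0 t1]; have s0 := sqrtr_ge0 t.
have s1 : Num.sqrt t <= 1 by rewrite -sqrtr1 ler_sqrt.
have bs : 0 <= b * Num.sqrt t by exact: mulr_ge0.
have bs1 : b * Num.sqrt t <= b by rewrite -[leRHS]mulr1 ler_wpM2l.
have bst : 0 <= b * Num.sqrt t * t by exact: mulr_ge0.
have bst1 : b * Num.sqrt t * t <= b * Num.sqrt t by rewrite -[leRHS]mulr1 ler_wpM2l.
rewrite /kappa (_ : 2 * b / 3 * (t * Num.sqrt t) = 2 / 3 * (b * Num.sqrt t * t)).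
  by apply/andP; split; lra.
by ring.
Qed.

Lemma ln_kappa_le b t : 0 <= b -> 0 < t <= 1 -> ln t + kappa b t <= 2 * b.
Proof.
move=> b0 /andP[t0 t1]; have lt0 : ln t <= 0 by exact: ln_le0.
by have := @kappa_bounds b t b0; rewrite ltW // t1 => /(_ isT) /andP[_]; lra.
Qed.

Lemma is_derive_ln_kappa b t : 0 < t ->
  is_derive t 1 (fun t => ln t + kappa b t) (kappa1 b t).
Proof.
move=> t0.
have ds := is_derive1_sqrt t0.
have s0 : 0 < Num.sqrt t by rewrite sqrtr_gt0.
have did : is_derive t 1 (id : R -> R) 1 by exact: is_derive_id.
have d1 := is_deriveD (is_derive1_ln t0) (is_deriveD (is_deriveD
  (is_deriveN did) (is_deriveM (is_derive_cst (2 * b) t 1) ds))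
  (is_deriveN (is_deriveM (is_derive_cst (2 * b / 3) t 1) (is_deriveM did ds)))).
apply: is_derive_eq d1 _.
rewrite /GRing.scale /= /kappa1.
move: s0 (sqr_sqrtr (ltW t0)); move: (Num.sqrt t) => e e0 <-; field.
by rewrite gt_eqF.
Qed.

Lemma is_derive_kappa1 b t : 0 < t -> is_derive t 1 (kappa1 b) (kappa2 b t).
Proof.
move=> t0.
have ds := is_derive1_sqrt t0.
have s0 : 0 < Num.sqrt t by rewrite sqrtr_gt0.
have did : is_derive t 1 (id : R -> R) 1 by exact: is_derive_id.
have tn : (id : R -> R) t != 0 by rewrite gt_eqF.
have sn : Num.sqrt t != 0 by rewrite gt_eqF.
have di := is_deriveV tn did.
have dis := is_deriveV sn ds.
have d1 := is_deriveD (is_deriveD (is_deriveD di (is_derive_cst (-1 : R) t 1))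
  (is_deriveM (is_derive_cst b t 1) dis))
  (is_deriveN (is_deriveM (is_derive_cst b t 1) ds)).
apply: is_derive_eq d1 _.
rewrite /GRing.scale /= /kappa2.
move: s0 (sqr_sqrtr (ltW t0)); move: (Num.sqrt t) => e e0 <-; field.
by rewrite gt_eqF.
Qed.

(** The derivative [kappa1] is nonpositive beyond [1]. So where [T = min t 1], the smooth expression
    in [t] lies below the one in [T] and serves as a lower test function. *)
Lemma ln_kappa_decreasing b t : 0 <= b -> 1 <= t ->
  ln t + kappa b t <= ln 1 + kappa b 1.
Proof.
move=> b0; rewrite le_eqVlt => /orP[/eqP <- //|t1].
have [z z1|z /andP[z1 z2] /eqP] := @mean_value R (fun t => ln t + kappa b t) (kappa1 b) 1 t t1.
  by apply: is_derive_ln_kappa; lra.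
rewrite subr_eq => /eqP ->; rewrite gerDr; apply: mulr_le0_ge0; last by lra.
have s0 : 0 < Num.sqrt z by rewrite sqrtr_gt0; lra.
have s1 : 1 <= Num.sqrt z by rewrite -sqrtr1 ler_sqrt; lra.
rewrite /kappa1.
have : z^-1 <= 1 by rewrite invf_le1 //; lra.
have : b * (Num.sqrt z)^-1 <= b * 1 by apply: ler_wpM2l => //; rewrite invf_le1.
have : b * 1 <= b * Num.sqrt z by apply: ler_wpM2l.
by lra.
Qed.

(** As [kappa2 <= 0 <= kappa1], the worst case is equality in both hypotheses. With the parameter
    [4 * (C * r)] the terms in [1 / t] and in [1 / sqrt t] then cancel exactly; what remains is
    bounded. *)
Lemma kappa_laplacian_ge (C r N Dt Gt t : R) : 0 <= C -> 0 < r <= 1 -> 0 <= N ->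
  0 < t <= 1 ->
  4 * N * (1 - C * r * Num.sqrt t) <= Dt ->
  Gt <= 4 * t * N * (1 + C * r * Num.sqrt t) ->
  - (4 * (1 + 6 * C + 6 * C ^+ 2) * N) <=
    kappa2 (4 * (C * r)) t * Gt + kappa1 (4 * (C * r)) t * Dt.
Proof.
move=> C0 /andP[r0 r1] N0 /andP[t0 t1]; set e := Num.sqrt t => HD HG.
have e0 : 0 < e by rewrite sqrtr_gt0.
have e1 : e <= 1 by rewrite -sqrtr1 ler_sqrt.
have te : t = e ^+ 2 by rewrite sqr_sqrtr // ltW.
set c := C * r in HD HG *.
have c0 : 0 <= c by rewrite mulr_ge0 // ltW.
have cC : c <= C by rewrite -[leRHS]mulr1 ler_wpM2l.
set k2 := kappa2 _ _; set k1 := kappa1 _ _.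
have i1 : 1 <= e^-1 by rewrite invf_ge1.
have k20 : k2 <= 0.
  rewrite /k2 /kappa2 -/e.
  have h1 : 0 <= t ^- 2 by rewrite invr_ge0 exprn_ge0 // ltW.
  have h2 : 0 <= 4 * c / 2 * e ^- 3.
    by rewrite mulr_ge0 ?invr_ge0 ?exprn_ge0 ?(ltW e0) //; lra.
  have h3 : 0 <= 4 * c / 2 * e^-1 by rewrite mulr_ge0; lra.
  by lra.
have k10 : 0 <= k1.
  rewrite /k1 /kappa1 -/e.
  have h1 : 1 <= t^-1 by rewrite invf_ge1.
  have h2 : 4 * c * 1 <= 4 * c * e^-1 by apply: ler_wpM2l => //; lra.
  have h3 : 4 * c * e <= 4 * c * 1 by apply: ler_wpM2l => //; lra.
  by lra.
have hG : k2 * (4 * t * N * (1 + c * e)) <= k2 * Gt by rewrite ler_wnM2l.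
have hD : k1 * (4 * N * (1 - c * e)) <= k1 * Dt by rewrite ler_wpM2l.
apply: le_trans (lerD hG hD).
have -> : k2 * (4 * t * N * (1 + c * e)) + k1 * (4 * N * (1 - c * e)) =
    4 * N * (-1 - 6 * c * e + c * e - 6 * c ^+ 2 + 2 * c ^+ 2 * e ^+ 2).
  by rewrite /k1 /k2 /kappa1 /kappa2 -/e te; field; rewrite gt_eqF.
rewrite (_ : - _ = 4 * N * - (1 + 6 * C + 6 * C ^+ 2)); last by ring.
apply: ler_wpM2l; first by rewrite mulr_ge0.
have : c * e <= c * 1 by apply: ler_wpM2l.
have : 0 <= c * e by rewrite mulr_ge0 // ltW.
have : 0 <= c ^+ 2 * e ^+ 2 by rewrite mulr_ge0 ?sqr_ge0.
have : c ^+ 2 <= C ^+ 2 by rewrite ler_pXn2r // ?nnegrE; lra.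
by lra.
Qed.

(* In the last hypothesis, either [z] is outside the support of the cut-off, or
   [T = min t 1] for a function [t] whose gradient and Laplacian are those of the
   squared distance, up to a relative error [C * r * sqrt t]. *)
Lemma sibony_estimate (a : R * R) (rd tau C r eps Cst : R) (T u : R * R -> R) :
  0 < rd -> 0 < tau -> 0 <= C -> 0 < r <= 1 -> 0 < eps ->
  (forall z, sqdist a z <= rd ^+ 2 ->
    [/\ {for z, continuous T}, {for z, continuous u}, 0 <= T z <= 1 & u z <= 0]) ->
  (forall z, sqdist a z <= rd ^+ 2 -> T z <= Cst * sqdist a z) ->
  (forall tau' e, tau' < tau -> 0 < e ->
     exists2 x, 0 < x < e & tau' * x ^+ 2 <= T (a.1 + x, a.2)) ->
  (forall z, 0 < sqdist a z < rd ^+ 2 -> 0 < T z -> exists ux uy lu,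
     [/\ pjet u z ux uy lu, 0 <= lu &
     (\forall z' \near z, T z' = 1) \/
     exists (t : R * R -> R) gx gy l N,
       [/\ (\forall z' \near z, T z' = Num.min (t z') 1), t z <= 1,
           pjet t z gx gy l, 0 <= N & [/\ eps * r ^+ 2 * N <= lu,
           4 * N * (1 - C * r * Num.sqrt (t z)) <= l &
           gx ^+ 2 + gy ^+ 2 <= 4 * t z * N * (1 + C * r * Num.sqrt (t z))]]]) ->
  tau * rd ^+ 2 <= expR (8 * C + 1 -
    4 * (1 + 6 * C + 6 * C ^+ 2) / (eps * r ^+ 2) * u a).
Proof.
move=> rd0 tau0 C0 /andP[r0 r1] eps0 reg TC Ttau H.
(* Times the lower bound [eps * r ^+ 2 * N] for the Laplacian of [u], this is exactly the defect
   left by [kappa_laplacian_ge]. *)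
set lam := 4 * _ / _.
have er0 : 0 < eps * r ^+ 2 by rewrite mulr_gt0 // exprn_gt0.
have B0 : 0 <= 4 * (1 + 6 * C + 6 * C ^+ 2).
  by have := sqr_ge0 C; lra.
have lam0 : 0 <= lam by rewrite divr_ge0 // ltW.
have b0 : 0 <= 4 * (C * r) by rewrite !mulr_ge0 // ltW.
have bC : 4 * (C * r) <= 4 * C.
  by rewrite ler_wpM2l // -[leRHS]mulr1 ler_wpM2l.
have Tpos (x : R) : 0 <= x <= 1 ->
   -1 <= kappa (4 * (C * r)) x <= 2 * (4 * (C * r)) by exact: kappa_bounds.
apply: (@le_trans _ _ (expR (2 * (4 * (C * r)) + 1 - lam * u a))); last first.
  by rewrite ler_expR; lra.
apply: (@pole_principle R a rd tau lam _ (2 * (4 * (C * r))) Cst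
  (kappa (4 * (C * r))) T u) => //.
- exact: kappa_continuous.
- by move=> x; exact: ln_kappa_le.
move=> z zr Tz; have [ux [uy [lu [ju lu0]]]] := H z zr Tz.
case=> [T1|[t [gx [gy [l [N [Tt t1 jt N0 [lN Dl Gl]]]]]]]].
  exists (fun z => (ln 1 + kappa (4 * (C * r)) 1) + lam * u z).
  have j := pjetD (pjet_cst (ln 1 + kappa (4 * (C * r)) 1) z) (pjetZ lam ju).
  do 3!eexists; split; first exact: j.
  - by rewrite add0r mulr_ge0.
  - by rewrite (nbhs_singleton T1).
  - by apply: filterS T1 => z' ->.
have Tzt : T z = t z by rewrite (nbhs_singleton Tt); exact/min_idPl.
have tz0 : 0 < t z by rewrite -Tzt.
exists (fun z => (ln (t z) + kappa (4 * (C * r)) (t z)) + lam * u z).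
have n0 : \forall s \near t z, 0 < s by exact: lt_nbhsr.
have jk := @pjet_comp R (fun t => ln t + kappa (4 * (C * r)) t)
  (kappa1 (4 * (C * r))) t z gx gy l (kappa2 (4 * (C * r)) (t z)) jt.
have {}jk := jk (filterS (fun s => @is_derive_ln_kappa (4 * (C * r)) s) n0)
  (is_derive_kappa1 _ tz0).
have j := pjetD (jk _) (pjetZ lam ju).
do 3!eexists; split; first exact: j.
- have tz1 : 0 < t z <= 1 by rewrite tz0.
  have r01 : 0 < r <= 1 by rewrite r0.
  have := kappa_laplacian_ge C0 r01 N0 tz1 Dl Gl.
  have : lam * (eps * r ^+ 2 * N) <= lam * lu by apply: ler_wpM2l.
  have -> : lam * (eps * r ^+ 2 * N) = 4 * (1 + 6 * C + 6 * C ^+ 2) * N.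
    by rewrite /lam; field; rewrite !gt_eqF.
  by lra.
- by rewrite Tzt.
- apply: filterS Tt => z' ->; rewrite lerD2r.
  have [t1'|t1'] := leP (t z') 1; first by [].
  by apply: ln_kappa_decreasing => //; exact: ltW.
Qed.

End Radial.

(** * Laplacians along pseudo-holomorphic discs *)

Section Schwarz.
Context {R : realType}.

Lemma derive_row (g : R * R -> R) (z : R * R) d :
  is_derive z (1, 0) g d -> is_derive z.1 1 (fun x => g (x, z.2)) d.
Proof.
case: z => x y [dg <-].
have e : (fun h : R => h^-1 *: (g (h *: (1, 0) + (x, y)) - g (x, y))) =
    (fun h : R => h^-1 *: (g (h *: (1 : R) + x, y) - g (x, y))).
  apply/funext => h; congr (_ *: (g _ - _)).
  by apply: injective_projections => //=; rewrite ?scaler0 ?add0r.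
split; first by move: dg; rewrite /derivable e.
by rewrite /derive e.
Qed.

Lemma derive_column (g : R * R -> R) (z : R * R) d :
  is_derive z (0, 1) g d -> is_derive z.2 1 (fun y => g (z.1, y)) d.
Proof.
case: z => x y [dg <-].
have e : (fun h : R => h^-1 *: (g (h *: (0, 1) + (x, y)) - g (x, y))) =
    (fun h : R => h^-1 *: (g (x, h *: (1 : R) + y) - g (x, y))).
  apply/funext => h; congr (_ *: (g _ - _)).
  by apply: injective_projections => //=; rewrite ?scaler0 ?add0r.
split; first by move: dg; rewrite /derivable e.
by rewrite /derive e.
Qed.

Lemma pjet_derive (g p q : R * R -> R) (z : R * R) (px qy : R) :
  (\forall z' \near z, is_derive (z' : R * R) (1, 0) g (p z')) ->
  (\forall z' \near z, is_derive (z' : R * R) (0, 1) g (q z')) ->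
  is_derive z (1, 0) p px -> is_derive z (0, 1) q qy ->
  pjet g z (p z) (q z) (px + qy).
Proof.
move=> gp gq pp qq; exists px, qy; split=> //.
- exists (fun x => p (x, z.2)); split; last exact: derive_row.
    by apply: filterS (near_row gp) => x /derive_row.
  by rewrite -surjective_pairing.
- exists (fun y => q (z.1, y)); split; last exact: derive_column.
    by apply: filterS (near_column gq) => x /derive_column.
  by rewrite -surjective_pairing.
Qed.

Definition linear_approx (p : R * R -> R) (z : R * R) (al be : R) : Prop :=
  forall e, 0 < e -> exists2 d, 0 < d & forall h k s, s < d -> `|h| <= s ->
    `|k| <= s ->
    `|p (z.1 + h, z.2 + k) - p z - (al * h + be * k)| <= e * s.

Lemma differentiable_linear_approx (p : R * R -> R) (z : R * R) :
  differentiable p z -> linear_approx p z ('D_(1, 0) p z) ('D_(0, 1) p z).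
Proof.
move=> dp e e0; have /eqaddoP /(_ _ e0) := diff_locally dp.
move=> /nbhs_ballP [d /= d0 Hd]; exists d => // h k s sd hs ks.
have n : `|(h, k)| <= s by rewrite prod_normE /= ge_max hs ks.
have /= := Hd (h, k); rewrite -ball_normE /= sub0r normrN.
move=> /(_ (le_lt_trans n sd)) b.
have {}b : `|p ((h, k) + z) - (p z + 'd p z (h, k))| <= e * `|(h, k)| by exact: b.
have -> : p (z.1 + h, z.2 + k) - p z - ('D_(1, 0) p z * h + 'D_(0, 1) p z * k)
    = p ((h, k) + z) - (p z + 'd p z (h, k)).
  rewrite !deriveE // -!addrA -opprD; congr (p _ - (_ + _)).
    by apply: injective_projections; rewrite /= addrC.
  rewrite mulrC [X in _ + X]mulrC -!linearZ -linearD; congr ('d p z _).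
  by apply: injective_projections => /=; rewrite /GRing.scale /= ?mulr0 ?mulr1 ?addr0 ?add0r.
by apply: (le_trans b); apply: ler_wpM2l => //; exact: ltW.
Qed.

(** The mean value theorem in the first variable turns the difference over a square of side [h] into
    [h] times a vertical increment of [p], which the linear approximation of [p] at [z]
    evaluates. *)
Lemma second_difference (g p : R * R -> R) (z : R * R) (al be : R) :
  (\forall z' \near z, is_derive (z' : R * R) (1, 0) g (p z')) ->
  linear_approx p z al be -> forall e, 0 < e ->
  \forall h \near (0 : R), 0 < h ->
    `|g (z.1 + h, z.2 + h) - g (z.1 + h, z.2) - (g (z.1, z.2 + h) - g (z.1, z.2))
      - be * h ^+ 2| <= e * h ^+ 2.
Proof.
case: z => x y gp pl e e0 /=.
have e20 : 0 < e / 2 by rewrite divr_gt0.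
have [d d0 Hd] := pl _ e20.
have [d' /= d'0 Hd'] := (nbhs_ballP _ _).1 gp.
have m0 : 0 < Num.min d d' by rewrite lt_min d0 d'0.
apply/nbhs_ballP; exists (Num.min d d') => // h.
rewrite /ball /= sub0r normrN => hd h0.
move: hd; rewrite gtr0_norm // lt_min => /andP[hd hd'].
have gp' s k : x <= s <= x + h -> 0 <= k <= h ->
    is_derive s 1 (fun t => g (t, y + k)) (p (s, y + k)).
  move=> /andP[s1 s2] /andP[k1 k2].
  apply: (derive_row (z := (s, y + k))); apply: Hd'.
  rewrite -ball_normE /= prod_normE /= gt_max.
  by rewrite !ltr_norml; apply/andP; split; lra.
have [|s shx|s /andP[s1 s2]] := @mean_value R (fun t => g (t, y + h) - g (t, y + 0))
    (fun t => p (t, y + h) - p (t, y + 0)) x (x + h).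
- by rewrite ltrDl.
- by apply: is_deriveB; apply: gp' => //; lra.
rewrite addr0 => E.
rewrite (_ : g _ - g _ - (g _ - g _) = (p (s, y + h) - p (s, y)) * (x + h - x));
  last by rewrite -E; ring.
have sh : `|s - x| <= h by rewrite ger0_norm; lra.
have hh : `|h| <= h by rewrite gtr0_norm.
have h0' : `|0 : R| <= h by rewrite normr0 ltW.
have /= b1 := Hd (s - x) h h hd sh hh; have /= b2 := Hd (s - x) 0 h hd sh h0'.
rewrite subrKC in b1.
rewrite subrKC addr0 in b2.
rewrite (_ : _ - _ = ((p (s, y + h) - p (x, y) - (al * (s - x) + be * h)) -
  (p (s, y) - p (x, y) - (al * (s - x) + be * 0))) * h); last by ring.
rewrite normrM (gtr0_norm h0) expr2 mulrA ler_pM2r //.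
apply: (le_trans (ler_normB _ _)).
by lra.
Qed.

Lemma linear_approx_swap p z al be : linear_approx p (z.2, z.1) al be ->
  linear_approx (fun z => p (z.2, z.1)) z be al.
Proof.
move=> H e e0; have [d d0 Hd] := H e e0; exists d => // h k s sd hs ks /=.
by rewrite (addrC (be * h)); exact: Hd.
Qed.

Lemma derive_swap (g : R * R -> R) (z : R * R) d : is_derive (z.2, z.1) (0, 1) g d ->
  is_derive z (1, 0) (fun z => g (z.2, z.1)) d.
Proof.
case: z => x y [/= dg <-].
have e : (fun h : R => h^-1 *: (g (h *: (0, 1) + (y, x)) - g (y, x))) =
    (fun h : R => h^-1 *: (g ((h *: ((1 : R), (0 : R)) + (x, y)).2,
       (h *: ((1 : R), (0 : R)) + (x, y)).1) - g (y, x))).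
  apply/funext => h; congr (_ *: (g _ - _)).
split; first by move: dg; rewrite /derivable e.
by rewrite /derive e.
Qed.

(** Young's form, for first partial derivatives differentiable at the point. The second difference
    over a square is unchanged when the coordinates are exchanged, so both mixed derivatives
    approximate the same quotient, each up to [|A - B| / 4]. *)
Lemma schwarz (g p q : R * R -> R) (z : R * R) :
  (\forall z' \near z, is_derive (z' : R * R) (1, 0) g (p z')) ->
  (\forall z' \near z, is_derive (z' : R * R) (0, 1) g (q z')) ->
  differentiable p z -> differentiable q z ->
  'D_(0, 1) p z = 'D_(1, 0) q z.
Proof.
move=> gp gq /differentiable_linear_approx pl /differentiable_linear_approx ql.
set B := 'D_(0, 1) p z in pl *; set A := 'D_(1, 0) q z in ql *.
have sw : {for (z.2, z.1), continuous (fun z : R * R => (z.2, z.1))}.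
  apply: (@cvg_pair _ _ _ (nbhs (z.2, z.1)) (nbhs z.1) (nbhs z.2)).
    exact: cvg_snd.
  exact: cvg_fst.
have gq' : \forall z' \near (z.2, z.1),
    is_derive (z' : R * R) (1, 0) (fun z => g (z.2, z.1)) (q (z'.2, z'.1)).
  have := near_comp sw (P := fun z' => is_derive (z' : R * R) (0, 1) g (q z')).
  rewrite /= -surjective_pairing => /(_ gq).
  by apply: filterS => z' /derive_swap.
have ql' : linear_approx (fun z => q (z.2, z.1)) (z.2, z.1) ('D_(0, 1) q z) A.
  by apply: linear_approx_swap; rewrite /= -surjective_pairing.
suff : `|A - B| <= 0 by rewrite normr_le0 subr_eq0 => /eqP.
rewrite leNgt; apply/negP => AB.
have e0 : 0 < `|A - B| / 4 by rewrite divr_gt0.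
have h1 := second_difference gp pl e0; have /= h2 := second_difference gq' ql' e0.
have [d /= d0 Hd] := (nbhs_ballP _ _).1 (filterI h1 h2).
have d20 : 0 < d / 2 by rewrite divr_gt0.
have := Hd (d / 2); rewrite /ball /= sub0r normrN gtr0_norm //.
move=> /(_ _)-H; have {H}[|b1 b2] := H; first by lra.
have {}b1 := b1 d20; have {}b2 := b2 d20.
have x0 : 0 < (d / 2) ^+ 2 by rewrite exprn_gt0.
have : `|A - B| * (d / 2) ^+ 2 <= `|A - B| / 2 * (d / 2) ^+ 2.
  rewrite -{1}(gtr0_norm x0) -normrM.
  move: b1 b2; set X := (d / 2) ^+ 2.
  rewrite !ler_norml => /andP[? ?] /andP[? ?].
  by apply/andP; split; lra.
rewrite ler_pM2r //; lra.
Qed.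

End Schwarz.

Section Laplacian.
Context {R : realType} {m : nat}.
Let E := 'rV[R]_m.

Lemma is_derive_coord (V : normedModType R) (F : V -> E) (x v : V) (j : 'I_m) :
  derivable F x v -> is_derive x v (fun x => F x 0 j) ('D_v F x 0 j).
Proof.
move=> dF; split; first exact: (derivable_mxP F x v).1.
by rewrite derive_mx // mxE.
Qed.

Lemma is_derive_mul (V : normedModType R) (f g : V -> R) (x v : V) (df dg : R) :
  is_derive x v f df -> is_derive x v g dg ->
  is_derive x v (fun x => f x * g x) (f x * dg + g x * df).
Proof. exact: is_deriveM. Qed.

Lemma is_derive_opp (V : normedModType R) (f : V -> R) (x v : V) (df : R) :
  is_derive x v f df -> is_derive x v (fun x => - f x) (- df).
Proof. exact: is_deriveN. Qed.

Lemma differentiable_row (V : normedModType R) (F : V -> E) (x : V) (j : 'I_m) :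
  differentiable F x -> differentiable (fun x => F x 0 j) x.
Proof.
move=> dF.
exact: (differentiable_comp (g := fun N : E => N 0 j) dF (differentiable_coord _ _ _)).
Qed.

Lemma diff_coords (f : E -> R) (y v : E) :
  'd f y v = \sum_k v 0 k * 'd f y (delta_mx 0 k).
Proof.
rewrite [in LHS](row_sum_delta v) linear_sum; apply: eq_bigr => k _.
by rewrite linearZ.
Qed.

Lemma is_derive_big_sum (V : normedModType R) (h : 'I_m -> V -> R) (x v : V)
  (dh : 'I_m -> R) : (forall j, is_derive x v (h j) (dh j)) ->
  is_derive x v (fun x => \sum_j h j x) (\sum_j dh j).
Proof.
move=> H; rewrite (_ : (fun x => _) = \sum_j h j); first exact: is_derive_sum.
by apply/funext => y; rewrite fct_sumE.
Qed.

(* The value at [(v, w)] of the exterior derivative of the 1-form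
   [\sum_j A j dy_j], with the opposite sign. *)
Definition curl (A : 'I_m -> E -> R) (y v w : E) : R :=
  \sum_j (v 0 j * 'd (A j) y w - w 0 j * 'd (A j) y v).

(* The components of the 1-form [J^* df]. *)
Definition Jdiff (J : E -> 'M[R]_m) (f : E -> R) (j : 'I_m) (y : E) : R :=
  \sum_k J y j k * 'D_(delta_mx 0 k) f y.

Lemma diff_mulJ (J : E -> 'M[R]_m) (f : E -> R) (y v : E) : differentiable f y ->
  'd f y (v *m J y) = \sum_j v 0 j * Jdiff J f j y.
Proof.
move=> df; rewrite mulmx_sum_row linear_sum; apply: eq_bigr => j _.
rewrite linearZ diff_coords; congr (_ *: _); apply: eq_bigr => k _.
by rewrite deriveE // mxE.
Qed.

Lemma is_derive_comp (V W : normedModType R) (f : W -> R) (F : V -> W) (x v : V) :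
  differentiable F x -> differentiable f (F x) ->
  is_derive x v (f \o F) ('d f (F x) ('D_v F x)).
Proof.
move=> dF df; have dc := differentiable_comp dF df.
split; first exact: diff_derivable.
by rewrite !deriveE // diff_comp.
Qed.

Lemma sum_telescope (a b c d e : 'I_m -> R) :
  \sum_j (- a j * b j - c j) + \sum_j (d j * e j + c j) =
  \sum_j (d j * e j - a j * b j).
Proof. by rewrite -big_split; apply: eq_bigr => j _ /=; ring. Qed.

(* Writing [f_x] and [f_y] through the form [J^* df] makes the second
   derivatives of [F] cancel by the symmetry of its mixed derivatives. *)
Lemma laplacian_comp (O : set (R * R)) (Y : set E) (F : R * R -> E)
    (J : E -> 'M[R]_m) (f : E -> R) :
  open O -> (forall z, O z -> Y (F z)) -> Ck 2 O F ->
  (forall z, O z -> 'D_(0, 1) F z = 'D_(1, 0) F z *m J (F z)) ->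
  (forall y, Y y -> J y *m J y = - 1%:M) ->
  (forall y, Y y -> differentiable f y) ->
  (forall j y, Y y -> differentiable (Jdiff J f j) y) ->
  forall z, O z -> let w := 'D_(1, 0) F z in
  pjet (f \o F) z ('d f (F z) w) ('d f (F z) (w *m J (F z)))
    (curl (Jdiff J f) (F z) w (w *m J (F z))).
Proof.
move=> Oo OY [dF dDF] FJ JJ df dA z Oz w.
pose A := Jdiff J f; pose Fx := 'D_(1, 0) F; pose Fy := 'D_(0, 1) F.
have dFx z' : O z' -> differentiable Fx z' by have [H _] := dDF (1, 0); exact: H.
have dFy z' : O z' -> differentiable Fy z' by have [H _] := dDF (0, 1); exact: H.
pose p z := \sum_j (- Fy z 0 j) * A j (F z).
pose q z := \sum_j Fx z 0 j * A j (F z).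
have near_O (P : R * R -> Prop) : (forall z, O z -> P z) -> \forall z' \near z, P z'.
  by move=> OP; apply: filterS (open_nbhs_nbhs (conj Oo Oz)) => z'; exact: OP.
have pE z' : O z' -> p z' = 'd f (F z') (Fx z').
  move=> Oz'; have -> : Fx z' = (- Fy z') *m J (F z').
    rewrite /Fy FJ // mulNmx -mulmxA JJ; last exact: OY.
    by rewrite mulmxN mulmx1 opprK.
  rewrite diff_mulJ; last by apply: df; exact: OY.
  by apply: eq_bigr => j _; rewrite mxE.
have qE z' : O z' -> q z' = 'd f (F z') (Fy z').
  by move=> Oz'; rewrite /Fy FJ // diff_mulJ //; apply: df; exact: OY.
have hp : \forall z' \near z, is_derive (z' : R * R) (1, 0) (f \o F) (p z').
  apply: near_O => z' Oz'; rewrite pE //.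
  by apply: is_derive_comp; [exact: dF|apply: df; exact: OY].
have hq : \forall z' \near z, is_derive (z' : R * R) (0, 1) (f \o F) (q z').
  apply: near_O => z' Oz'; rewrite qE //.
  by apply: is_derive_comp; [exact: dF|apply: df; exact: OY].
have dAF j v : is_derive z v (A j \o F) ('d (A j) (F z) ('D_v F z)).
  by apply: is_derive_comp; [exact: dF|apply: dA; exact: OY].
have dp : is_derive z (1, 0) p
    (\sum_j ((- Fy z 0 j) * 'd (A j) (F z) (Fx z) - A j (F z) * 'D_(1, 0) Fy z 0 j)).
  apply: is_derive_big_sum => j.
  have d1 : is_derive z (1, 0) (fun z => Fy z 0 j) ('D_(1, 0) Fy z 0 j).
    by apply: is_derive_coord; apply: diff_derivable; exact: dFy.
  have := is_derive_mul (is_derive_opp d1) (dAF j (1, 0)).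
  by rewrite mulrN.
have sym j : 'D_(0, 1) Fx z 0 j = 'D_(1, 0) Fy z 0 j.
  have := @schwarz R (fun z => F z 0 j) (fun z => Fx z 0 j) (fun z => Fy z 0 j) z.
  have d1 : is_derive z (0, 1) (fun z => Fx z 0 j) ('D_(0, 1) Fx z 0 j).
    by apply: is_derive_coord; apply: diff_derivable; exact: dFx.
  have d2 : is_derive z (1, 0) (fun z => Fy z 0 j) ('D_(1, 0) Fy z 0 j).
    by apply: is_derive_coord; apply: diff_derivable; exact: dFy.
  have [_ e1] := d1; have [_ e2] := d2.
  move=> sch; apply: (etrans (esym e1) (etrans (sch _ _ _ _) e2)).
  - by apply: near_O => z' Oz'; apply: is_derive_coord; apply: diff_derivable; exact: dF.
  - by apply: near_O => z' Oz'; apply: is_derive_coord; apply: diff_derivable; exact: dF.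
  - by apply: differentiable_row; exact: dFx.
  - by apply: differentiable_row; exact: dFy.
have dq : is_derive z (0, 1) q
    (\sum_j (Fx z 0 j * 'd (A j) (F z) (Fy z) + A j (F z) * 'D_(1, 0) Fy z 0 j)).
  apply: is_derive_big_sum => j.
  have d1 : is_derive z (0, 1) (fun z => Fx z 0 j) ('D_(0, 1) Fx z 0 j).
    by apply: is_derive_coord; apply: diff_derivable; exact: dFx.
  rewrite -sym; exact: is_derive_mul d1 (dAF j (0, 1)).
apply: pjet_eq (pjet_derive hp hq dp dq) _ _ _.
- exact: pE.
- by rewrite qE // /Fy FJ.
- rewrite -(FJ z Oz).
  exact: (sum_telescope (fun j => Fy z 0 j) (fun j => 'd (A j) (F z) (Fx z))
    (fun j => A j (F z) * 'D_(1, 0) Fy z 0 j) (fun j => Fx z 0 j)).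
Qed.

End Laplacian.

(** * Local bounds in a chart *)

Section InnerProduct.
Context {R : realType} {m : nat}.
Let E := 'rV[R]_m.
Implicit Types (A B : 'M[R]_m) (u v w x : E).

Definition dotp u v : R := \sum_j u 0 j * v 0 j.

(* Invariant under [B] as soon as [B *m B = - 1]. *)
Definition hip B u v : R := dotp u v + dotp (u *m B) (v *m B).

Definition hnorm2 B v : R := hip B v v.

Lemma dotpC u v : dotp u v = dotp v u.
Proof. by apply: eq_bigr => j _; rewrite mulrC. Qed.

Lemma dotpDl u v w : dotp (u + v) w = dotp u w + dotp v w.
Proof. by rewrite -big_split; apply: eq_bigr => j _; rewrite mxE mulrDl. Qed.

Lemma dotpZl a u w : dotp (a *: u) w = a * dotp u w.
Proof. by rewrite mulr_sumr; apply: eq_bigr => j _; rewrite mxE mulrA. Qed.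

Lemma dotp_ge0 u : 0 <= dotp u u.
Proof. by apply: sumr_ge0 => j _; rewrite -expr2 sqr_ge0. Qed.

Lemma hipC B u v : hip B u v = hip B v u.
Proof. by rewrite /hip dotpC (dotpC (u *m B)). Qed.

Lemma hipDl B u v w : hip B (u + v) w = hip B u w + hip B v w.
Proof. by rewrite /hip mulmxDl !dotpDl addrACA. Qed.

Lemma hipZl B a u w : hip B (a *: u) w = a * hip B u w.
Proof. by rewrite /hip -scalemxAl !dotpZl mulrDr. Qed.

Lemma hipDr B u v w : hip B w (u + v) = hip B w u + hip B w v.
Proof. by rewrite !(hipC B w) hipDl. Qed.

Lemma hipZr B a u w : hip B w (a *: u) = a * hip B w u.
Proof. by rewrite !(hipC B w) hipZl. Qed.

Lemma hipNr B u w : hip B w (- u) = - hip B w u.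
Proof. by rewrite -scaleN1r hipZr mulN1r. Qed.

Lemma hnorm2_ge0 B v : 0 <= hnorm2 B v.
Proof. by rewrite /hnorm2 /hip addr_ge0 ?dotp_ge0. Qed.

Lemma hip_cauchy_schwarz B u v : hip B u v ^+ 2 <= hnorm2 B u * hnorm2 B v.
Proof.
have H (t : R) : 0 <= hnorm2 B u + 2 * t * hip B u v + t ^+ 2 * hnorm2 B v.
  have := hnorm2_ge0 B (u + t *: v).
  rewrite /hnorm2 hipDl !hipDr !hipZl !hipZr (hipC B v u).
  by rewrite (_ : _ + _ + _ = hip B u u + 2 * t * hip B u v + t ^+ 2 * hip B v v) //; ring.
have := hnorm2_ge0 B v; rewrite le_eqVlt => /orP[/eqP v0|v0].
  rewrite -v0 mulr0; have [->|uv] := eqVneq (hip B u v) 0; first by rewrite expr0n.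
  have := H (- (hnorm2 B u + 1) / (2 * hip B u v)); rewrite -v0 mulr0 addr0.
  have -> : 2 * (- (hnorm2 B u + 1) / (2 * hip B u v)) * hip B u v = - (hnorm2 B u + 1).
    by field.
  by lra.
have := H (- hip B u v / hnorm2 B v).
have vn : hnorm2 B v != 0 by rewrite gt_eqF.
have -> : hnorm2 B u + 2 * (- hip B u v / hnorm2 B v) * hip B u v +
    (- hip B u v / hnorm2 B v) ^+ 2 * hnorm2 B v =
    (hnorm2 B u * hnorm2 B v - hip B u v ^+ 2) / hnorm2 B v by field.
by rewrite pmulr_lge0 ?invr_gt0 // subr_ge0.
Qed.

Lemma hip_invariant B u v : B *m B = - 1%:M ->
  hip B (u *m B) (v *m B) = hip B u v.
Proof.
move=> BB; rewrite /hip -!mulmxA BB !mulmxN !mulmx1 addrC; congr (_ + _).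
by apply: eq_bigr => j _; rewrite !mxE mulrNN.
Qed.

Lemma hip_orthogonal B w : B *m B = - 1%:M -> hip B w (w *m B) = 0.
Proof.
move=> BB; have := hip_invariant w (w *m B) BB.
rewrite -mulmxA BB mulmxN mulmx1 hipNr (hipC B (w *m B)).
by move=> H; lra.
Qed.

(** Bessel's inequality: [w] and [w *m B] are orthogonal of equal length. Cauchy-Schwarz on each
    term would lose a factor [2], and with it the cancellation of the terms in [1 / t] in
    [kappa_laplacian_ge]. *)
Lemma hip_bessel B x w : B *m B = - 1%:M ->
  hip B x w ^+ 2 + hip B x (w *m B) ^+ 2 <= hnorm2 B x * hnorm2 B w.
Proof.
move=> BB; set p := hip B x w; set q := hip B x (w *m B).
have := hip_cauchy_schwarz B x (p *: w + q *: (w *m B)).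
have -> : hip B x (p *: w + q *: (w *m B)) = p ^+ 2 + q ^+ 2.
  by rewrite hipDr !hipZr -/p -/q -!expr2.
have -> : hnorm2 B (p *: w + q *: (w *m B)) = (p ^+ 2 + q ^+ 2) * hnorm2 B w.
  rewrite /hnorm2 hipDl !hipDr !hipZl !hipZr (hip_orthogonal _ BB).
  by rewrite (hipC B (w *m B) w) (hip_orthogonal _ BB) (hip_invariant _ _ BB); ring.
have : 0 <= p ^+ 2 + q ^+ 2 by rewrite addr_ge0 ?sqr_ge0.
rewrite le_eqVlt => /orP[/eqP <- _|pq].
  by rewrite mulr_ge0 ?hnorm2_ge0.
by rewrite expr2 mulrCA ler_pM2l.
Qed.

Lemma hip_le B u v (p q : R) : 0 <= p -> 0 <= q ->
  hnorm2 B u <= p ^+ 2 -> hnorm2 B v <= q ^+ 2 -> `|hip B u v| <= p * q.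
Proof.
move=> p0 q0 up vq.
rewrite -(@ler_pXn2r _ 2) ?nnegrE ?mulr_ge0 // real_normK ?num_real //.
apply: (le_trans (hip_cauchy_schwarz B u v)); rewrite exprMn.
by apply: ler_pM => //; exact: hnorm2_ge0.
Qed.

(* Used with [A] the structure at the position [x] of a disc of velocity [w], and
   [B] the structure at the origin, to which the norm is adapted. *)
Lemma hnorm2_almost_holomorphic A B x w q (c : R) : B *m B = - 1%:M -> 0 <= c ->
  hnorm2 B x <= 1 ->
  hnorm2 B (w *m (A - B)) <= c ^+ 2 * hnorm2 B x * hnorm2 B w ->
  hnorm2 B q <= c ^+ 2 * hnorm2 B w ^+ 2 ->
  let C := 2 * c + c ^+ 2 in
  4 * hnorm2 B w * (1 - C * Num.sqrt (hnorm2 B x)) <=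
    2 * hnorm2 B w + 2 * hnorm2 B (w *m A) + 2 * hip B x q /\
  (2 * hip B x w) ^+ 2 + (2 * hip B x (w *m A)) ^+ 2 <=
    4 * hnorm2 B x * hnorm2 B w * (1 + C * Num.sqrt (hnorm2 B x)).
Proof.
move=> BB c0 x1 AB qq C.
have sx := hnorm2_ge0 B x; have sw := hnorm2_ge0 B w.
pose e := Num.sqrt (hnorm2 B x); pose f := Num.sqrt (hnorm2 B w).
have e0 : 0 <= e by exact: sqrtr_ge0.
have f0 : 0 <= f by exact: sqrtr_ge0.
have e1 : e <= 1 by rewrite -[leRHS]sqrtr1 ler_sqrt.
have xe : hnorm2 B x = e ^+ 2 by rewrite sqr_sqrtr.
have wf : hnorm2 B w = f ^+ 2 by rewrite sqr_sqrtr.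
(* The deviation from the structure at the origin has length at most [c * e * f], small with [x]:
   one source of the relative error [C * e], the other being [q]. *)
pose d := w *m (A - B).
have wA : w *m A = w *m B + d by rewrite /d mulmxBr addrC subrK.
have wB : hnorm2 B (w *m B) = f ^+ 2 by rewrite /hnorm2 (hip_invariant _ _ BB) -wf.
have dn : hnorm2 B d <= (c * e * f) ^+ 2.
  have -> : (c * e * f) ^+ 2 = c ^+ 2 * e ^+ 2 * f ^+ 2 by ring.
  by rewrite -xe -wf.
have cef : 0 <= c * e * f by rewrite !mulr_ge0.
have ef : 0 <= e * f by rewrite mulr_ge0.
have cf : 0 <= c * f ^+ 2 by rewrite mulr_ge0 ?sqr_ge0.
have b1 := hip_le f0 cef (eq_ind_r (fun y => y <= _) (lexx _) wB) dn.
have b2 : `|hip B x q| <= e * (c * f ^+ 2).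
  apply: hip_le => //; first by rewrite xe.
  by rewrite exprMn -wf.
have b3 : `|hip B x (w *m B)| <= e * f by apply: hip_le; rewrite ?xe ?wB.
have b4 : `|hip B x d| <= e * (c * e * f) by apply: hip_le; rewrite ?xe.
have d0 := hnorm2_ge0 B d.
have cc : 0 <= c ^+ 2 * (e * f ^+ 2) by rewrite mulr_ge0 ?sqr_ge0 // mulr_ge0 ?sqr_ge0.
have ce : 0 <= c * (e * f ^+ 2) by rewrite mulr_ge0 // mulr_ge0 ?sqr_ge0.
split.
  have -> : hnorm2 B (w *m A) = f ^+ 2 + 2 * hip B (w *m B) d + hnorm2 B d.
    by rewrite wA /hnorm2 hipDl !hipDr -/(hnorm2 B (w *m B)) wB (hipC B d); ring.
  rewrite wf -/e /C.
  move: b1 b2; rewrite !ler_norml => /andP[b1 _] /andP[b2 _].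
  rewrite (_ : 4 * f ^+ 2 * _ = 4 * f ^+ 2 - 8 * (c * (e * f ^+ 2)) - 4 * (c ^+ 2 * (e * f ^+ 2))); last by ring.
  rewrite (_ : f * (c * e * f) = c * (e * f ^+ 2)) in b1; last by ring.
  rewrite (_ : e * (c * f ^+ 2) = c * (e * f ^+ 2)) in b2; last by ring.
  by lra.
have bes := hip_bessel x w BB.
rewrite wA hipDr; set p := hip B x (w *m B); set r := hip B x d.
rewrite -/p in bes b3; rewrite -/r in b4; clearbody p r.
have pr : p * r <= c * (e ^+ 3 * f ^+ 2).
  apply: (le_trans (ler_norm _)); rewrite normrM.
  rewrite (_ : c * _ = e * f * (e * (c * e * f))); last by ring.
  exact: ler_pM.
have rr : r ^+ 2 <= c ^+ 2 * (e ^+ 3 * f ^+ 2).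
  rewrite -real_normK ?num_real //.
  apply: (@le_trans _ _ ((e * (c * e * f)) ^+ 2)).
    by rewrite ler_pXn2r // ?nnegrE // mulr_ge0.
  rewrite (_ : (e * _) ^+ 2 = e * (c ^+ 2 * (e ^+ 3 * f ^+ 2))); last by ring.
  by rewrite ler_piMl // mulr_ge0 ?sqr_ge0 // mulr_ge0 ?sqr_ge0 // exprn_ge0.
rewrite xe wf in bes; rewrite -/e xe wf /C.
rewrite (_ : 4 * e ^+ 2 * f ^+ 2 * _ = 4 * (e ^+ 2 * f ^+ 2) + 8 * (c * (e ^+ 3 * f ^+ 2))
  + 4 * (c ^+ 2 * (e ^+ 3 * f ^+ 2))); last by ring.
rewrite (_ : (2 * hip B x w) ^+ 2 + _ =
  4 * (hip B x w ^+ 2 + p ^+ 2) + 8 * (p * r) + 4 * r ^+ 2); last by ring.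
by lra.
Qed.

Definition rjet (F : R * R -> E) (z : R * R) (X Y L : E) : Prop :=
  forall j, pjet (fun z => F z 0 j) z (X 0 j) (Y 0 j) (L 0 j).

Lemma pjet_sum (n : nat) (h : 'I_n -> R * R -> R) (z : R * R) (gx gy l : 'I_n -> R) :
  (forall j, pjet (h j) z (gx j) (gy j) (l j)) ->
  pjet (fun z => \sum_j h j z) z (\sum_j gx j) (\sum_j gy j) (\sum_j l j).
Proof.
elim: n h gx gy l => [|n IH] h gx gy l H.
  rewrite !big_ord0 (_ : (fun z => _) = fun=> 0); first exact: pjet_cst.
  by apply/funext => y; rewrite big_ord0.
rewrite !big_ord_recr /= (_ : (fun z => _) = fun z =>
  \sum_(j < n) h (widen_ord (leqnSn n) j) z + h ord_max z); last first.
  by apply/funext => y; rewrite big_ord_recr.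
by apply: pjetD => //; exact: IH.
Qed.

Lemma rjet_sub F z X Y L v : rjet F z X Y L -> rjet (fun z => F z - v) z X Y L.
Proof.
move=> H j; have := pjetD (H j) (pjet_cst (- v 0 j) z).
rewrite !addr0 (_ : (fun z => F z 0 j + _) = fun z => (F z - v) 0 j) //.
by apply/funext => y; rewrite !mxE.
Qed.

Lemma rjet_mul F z X Y L B : rjet F z X Y L ->
  rjet (fun z => F z *m B) z (X *m B) (Y *m B) (L *m B).
Proof.
move=> H j; have := pjet_sum (fun k => pjetZ (B k j) (H k)).
rewrite (_ : (fun z => _) = fun z => (F z *m B) 0 j); last first.
  by apply/funext => y; rewrite mxE; apply: eq_bigr => k _; rewrite mulrC.
by move/pjet_eq; apply; rewrite mxE; apply: eq_bigr => k _; rewrite mulrC.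
Qed.

Lemma pjet_dotp F z X Y L : rjet F z X Y L ->
  pjet (fun z => dotp (F z) (F z)) z (2 * dotp (F z) X) (2 * dotp (F z) Y)
    (2 * dotp X X + 2 * dotp Y Y + 2 * dotp (F z) L).
Proof.
move=> H; have := pjet_sum (fun j => pjet_sqr (H j)).
rewrite (_ : (fun z => _) = fun z => dotp (F z) (F z)); last first.
  by apply/funext => y; apply: eq_bigr => k _; rewrite expr2.
move/pjet_eq; apply; rewrite /dotp !mulr_sumr -?big_split; apply: eq_bigr => k _ /=; ring.
Qed.

Lemma pjet_hnorm2 F z X Y L B : rjet F z X Y L ->
  pjet (fun z => hnorm2 B (F z)) z (2 * hip B (F z) X) (2 * hip B (F z) Y)
    (2 * hnorm2 B X + 2 * hnorm2 B Y + 2 * hip B (F z) L).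
Proof.
move=> H; have := pjetD (pjet_dotp H) (pjet_dotp (rjet_mul B H)).
by move/pjet_eq; apply; rewrite /hnorm2 /hip; ring.
Qed.

Lemma sqr_coord_le v j : v 0 j ^+ 2 <= dotp v v.
Proof.
rewrite /dotp (bigD1 j) //= expr2 lerDl; apply: sumr_ge0 => k _.
by rewrite -expr2 sqr_ge0.
Qed.

Lemma coord_mul_le v i j : `|v 0 i * v 0 j| <= dotp v v.
Proof.
have vi := sqr_coord_le v i; have vj := sqr_coord_le v j.
have := sqr_ge0 (v 0 i - v 0 j); have := sqr_ge0 (v 0 i + v 0 j).
by rewrite sqrrD sqrrB ler_norml => ? ?; apply/andP; split; lra.
Qed.

Definition qform (c : 'I_m -> 'I_m -> R) v : R :=
  \sum_i \sum_j v 0 i * v 0 j * c i j.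

Lemma qform_bound (c : 'I_m -> 'I_m -> R) v (k : R) :
  (forall i j, `|c i j| <= k) -> `|qform c v| <= m%:R ^+ 2 * k * dotp v v.
Proof.
move=> ck.
have -> : m%:R ^+ 2 * k * dotp v v = \sum_(i < m) \sum_(j < m) (dotp v v * k).
  by rewrite !sumr_const !card_ord -mulrnA -[RHS]mulr_natr natrM; ring.
apply: (le_trans (ler_norm_sum _ _ _)); apply: ler_sum => i _.
apply: (le_trans (ler_norm_sum _ _ _)); apply: ler_sum => j _.
by rewrite normrM; apply: ler_pM => //; exact: coord_mul_le.
Qed.

End InnerProduct.

(** * The Levi form as a quadratic form with continuous coefficients *)

Section QuadraticForms.
Context {R : realType} {m : nat}.
Let E := 'rV[R]_m.
Implicit Types (f g : E -> R) (Y : set E) (y v w : E).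

Lemma continuous_sum_ord (T : topologicalType) n (h : 'I_n -> T -> R) (x : T) :
  (forall j, {for x, continuous (h j)}) ->
  {for x, continuous (fun x => \sum_j h j x)}.
Proof.
elim: n h => [|n IH] h H.
  rewrite (_ : (fun x => _) = fun=> 0); first exact: cvg_cst.
  by apply/funext => y; rewrite big_ord0.
rewrite (_ : (fun x => _) = fun x =>
  \sum_(j < n) h (widen_ord (leqnSn n) j) x + h ord_max x); last first.
  by apply/funext => y; rewrite big_ord_recr.
by apply: cvgD; [exact: IH|exact: H].
Qed.

Lemma continuous_mul (T : topologicalType) (f g : T -> R) (x : T) :
  {for x, continuous f} -> {for x, continuous g} ->
  {for x, continuous (fun x => f x * g x)}.
Proof. by move=> fc gc; apply: (@cvgM R _ (nbhs x)). Qed.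

Lemma continuous_sub (T : topologicalType) (f g : T -> R) (x : T) :
  {for x, continuous f} -> {for x, continuous g} ->
  {for x, continuous (fun x => f x - g x)}.
Proof. by move=> fc gc; apply: (@cvgB _ _ _ (nbhs x)). Qed.

Lemma continuous_near_eq (T U : topologicalType) (f g : T -> U) (x : T) :
  (\forall x' \near x, f x' = g x') -> {for x, continuous f} ->
  {for x, continuous g}.
Proof.
move=> fg fc; rewrite /prop_for /continuous_at -(nbhs_singleton fg).
by apply: cvg_trans fc; apply: near_eq_cvg; apply: filterS fg => x' ->.
Qed.

Lemma Ck1_mul Y f g : open Y -> Ck 1 Y f -> Ck 1 Y g ->
  Ck 1 Y (fun y => f y * g y).
Proof.
move=> Yo [df cf] [dg cg]; split=> [y Yy|v y Yy].
  exact: (differentiableM (df y Yy) (dg y Yy)).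
apply: (@continuous_near_eq _ _
  (fun y => f y * 'D_v g y - (- g y) * 'D_v f y)).
  apply: filterS (open_nbhs_nbhs (conj Yo Yy)) => y' Yy'.
  have dfv : is_derive y' v f ('D_v f y') by apply/derivableP/diff_derivable/df.
  have dgv : is_derive y' v g ('D_v g y') by apply/derivableP/diff_derivable/dg.
  have [_ ->] := is_derive_mul dfv dgv.
  by rewrite mulNr opprK.
have fc : {for y, continuous f} by exact: differentiable_continuous (df y Yy).
have gc : {for y, continuous g} by exact: differentiable_continuous (dg y Yy).
apply: continuous_sub; apply: continuous_mul => //.
- exact: cg.
- exact: continuousN.
- exact: cf.
Qed.

Lemma Ck1_sum Y n (h : 'I_n -> E -> R) : open Y -> (forall j, Ck 1 Y (h j)) ->
  Ck 1 Y (fun y => \sum_j h j y).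
Proof.
move=> Yo H; split=> [y Yy|v y Yy].
  rewrite (_ : (fun y => _) = \sum_j h j); last first.
    by apply/funext => y'; rewrite fct_sumE.
  by apply: differentiable_sum => j; have [+ _] := H j; apply.
apply: (@continuous_near_eq _ _ (fun y => \sum_j 'D_v (h j) y)).
  apply: filterS (open_nbhs_nbhs (conj Yo Yy)) => y' Yy'.
  rewrite (_ : (fun y => _) = \sum_j h j); last first.
    by apply/funext => y''; rewrite fct_sumE.
  rewrite derive_sum // => j.
  by apply: diff_derivable; have [+ _] := H j; apply.
by apply: continuous_sum_ord => j; have [_] := H j; apply.
Qed.

Lemma Ck1_Jdiff Y (J : E -> 'M[R]_m) f j : open Y ->
  (forall i k, Ck 1 Y (fun y => J y i k)) -> Ck 2 Y f -> Ck 1 Y (Jdiff J f j).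
Proof.
move=> Yo CJ [_ Cf]; by apply: Ck1_sum => // k; apply: Ck1_mul.
Qed.

Lemma derive_coord (i : 'I_m) v y : 'D_v (fun y : E => y 0 i) y = v 0 i.
Proof.
have [_ ->] := is_derive_coord i (@derivable_id _ _ y v).
by rewrite derive_id.
Qed.

Lemma Ck2_coord Y (i : 'I_m) : Ck 2 Y (fun y : E => y 0 i).
Proof.
split=> [y _|v]; first exact: differentiable_coord.
rewrite (_ : 'D_v _ = fun=> v 0 i); last by apply/funext => y; exact: derive_coord.
split=> [y _|w y _]; first exact: differentiable_cst.
apply: (@continuous_near_eq _ _ (fun=> 0)); last exact: cst_continuous.
apply: near_all => y'.
by have [_ ->] : is_derive y' w (fun=> v 0 i) 0 by exact: is_derive_cst.
Qed.

(** Not symmetrised; the continuity of these coefficients in [y] is what spreads bounds on the Levi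
    form from a point to a neighbourhood. *)
Definition curl_coef (J : E -> 'M[R]_m) (A : 'I_m -> E -> R) y (a b : 'I_m) : R :=
  \sum_k J y b k * ('D_(delta_mx 0 k) (A a) y - 'D_(delta_mx 0 a) (A k) y).

Lemma curl_qform (J : E -> 'M[R]_m) (A : 'I_m -> E -> R) y v :
  (forall j, differentiable (A j) y) ->
  curl A y v (v *m J y) = qform (curl_coef J A y) v.
Proof.
move=> dA; pose d j k := 'D_(delta_mx 0 k) (A j) y.
have dE j w : 'd (A j) y w = \sum_k w 0 k * d j k.
  by rewrite diff_coords; apply: eq_bigr => k _; rewrite /d deriveE.
have vJ k : (v *m J y) 0 k = \sum_b v 0 b * J y b k by rewrite mxE.
rewrite /curl sumrB.
have -> : \sum_j v 0 j * 'd (A j) y (v *m J y) =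
    \sum_j \sum_b \sum_k v 0 j * v 0 b * (J y b k * d j k).
  apply: eq_bigr => j _; rewrite dE mulr_sumr exchange_big; apply: eq_bigr => k _.
  by rewrite vJ mulr_suml mulr_sumr; apply: eq_bigr => b _; ring.
have -> : \sum_j (v *m J y) 0 j * 'd (A j) y v =
    \sum_j \sum_b \sum_k v 0 j * v 0 b * (J y b k * d k j).
  transitivity (\sum_k \sum_j \sum_b v 0 j * v 0 b * (J y b k * d k j)).
    apply: eq_bigr => k _; rewrite dE mulr_sumr; apply: eq_bigr => j _.
    by rewrite vJ mulr_suml; apply: eq_bigr => b _; ring.
  by rewrite exchange_big; apply: eq_bigr => j _; rewrite exchange_big.
rewrite -sumrB; apply: eq_bigr => a _; rewrite -sumrB; apply: eq_bigr => b _.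
rewrite -sumrB /curl_coef mulr_sumr; apply: eq_bigr => k _.
by rewrite /d; ring.
Qed.

Lemma curl_coef_continuous Y (J : E -> 'M[R]_m) (A : 'I_m -> E -> R) y a b :
  (forall i k, Ck 1 Y (fun y => J y i k)) -> (forall j, Ck 1 Y (A j)) -> Y y ->
  {for y, continuous (fun y => curl_coef J A y a b)}.
Proof.
move=> CJ CA Yy; apply: continuous_sum_ord => k; apply: continuous_mul.
  by have [+ _] := CJ b k; move=> /(_ y Yy); exact: differentiable_continuous.
by apply: continuous_sub; [have [_] := CA a|have [_] := CA k]; apply.
Qed.

Lemma entry_continuous v (j : 'I_m) : {for v, continuous (fun v : E => v 0 j)}.
Proof. exact: (@coord_continuous R 1 m 0 j v). Qed.

Lemma dotp_continuous : continuous (fun v : E => dotp v v).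
Proof.
move=> v; apply: continuous_sum_ord => j.
by apply: continuous_mul; exact: entry_continuous.
Qed.

Lemma qform_continuous (c : 'I_m -> 'I_m -> R) : continuous (qform c).
Proof.
move=> v; apply: continuous_sum_ord => i; apply: continuous_sum_ord => j.
apply: continuous_mul; last exact: cst_continuous.
by apply: continuous_mul; exact: entry_continuous.
Qed.

Lemma dotp_eq0 v : dotp v v = 0 -> v = 0.
Proof.
move=> v0; apply/rowP => j; rewrite mxE; apply/eqP; rewrite -sqrf_eq0.
by rewrite eq_le sqr_ge0 andbT -v0 sqr_coord_le.
Qed.

Lemma qformZ (c : 'I_m -> 'I_m -> R) (a : R) v : qform c (a *: v) = a ^+ 2 * qform c v.
Proof.
rewrite /qform mulr_sumr; apply: eq_bigr => i _; rewrite mulr_sumr.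
by apply: eq_bigr => j _; rewrite !mxE; ring.
Qed.

Lemma qform_pos_def (c : 'I_m -> 'I_m -> R) : (forall v, v <> 0 -> 0 < qform c v) ->
  exists2 e, 0 < e & forall v, e * dotp v v <= qform c v.
Proof.
move=> c0; pose S : set E := [set v | dotp v v = 1].
have q0 : qform c 0 = 0.
  by rewrite /qform big1 // => i _; rewrite big1 // => j _; rewrite mxE !mul0r.
have d00 : dotp (0 : E) 0 = 0 by rewrite /dotp big1 // => i _; rewrite mxE mul0r.
have scale v : v <> 0 -> 0 < dotp v v /\
    exists2 a, a ^+ 2 * dotp v v = 1 & S (a *: v).
  move=> v0; have dv : 0 < dotp v v.
    by rewrite lt_neqAle dotp_ge0 andbT eq_sym; apply/eqP => /dotp_eq0.
  split=> //; exists (Num.sqrt (dotp v v))^-1.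
    by rewrite exprVn sqr_sqrtr ?mulVf ?gt_eqF // ltW.
  rewrite /S /= dotpZl dotpC dotpZl mulrA -expr2.
  by rewrite exprVn sqr_sqrtr ?mulVf ?gt_eqF // ltW.
(* The unit sphere is empty only when the space is zero, and then any constant works. *)
have [[s Ss]|S0] := pselect (exists s, S s); last first.
  exists 1 => // v; have [->|v0] := pselect (v = 0); first by rewrite q0 d00 mulr0.
  by have [_ [a _ Sa]] := scale v v0; case: S0; exists (a *: v).
have Sc : compact S.
  apply: bounded_closed_compact.
    exists 1; split=> // t t1 v; rewrite /S /= => dv.
    apply: le_trans (ltW t1); rewrite [leLHS]/Num.Def.normr/= mx_normrE.
    apply: bigmax_le => // -[i j] _ /=; rewrite ord1.
    by rewrite -(@expr_le1 _ 2) // real_normK ?num_real // -dv sqr_coord_le.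
  rewrite (_ : S = [set v | dotp v v <= 1] `&` [set v | 1 <= dotp v v]).
    apply: closedI.
      exact: (closed_sublevel dotp_continuous).
    exact: (closed_superlevel dotp_continuous).
  apply/seteqP; split=> v; rewrite /S /=; first by move=> ->; rewrite lexx.
  by move=> [a b]; apply/eqP; rewrite eq_le a b.
have [||s0 /set_mem Ss0 smin] := @compact_EVT_min _ _ (qform c) S _ Sc.
- by exists s.
- by apply: continuous_subspaceT; exact: qform_continuous.
have s00 : s0 <> 0.
  move=> e; move: Ss0; rewrite /S /= e d00 => /eqP.
  by rewrite eq_sym oner_eq0.
exists (qform c s0); first exact: c0.
move=> v; have [->|v0] := pselect (v = 0); first by rewrite q0 d00 mulr0.
have [dv [a a1 Sa]] := scale v v0.
have := smin (a *: v) (mem_set Sa); rewrite qformZ => le.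
rewrite -(ler_pM2l (x := a ^+ 2)); last first.
  by rewrite -(pmulr_lgt0 _ dv) a1.
by rewrite mulrCA a1 mulr1.
Qed.

End QuadraticForms.

(** * Bounds valid near a point of a chart *)

Section LocalBounds.
Context {R : realType} {m : nat}.
Let E := 'rV[R]_m.
Implicit Types (f g : E -> R) (Y : set E) (y v w : E).

Lemma near_bounded (I : finType) (T : topologicalType) (h : I -> T -> R) (x : T) :
  (forall i, {for x, continuous (h i)}) ->
  exists2 K, 0 <= K & \forall x' \near x, forall i, `|h i x'| <= K.
Proof.
move=> hc; exists (\sum_i (`|h i x| + 1)).
  by apply: sumr_ge0 => i _; rewrite addr_ge0.
apply: filter_forall => i.
have nc : {for x, continuous (fun x => `|h i x|)}.
  exact: (continuous_comp (hc i) (@norm_continuous _ _ _)).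
have : `|h i x| < `|h i x| + 1 by rewrite ltrDl.
move/(near_lt nc); apply: filterS => x' /ltW /le_trans; apply.
rewrite (bigD1 i) //= lerDl; apply: sumr_ge0 => j _.
by rewrite addr_ge0.
Qed.

Lemma near_close (I : finType) (T : topologicalType) (h : I -> T -> R) (x : T) e :
  0 < e -> (forall i, {for x, continuous (h i)}) ->
  \forall x' \near x, forall i, `|h i x' - h i x| <= e.
Proof.
move=> e0 hc; apply: filter_forall => i.
have nc : {for x, continuous (fun x' => `|h i x' - h i x|)}.
  apply: (continuous_comp (f := fun x' => h i x' - h i x) (g := fun t => `|t|)).
    by apply: continuous_sub; [exact: hc|exact: cst_continuous].
  exact: norm_continuous.
have : `|h i x - h i x| < e by rewrite subrr normr0.
by move/(near_lt nc); apply: filterS => x' /ltW.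
Qed.

(** Mean value theorem on the segment from [y'] to [y], inside the ball by convexity. The ball is
    that of the sup norm, the bound is Euclidean. *)
Lemma lipschitz_ball f y0 (r K : R) : 0 <= K ->
  (forall y, `|y - y0| < r -> differentiable f y) ->
  (forall y k, `|y - y0| < r -> `|'D_(delta_mx 0 k) f y| <= K) ->
  forall y y', `|y - y0| < r -> `|y' - y0| < r ->
  `|f y - f y'| <= m%:R * K * Num.sqrt (dotp (y - y') (y - y')).
Proof.
move=> K0 df dK y y' yr y'r; pose x := y - y'.
pose F (t : R) : E := t *: x + y'.
have Fr t : 0 <= t <= 1 -> `|F t - y0| < r.
  move=> /andP[t0 t1].
  have -> : F t - y0 = t *: (y - y0) + (1 - t) *: (y' - y0).
    rewrite /F /x !scalerBr !scalerBl !scale1r; apply/rowP => j; rewrite !mxE; ring.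
  apply: (le_lt_trans (ler_normD _ _)); rewrite !normrZ ger0_norm // ger0_norm ?subr_ge0 //.
  have [M yM y'M] : exists2 M, `|y - y0| <= M /\ `|y' - y0| <= M & M < r.
    by exists (Num.max `|y - y0| `|y' - y0|); rewrite ?gt_max ?yr // !le_max !lexx orbT.
  case: yM => yM y'M'; apply: (@le_lt_trans _ _ M) => //.
  have : t * `|y - y0| <= t * M by apply: ler_wpM2l.
  have : (1 - t) * `|y' - y0| <= (1 - t) * M by apply: ler_wpM2l => //; lra.
  by lra.
have dF (t : R) : differentiable F t /\ 'D_1 F t = x.
  have d1 : is_diff t ( *:%R^~ x : R -> E) ( *:%R^~ x) by exact: is_diff_scalel.
  have d2 : is_diff t (cst y' : R -> E) 0 by exact: is_diff_cst.
  have d3 : is_diff t F ( *:%R^~ x + 0) by exact: (is_diffD d1 d2).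
  have dFt : differentiable F t by case: d3.
  split=> //; rewrite deriveE //; case: d3 => _ ->.
  by rewrite !fctE addr0 scale1r.
have [|t t01|t /andP[t0 t1] eq] := @mean_value R (f \o F)
    (fun t => 'd f (F t) x) 0 1; first exact: ltr01.
  have [dFt <-] := dF t.
  by apply: is_derive_comp => //; apply: df; exact: Fr.
have -> : f y - f y' = 'd f (F t) x.
  by move: eq; rewrite /= /F scale1r scale0r add0r subrK subr0 mulr1.
rewrite diff_coords; apply: (le_trans (ler_norm_sum _ _ _)).
have -> : m%:R * K * Num.sqrt (dotp x x) = \sum_(k < m) (Num.sqrt (dotp x x) * K).
  by rewrite sumr_const card_ord -[RHS]mulr_natr; ring.
have Ft : `|F t - y0| < r by apply: Fr; rewrite !ltW.
apply: ler_sum => k _; rewrite normrM; apply: ler_pM => //.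
  rewrite -(@ler_pXn2r _ 2) ?nnegrE ?sqrtr_ge0 // real_normK ?num_real //.
  by rewrite sqr_sqrtr ?dotp_ge0 // sqr_coord_le.
by rewrite -deriveE; [exact: dK|exact: df].
Qed.

Lemma dotp_mulmx_le (A : 'M[R]_m) v (K : R) : 0 <= K -> (forall i j, `|A i j| <= K) ->
  dotp (v *m A) (v *m A) <= m%:R ^+ 3 * K ^+ 2 * dotp v v.
Proof.
move=> K0 AK.
have -> : m%:R ^+ 3 * K ^+ 2 * dotp v v = \sum_(j < m) (m%:R ^+ 2 * K ^+ 2 * dotp v v).
  by rewrite sumr_const card_ord -[RHS]mulr_natr; ring.
apply: ler_sum => j _.
have -> : (v *m A) 0 j * (v *m A) 0 j = qform (fun a b => A a j * A b j) v.
  rewrite mxE mulr_suml; apply: eq_bigr => a _; rewrite mulr_sumr.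
  by apply: eq_bigr => b _; ring.
apply: (le_trans (ler_norm _)); apply: qform_bound => a b.
by rewrite normrM expr2; apply: ler_pM.
Qed.

Lemma nbhs_norm_ball (y0 : E) (P : E -> Prop) : (\forall y \near y0, P y) ->
  exists2 r : R, 0 < r & forall y, `|y - y0| < r -> P y.
Proof.
move=> /(nbhs_ballP _ _).1 [r /= r0 H]; exists r => // y yr; apply: H.
by rewrite -ball_normE /= distrC.
Qed.

(* The matrix of [J], acting on row vectors, and the defining function [f] in a
   chart; [curl] is the Levi form of [f], and [curl] of the coordinates gives the
   Laplacian of the components of a [J]-holomorphic disc. *)
Record local_bounds (J : E -> 'M[R]_m) f y0 (r e K : R) : Prop := LocalBounds {
  lb_r : 0 < r ;
  lb_e : 0 < e ;
  lb_K : 0 <= K ;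
  lb_curl : forall y v, `|y - y0| < r ->
    e * dotp v v <= curl (Jdiff J f) y v (v *m J y) <= K * dotp v v ;
  lb_J : forall y v, `|y - y0| < r -> dotp (v *m J y) (v *m J y) <= K * dotp v v ;
  lb_Jlip : forall y y' v, `|y - y0| < r -> `|y' - y0| < r ->
    dotp (v *m (J y - J y')) (v *m (J y - J y')) <=
      K * dotp v v * dotp (y - y') (y - y') ;
  lb_acc : forall y v (q : E), `|y - y0| < r ->
    (forall i, q 0 i = curl (Jdiff J (fun y => y 0 i)) y v (v *m J y)) ->
    dotp q q <= K * dotp v v ^+ 2 }.

Lemma half_perturbation (q1 q2 a e d : R) : e * d <= q2 -> `|q1 - q2| <= a ->
  a <= e / 2 * d -> e / 2 * d <= q1.
Proof. by rewrite ler_norml => h1 /andP[h2 _] h3; lra. Qed.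

Lemma exists_local_bounds Y (J : E -> 'M[R]_m) f y0 : open Y -> Y y0 ->
  (forall i k, Ck 1 Y (fun y => J y i k)) -> Ck 2 Y f ->
  (forall v, v <> 0 -> 0 < curl (Jdiff J f) y0 v (v *m J y0)) ->
  exists r e K, local_bounds J f y0 r e K /\ forall y, `|y - y0| < r -> Y y.
Proof.
move=> Yo Yy0 CJ Cf pos.
have CA j : Ck 1 Y (Jdiff J f j) by exact: Ck1_Jdiff.
have CX i j : Ck 1 Y (Jdiff J (fun y => y 0 i) j).
  exact: (Ck1_Jdiff j Yo CJ (Ck2_coord Y i)).
have Ck1_diff g y : Ck 1 Y g -> Y y -> differentiable g y by case=> H _; exact: H.
have dA j y : Y y -> differentiable (Jdiff J f j) y := Ck1_diff _ y (CA j).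
have dX i j y : Y y -> differentiable (Jdiff J (fun y => y 0 i) j) y :=
  Ck1_diff _ y (CX i j).
have posq v : v <> 0 -> 0 < qform (curl_coef J (Jdiff J f) y0) v.
  by move=> v0; rewrite -curl_qform; [exact: pos|move=> j; exact: dA].
have [e0 e00 He0] := qform_pos_def posq.
have m1 : 0 < m%:R ^+ 2 + 1 :> R by rewrite ltr_wpDl ?sqr_ge0.
(* A change of at most [e1] in the coefficients changes the form by at most
   [m%:R ^+ 2 * e1 * dotp v v], within half of the lower bound at [y0]. *)
pose e1 := e0 / 2 / (m%:R ^+ 2 + 1).
have e10 : 0 < e1 by rewrite !divr_gt0.
pose hA (p : 'I_m * 'I_m) y := curl_coef J (Jdiff J f) y p.1 p.2.
have cA p : {for y0, continuous (hA p)} 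
  by exact: (@curl_coef_continuous R m Y J (Jdiff J f) y0 p.1 p.2 CJ CA Yy0).
pose hX (p : 'I_m * 'I_m * 'I_m) y :=
  curl_coef J (Jdiff J (fun y => y 0 p.1.1)) y p.1.2 p.2.
have cX p : {for y0, continuous (hX p)}.
  exact: (@curl_coef_continuous R m Y J (Jdiff J (fun y => y 0 p.1.1)) y0 p.1.2 p.2
    CJ (CX p.1.1) Yy0).
pose hJ (p : 'I_m * 'I_m) y := J y p.1 p.2.
have cJ p : {for y0, continuous (hJ p)}.
  have [+ _] := CJ p.1 p.2; move=> /(_ y0 Yy0); exact: differentiable_continuous.
pose hD (p : 'I_m * 'I_m * 'I_m) y := 'D_(delta_mx 0 p.2) (fun y => J y p.1.1 p.1.2) y.
have cD p : {for y0, continuous (hD p)} by have [_] := CJ p.1.1 p.1.2; apply.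
have [KA KA0 nA] := near_bounded cA; have [KX KX0 nX] := near_bounded cX.
have [KJ KJ0 nJ] := near_bounded cJ; have [KD KD0 nD] := near_bounded cD.
have nC := near_close e10 cA.
have nY : \forall y \near y0, Y y by exact: open_nbhs_nbhs.
have [r r0 Hr] := nbhs_norm_ball
  (filterI nY (filterI nC (filterI (filterI nA nX) (filterI nJ nD)))).
pose M : R := m%:R.
have M0 : 0 <= M by exact: ler0n.
pose K1 := M ^+ 2 * KA; pose K2 := M ^+ 3 * KJ ^+ 2.
pose K3 := M ^+ 3 * (M * KD) ^+ 2; pose K4 := M * (M ^+ 2 * KX) ^+ 2.
have K10 : 0 <= K1 by rewrite mulr_ge0 ?exprn_ge0.
have K20 : 0 <= K2 by rewrite mulr_ge0 ?exprn_ge0.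
have K30 : 0 <= K3 by rewrite mulr_ge0 ?exprn_ge0 // mulr_ge0.
have K40 : 0 <= K4 by rewrite mulr_ge0 ?exprn_ge0 // mulr_ge0 ?exprn_ge0.
exists r, (e0 / 2), (K1 + K2 + K3 + K4); split; last by move=> y /Hr[].
have wk (k t : R) : k <= K1 + K2 + K3 + K4 -> 0 <= t -> k * t <= (K1 + K2 + K3 + K4) * t.
  by move=> ? ?; exact: ler_wpM2r.
split=> //; first by rewrite divr_gt0.
- by rewrite !addr_ge0.
- move=> y v /Hr[Yy [yC [[yA _] _]]].
  rewrite curl_qform; last by move=> j; exact: dA.
  apply/andP; split; last first.
    apply: (@le_trans _ _ (K1 * dotp v v)); last by apply: wk; [lra|exact: dotp_ge0].
    apply: (le_trans (ler_norm _)); apply: qform_bound => i j; exact: (yA (i, j)).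
  have : `|qform (fun i j => hA (i, j) y - hA (i, j) y0) v| <= M ^+ 2 * e1 * dotp v v.
    by apply: qform_bound => i j; exact: (yC (i, j)).
  have -> : qform (fun i j => hA (i, j) y - hA (i, j) y0) v =
      qform (curl_coef J (Jdiff J f) y) v - qform (curl_coef J (Jdiff J f) y0) v.
    rewrite /qform -sumrB; apply: eq_bigr => i _; rewrite -sumrB.
    by apply: eq_bigr => j _; rewrite -mulrBr.
  move=> qq; apply: half_perturbation (He0 v) qq _.
  apply: ler_wpM2r; first exact: dotp_ge0.
  rewrite /e1 mulrA ler_pdivrMr // mulrC ler_wpM2l //; first by rewrite divr_ge0 // ltW.
  by rewrite /M lerDl.
- move=> y v /Hr[_ [_ [_ [yJ _]]]].
  apply: (@le_trans _ _ (K2 * dotp v v)); last by apply: wk; [lra|exact: dotp_ge0].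
  by apply: dotp_mulmx_le => // i j; exact: (yJ (i, j)).
- move=> y y' v yr y'r.
  pose s := Num.sqrt (dotp (y - y') (y - y')).
  have ss : s ^+ 2 = dotp (y - y') (y - y') by rewrite sqr_sqrtr // dotp_ge0.
  have := @dotp_mulmx_le (J y - J y') v (M * KD * s).
  rewrite !mulr_ge0 ?sqrtr_ge0 // => /(_ isT) H.
  apply: (@le_trans _ _ (K3 * dotp v v * dotp (y - y') (y - y'))).
    rewrite /K3 -ss (_ : _ * s ^+ 2 = M ^+ 3 * (M * KD * s) ^+ 2 * dotp v v).
      apply: H => i j; rewrite !mxE.
      apply: (@lipschitz_ball (fun y => J y i j) y0 r) => //.
      + move=> y1 /Hr[Yy1 _]; have [+ _] := CJ i j; exact.
      + by move=> y1 k /Hr[_ [_ [_ [_ yD]]]]; exact: (yD (i, j, k)).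
    by ring.
  apply: ler_wpM2r; first exact: dotp_ge0.
  by apply: wk; [lra|exact: dotp_ge0].
- move=> y v q /Hr[Yy [_ [[_ yX] _]]] qE.
  apply: (@le_trans _ _ (K4 * dotp v v ^+ 2)); last by apply: wk; [lra|exact: sqr_ge0].
  have -> : K4 * dotp v v ^+ 2 = \sum_(i < m) (M ^+ 2 * KX * dotp v v) ^+ 2.
    by rewrite sumr_const card_ord -[RHS]mulr_natr /K4 /M; ring.
  apply: ler_sum => i _; rewrite -expr2 -real_normK ?num_real //.
  rewrite ler_pXn2r // ?nnegrE ?mulr_ge0 ?exprn_ge0 ?dotp_ge0 //.
  rewrite qE curl_qform; last by move=> j; exact: dX.
  by apply: qform_bound => a b; exact: (yX (i, a, b)).
Qed.

End LocalBounds.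

(** * Manifolds and discs in charts *)

Section Charts.
Context {R : realType} {m : nat} (M : manifold R m).
Let E := 'rV[R]_m.
Implicit Types (c d : chart R m M) (p q : M).

Lemma near_chart_cod c p : chart_dom c p -> \forall y \near c p, (c @` chart_dom c) y.
Proof.
move=> cp; apply: open_nbhs_nbhs; split; first exact: chart_cod_open.
by exists p.
Qed.

Lemma chart_inv_continuous c p : chart_dom c p -> {for c p, continuous (chart_inv c)}.
Proof. by move=> cp; apply: chart_inv_cts; exists p. Qed.

Lemma near_chart_inv c p (P : M -> Prop) : chart_dom c p -> (\forall q \near p, P q) ->
  \forall y \near c p, P (chart_inv c y).
Proof.
move=> cp Pp; apply: (near_comp (chart_inv_continuous cp)).
by rewrite chart_mapK.
Qed.

Lemma open_chart_image c (U : set M) : open U -> open (c @` (chart_dom c `&` U)).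
Proof.
move=> Uo; rewrite openE => _ [p [cp Up] <-].
have nU : \forall q \near p, U q by exact: open_nbhs_nbhs.
near=> y.
have [q cq qy] : (c @` chart_dom c) y by near: y; exact: near_chart_cod.
have : U (chart_inv c y) by near: y; exact: near_chart_inv.
by rewrite -qy chart_mapK // => Uq; exists q.
Unshelve. all: by end_near. Qed.

Lemma differentiable_transition c d p : atlas c -> atlas d ->
  chart_dom c p -> chart_dom d p -> differentiable (d \o chart_inv c) (c p).
Proof.
move=> ac ad cp dp; have [+ _] := atlas_compatible ac ad 1; apply.
by exists p.
Qed.

Lemma near_transitionK c d p : chart_dom c p -> chart_dom d p ->
  \forall y \near c p, ((c \o chart_inv d) \o (d \o chart_inv c)) y = y.
Proof.
move=> cp dp.
have nd : \forall q \near p, chart_dom d q.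
  by apply: open_nbhs_nbhs; split; [exact: chart_dom_open|].
near=> y.
have [q cq qy] : (c @` chart_dom c) y by near: y; exact: near_chart_cod.
have : chart_dom d (chart_inv c y) by near: y; exact: near_chart_inv.
by rewrite -qy /= chart_mapK // => dq; rewrite !chart_mapK.
Unshelve. all: by end_near. Qed.

Lemma near_eq_diff (V W : normedModType R) (f g : V -> W) (x v : V) :
  (\forall y \near x, f y = g y) -> differentiable f x -> differentiable g x ->
  'd f x v = 'd g x v.
Proof. by move=> fg df dg; rewrite -!deriveE //; exact: near_eq_derive. Qed.

Lemma diff_compE (U V W : normedModType R) (f : U -> V) (g : V -> W) (x v : U) :
  differentiable f x -> differentiable g (f x) ->
  'd (g \o f) x v = 'd g (f x) ('d f x v).
Proof. by move=> df dg; rewrite diff_comp. Qed.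

Lemma diff_transitionK c d p (v : E) : atlas c -> atlas d ->
  chart_dom c p -> chart_dom d p ->
  'd (c \o chart_inv d) (d p) ('d (d \o chart_inv c) (c p) v) = v.
Proof.
move=> ac ad cp dp.
have d1 := differentiable_transition ac ad cp dp.
have e : (d \o chart_inv c) (c p) = d p by rewrite /= chart_mapK.
have d2 : differentiable (c \o chart_inv d) ((d \o chart_inv c) (c p)).
  by rewrite e; exact: differentiable_transition.
have dc := differentiable_comp d1 d2.
have [did didE] : is_diff (c p) (id : E -> E) id by exact: is_diff_id.
have ne := near_eq_diff v (near_transitionK cp dp) dc did.
have H : 'd (c \o chart_inv d) ((d \o chart_inv c) (c p))
    ('d (d \o chart_inv c) (c p) v) = v.
  exact: etrans (esym (diff_compE v d1 d2)) (etrans ne (congr1 (fun h => h v) didE)).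
exact: (eq_ind _ (fun y => 'd (c \o chart_inv d) y _ = v) H _ e).
Qed.

Lemma of_chartK c p (w : E) : atlas c -> chart_dom c p ->
  to_chart c (of_chart c p w) = w.
Proof.
move=> ac cp; apply: diff_transitionK => //; first exact: chart_at_atlas.
exact: chart_at_dom.
Qed.

Lemma to_chartK c p (v : tangent p) : atlas c -> chart_dom c p ->
  of_chart c p (to_chart c v) = v.
Proof.
move=> ac cp; apply: diff_transitionK => //; first exact: chart_at_atlas.
exact: chart_at_dom.
Qed.

Lemma Ck_fun_differentiable k c (U : set M) (u : M -> R) p : Ck_fun k.+1 U u ->
  atlas c -> chart_dom c p -> U p -> differentiable (u \o chart_inv c) (c p).
Proof. by move=> Cu ac cp Up; have [+ _] := Cu c ac; apply; exists p. Qed.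

Lemma dfun_chart k c (U : set M) (u : M -> R) p (v : tangent p) :
  Ck_fun k.+1 U u -> U p -> atlas c -> chart_dom c p ->
  dfun u v = 'd (u \o chart_inv c) (c p) (to_chart c v).
Proof.
move=> Cu Up ac cp; pose b := chart_at p.
have bp : chart_dom b p by exact: chart_at_dom.
have ab : atlas b by exact: chart_at_atlas.
have dt := differentiable_transition ab ac bp cp.
have e : (c \o chart_inv b) (b p) = c p by rewrite /= chart_mapK.
have du : differentiable (u \o chart_inv c) ((c \o chart_inv b) (b p)).
  by rewrite e; exact: Ck_fun_differentiable Cu ac cp Up.
have dc := differentiable_comp dt du.
have db : differentiable (u \o chart_inv b) (b p).
  exact: Ck_fun_differentiable Cu ab bp Up.
have ne : \forall y \near b p,
    ((u \o chart_inv c) \o (c \o chart_inv b)) y = (u \o chart_inv b) y.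
  have nd : \forall q \near p, chart_dom c q.
    by apply: open_nbhs_nbhs; split; [exact: chart_dom_open|].
  by apply: filterS (near_chart_inv bp nd) => y cy; rewrite /= chart_mapK.
have h1 := diff_compE v dt du; have h2 := near_eq_diff v ne dc db.
have h3 : 'd (u \o chart_inv c) ((c \o chart_inv b) (b p)) =
    'd (u \o chart_inv c) (c p) :> (E -> R).
  exact: (congr1 (fun y => 'd (u \o chart_inv c) y : E -> R) e).
exact: (etrans (esym h2) (etrans h1 (congr1 (fun h => h _) h3))).
Qed.

Variable J : almost_complex M.

(* Acts on row vectors: [w *m Jmx c y] is [J w] in the chart [c]. *)
Definition Jmx c (y : E) : 'M[R]_m := \matrix_(i, j)
  to_chart c (J (chart_inv c y) (of_chart c (chart_inv c y) (delta_mx 0 i))) 0 j.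

Lemma to_chart_linear c p a (u v : tangent p) :
  to_chart c (a *: u + v) = a *: to_chart c u + to_chart c v.
Proof. exact: linearP. Qed.

Lemma of_chart_linear c p a (u v : E) :
  of_chart c p (a *: u + v) = a *: of_chart c p u + of_chart c p v.
Proof. exact: linearP. Qed.

Lemma row_expansion (f : E -> E) (w : E) :
  (forall (a : R) u v, f (a *: u + v) = a *: f u + f v) ->
  f w = \sum_k w 0 k *: f (delta_mx 0 k).
Proof.
move=> H; have f0 : f 0 = 0.
  by have := H (-1) 0 0; rewrite scaler0 add0r scaleN1r addNr.
have fD u v : f (u + v) = f u + f v by have := H 1 u v; rewrite !scale1r.
rewrite [in LHS](row_sum_delta w) (big_morph f fD f0); apply: eq_bigr => k _.
by rewrite -[X in f X]addr0 H f0 addr0.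
Qed.

Lemma JmxE c (y w : E) :
  w *m Jmx c y = to_chart c (J (chart_inv c y) (of_chart c (chart_inv c y) w)).
Proof.
pose f (w : E) := to_chart c (J (chart_inv c y) (of_chart c (chart_inv c y) w)).
rewrite -[RHS]/(f w) (@row_expansion f w) => [|a u v].
  apply/rowP => j; rewrite mxE summxE; apply: eq_bigr => i _.
  by rewrite !mxE.
pose q := chart_inv c y.
exact: etrans (congr1 (fun w => to_chart c (J q w)) (of_chart_linear c q a u v))
  (etrans (congr1 (@to_chart _ _ _ c q) (linearP (J q) a _ _))
    (to_chart_linear c a _ _)).
Qed.

Lemma to_chart_J c p (v : tangent p) : atlas c -> chart_dom c p ->
  to_chart c (J p v) = to_chart c v *m Jmx c (c p).
Proof. by move=> ac cp; rewrite JmxE chart_mapK // to_chartK. Qed.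

Lemma Jmx_sqr c (y : E) : atlas c -> (c @` chart_dom c) y ->
  Jmx c y *m Jmx c y = - 1%:M.
Proof.
move=> ac [p cp <-]; apply/row_matrixP => i.
rewrite !rowE mulmxA -[delta_mx 0 i](of_chartK _ ac cp) -!to_chart_J // acs_sqr.
rewrite mulmxN mulmx1 /to_chart; exact: linearN.
Qed.

Lemma Ck1_coord (Y : set E) (F : E -> E) (j : 'I_m) : open Y -> Ck 1 Y F ->
  Ck 1 Y (fun y => F y 0 j).
Proof.
move=> Yo [dF cF]; split=> [y Yy|v y Yy].
  by apply: differentiable_row; exact: dF.
apply: (@continuous_near_eq _ _ (fun y => 'D_v F y 0 j)).
  apply: filterS (open_nbhs_nbhs (conj Yo Yy)) => y' Yy'.
  have [_ ->] // : is_derive y' v (fun y => F y 0 j) ('D_v F y' 0 j).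
  by apply: is_derive_coord; apply: diff_derivable; exact: dF.
apply: (continuous_comp (f := 'D_v F) (g := fun w : E => w 0 j)).
  exact: cF.
exact: entry_continuous.
Qed.

Lemma Ck1_Jmx c i j : atlas c -> Ck 1 (c @` chart_dom c) (fun y => Jmx c y i j).
Proof.
move=> ac; have := Ck1_coord j (@chart_cod_open _ _ _ c) (acs_smooth J ac (delta_mx 0 i) 1).
by congr Ck; apply/funext => y; rewrite mxE.
Qed.

End Charts.

(** * Pseudo-holomorphic discs read in charts *)

Section Discs.
Context {R : realType} {m : nat} {M : manifold R m} (J : almost_complex M).
Let E := 'rV[R]_m.
Implicit Types (c : chart R m M) (p : M).

Lemma to_chart_at p (v : tangent p) : to_chart (chart_at p) v = v.
Proof.
have ap := @chart_at_atlas _ _ M p; have dp := @chart_at_dom _ _ M p.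
have d1 := differentiable_transition ap ap dp dp.
have nid : \forall y \near chart_at p p, (chart_at p \o chart_inv (chart_at p)) y = y.
  by apply: filterS (near_chart_cod dp) => _ [q qp <-] /=; rewrite chart_mapK.
have [did didE] : is_diff (chart_at p p) (id : E -> E) id by exact: is_diff_id.
exact: etrans (near_eq_diff v nid d1 did) (congr1 (fun h => h v) didE).
Qed.

(** An identity on a neighbourhood, because both sides are differentiated at [c p] to compute the
    Levi form. *)
Lemma near_dfun_Jstar k c (U : set M) (u : M -> R) p (x : E) : open U ->
  Ck_fun k.+1 U u -> U p -> atlas c -> chart_dom c p ->
  \forall y \near c p,
    Jstar J (@dfun R m M u) (of_chart c (chart_inv c y) x) =
    \sum_j x 0 j * Jdiff (Jmx J c) (u \o chart_inv c) j y.
Proof.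
move=> Uo Cu Up ac cp.
have nU : \forall q \near p, U q by exact: open_nbhs_nbhs.
have nUy := near_chart_inv cp nU.
have ncy := near_chart_cod cp.
apply: filterS (filterI ncy nUy) => _ [[q cq <-]].
rewrite chart_mapK // => Uq.
have dq := Ck_fun_differentiable Cu ac cq Uq.
rewrite /Jstar (dfun_chart _ Cu Uq ac cq) -(diff_mulJ _ _ dq).
by rewrite (to_chart_J _ _ ac cq) (of_chartK _ ac cq).
Qed.

Lemma Ck_sub k (V W : normedModType R) (A B : set V) (g : V -> W) : B `<=` A ->
  Ck k A g -> Ck k B g.
Proof.
move=> BA; elim: k g => [|k IH] g /=; first by move=> H x /BA; exact: H.
by move=> [dg Dg]; split=> [x /BA|v]; [exact: dg|exact: IH].
Qed.

Lemma Ck1_Jmx_sub c (U : set M) i j : atlas c ->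
  Ck 1 (c @` (chart_dom c `&` U)) (fun y => Jmx J c y i j).
Proof.
move=> ac; apply: Ck_sub (Ck1_Jmx J i j ac) => _ [x [xc _] <-].
by exists x.
Qed.

Lemma Ck1_Jdiff_chart c (U : set M) (u : M -> R) j : open U -> Ck_fun 2 U u ->
  atlas c ->
  Ck 1 (c @` (chart_dom c `&` U)) (Jdiff (Jmx J c) (u \o chart_inv c) j).
Proof.
move=> Uo Cu ac.
apply: (Ck1_Jdiff j _ _ (Cu c ac)); first exact: open_chart_image.
by move=> i k; exact: Ck1_Jmx_sub.
Qed.

(** In the preferred chart a tangent vector is its own coordinate vector, and the minus sign of
    [levi] is the one built into [curl]. *)
Lemma levi_curl k (U : set M) (u : M -> R) p (v : tangent p) (c := chart_at p) :
  open U -> Ck_fun k.+1 U u -> U p ->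
  (forall j, differentiable (Jdiff (Jmx J c) (u \o chart_inv c) j) (c p)) ->
  levi J u v = curl (Jdiff (Jmx J c) (u \o chart_inv c)) (c p) v (v *m Jmx J c (c p)).
Proof.
move=> Uo Cu Up dA.
have ac : atlas c by exact: chart_at_atlas.
have cp : chart_dom c p by exact: chart_at_dom.
have Jv : J p v = (v : E) *m Jmx J c (c p).
  by rewrite -{2}(to_chart_at v) -(to_chart_J J v ac cp) to_chart_at.
have D (x w : E) : 'D_w (fun y => Jstar J (@dfun R m M u)
     (of_chart c (chart_inv c y) x)) (c p) =
    \sum_j x 0 j * 'd (Jdiff (Jmx J c) (u \o chart_inv c) j) (c p) w.
  rewrite (near_eq_derive w (near_dfun_Jstar x Uo Cu Up ac cp)).
  have [_ ->] // : is_derive (c p) w (fun y => \sum_j x 0 j *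
      Jdiff (Jmx J c) (u \o chart_inv c) j y)
    (\sum_j x 0 j * 'd (Jdiff (Jmx J c) (u \o chart_inv c) j) (c p) w).
  apply: is_derive_big_sum => j; rewrite -deriveE //.
  have dj : is_derive (c p) w (Jdiff (Jmx J c) (u \o chart_inv c) j)
      ('D_w (Jdiff (Jmx J c) (u \o chart_inv c) j) (c p)).
    by apply: derivableP; exact: diff_derivable.
  have := is_derive_mul (is_derive_cst (x 0 j) (c p) w) dj.
  by rewrite mulr0 addr0.
rewrite /levi /ext_deriv -/c /=.
rewrite (D (J p v) v) (D v (J p v)) Jv /curl opprB sumrB //.
Qed.

Lemma open_unit_disc : open (@unit_disc R).
Proof.
rewrite openE => z zd; rewrite /interior.
have e z' : sqdist (0, 0) z' = z'.1 ^+ 2 + z'.2 ^+ 2 by rewrite /sqdist /= !subr0.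
have : sqdist (0, 0) z < 1 by rewrite e.
by move/(near_lt (@sqdist_continuous R (0, 0) z)); apply: filterS => z'; rewrite e.
Qed.

Variable f : R * R -> M.
Hypothesis hf : J_holomorphic_disc J f.

Lemma disc_continuous z : unit_disc z -> {for z, continuous f}.
Proof. by move=> zd; apply: hf.1.1. Qed.

Lemma open_disc_dom (U : set M) : open U -> open (@unit_disc R `&` f @^-1` U).
Proof.
move=> Uo; rewrite openE => z [zd cz]; apply: filterI.
  exact: (open_nbhs_nbhs (conj open_unit_disc zd)).
apply: (near_comp (disc_continuous zd)).
exact: open_nbhs_nbhs.
Qed.

Lemma disc_differentiable c z : atlas c -> unit_disc z -> chart_dom c (f z) ->
  differentiable (c \o f) z.
Proof. by move=> ac zd cz; have [+ _] := hf.1.2 c ac 1; apply. Qed.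

Lemma disc_to_chart c z (w : R * R) : atlas c -> unit_disc z -> chart_dom c (f z) ->
  to_chart c (dmap f z w) = 'D_w (c \o f) z.
Proof.
move=> ac zd cz; pose b := chart_at (f z).
have ab : atlas b by exact: chart_at_atlas.
have bz : chart_dom b (f z) by exact: chart_at_dom.
have db := disc_differentiable ab zd bz.
have dc := disc_differentiable ac zd cz.
have dt := differentiable_transition ab ac bz cz.
have nb : \forall z' \near z, chart_dom b (f z').
  apply: (near_comp (disc_continuous zd)).
  by apply: open_nbhs_nbhs; split; [exact: chart_dom_open|].
have ne : \forall z' \near z, ((c \o chart_inv b) \o (b \o f)) z' = (c \o f) z'.
  by apply: filterS nb => z' bz'; rewrite /= chart_mapK.
have dd := differentiable_comp db dt.
have h1 := diff_compE w db dt; have h2 := near_eq_diff w ne dd dc.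
rewrite (deriveE _ dc).
exact: (etrans (esym h1) h2).
Qed.

Lemma disc_holomorphic c z : atlas c -> unit_disc z -> chart_dom c (f z) ->
  'D_(0, 1) (c \o f) z = 'D_(1, 0) (c \o f) z *m Jmx J c (c (f z)).
Proof.
move=> ac zd cz.
have e : (0, 1) = Jst ((1, 0) : R * R) by rewrite /Jst /= oppr0.
rewrite -!disc_to_chart // e (hf.2 z zd (1, 0)).
exact: to_chart_J.
Qed.

(** The chart around [f z] is arbitrary: local bounds hold in one fixed chart, whereas the preferred
    chart varies with [f z]. *)
Lemma disc_laplacian c (U : set M) (u : M -> R) z :
  open U -> Ck_fun 2 U u -> atlas c -> unit_disc z -> chart_dom c (f z) -> U (f z) ->
  let w := 'D_(1, 0) (c \o f) z in let y := c (f z) in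
  pjet (u \o f) z (dfun u (dmap f z (1, 0))) (dfun u (J (f z) (dmap f z (1, 0))))
    (curl (Jdiff (Jmx J c) (u \o chart_inv c)) y w (w *m Jmx J c y)).
Proof.
move=> Uo Cu ac zd cz Uz w y.
pose O := @unit_disc R `&` f @^-1` (chart_dom c `&` U).
have Oo : open O.
  apply: open_disc_dom; apply: openI => //; exact: chart_dom_open.
pose Y := c @` (chart_dom c `&` U).
have Oz : O z by [].
have subO k : Ck k O (c \o f) by apply: Ck_sub (hf.1.2 c ac k) => z' [? []].
have CA j : Ck 1 Y _ := Ck1_Jdiff_chart j Uo Cu ac.
have Cr : forall y, Y y -> differentiable (u \o chart_inv c) y.
  by have [] := Cu c ac.
have dA j y' : Y y' -> differentiable (Jdiff (Jmx J c) (u \o chart_inv c) j) y'.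
  exact: (CA j).1.
have := laplacian_comp (F := c \o f) (J := Jmx J c) Oo _ (subO 2) _ _ Cr dA Oz.
have h1 z' : O z' -> Y ((c \o f) z') by move=> [_ fz]; exists (f z').
have h2 z' : O z' -> 'D_(0, 1) (c \o f) z' =
    'D_(1, 0) (c \o f) z' *m Jmx J c ((c \o f) z').
  by move=> [zd' [cz' _]]; exact: disc_holomorphic.
have h3 y' : Y y' -> Jmx J c y' *m Jmx J c y' = - 1%:M.
  by move=> [q [qc _] <-]; apply: Jmx_sqr => //; exists q.
move=> /(_ h1 h2 h3) /= j.
have ne : \forall z' \near z, ((u \o chart_inv c) \o (c \o f)) z' = (u \o f) z'.
  apply: filterS (open_nbhs_nbhs (conj Oo Oz)) => z' [_ [cz' _]].
  by rewrite /= chart_mapK.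
have {}j := pjet_near_eq ne j.
have e1 := dfun_chart (dmap f z (1, 0)) Cu Uz ac cz.
have e2 := dfun_chart (J (f z) (dmap f z (1, 0))) Cu Uz ac cz.
rewrite (to_chart_J J _ ac cz) (disc_to_chart _ ac zd cz) in e2.
rewrite (disc_to_chart _ ac zd cz) in e1.
by apply: pjet_eq j _ _ erefl; [exact: esym e1|exact: esym e2].
Qed.

(** Chart-free form, for points of the disc that may have left the chart of the local bounds; there
    the sign of the Laplacian suffices. *)
Lemma disc_levi (U : set M) (u : M -> R) z :
  open U -> Ck_fun 2 U u -> unit_disc z -> U (f z) ->
  pjet (u \o f) z (dfun u (dmap f z (1, 0))) (dfun u (J (f z) (dmap f z (1, 0))))
    (levi J u (dmap f z (1, 0))).
Proof.
move=> Uo Cu zd Uz; pose c := chart_at (f z).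
have ac : atlas c by exact: chart_at_atlas.
have cz : chart_dom c (f z) by exact: chart_at_dom.
have j := disc_laplacian Uo Cu ac zd cz Uz.
apply: pjet_eq j erefl erefl _.
have CA j := Ck1_Jdiff_chart j Uo Cu ac.
have dA j : differentiable (Jdiff (Jmx J c) (u \o chart_inv c) j) (c (f z)).
  by apply: (CA j).1; exists (f z).
have := levi_curl (dmap f z (1, 0)) Uo Cu Uz dA.
by rewrite -(disc_to_chart (1, 0) ac zd cz) to_chart_at => ->.
Qed.

End Discs.

(** * The tangential estimate *)

Section Cutoff.
Context {R : realType} {m : nat} {M : manifold R m}.
Let E := 'rV[R]_m.

(** Membership in the chart is tested because [c q] is meaningless elsewhere; [1] is the value at
    which the radial profile is critical. *)
Definition cutoff (c : chart R m M) (h : E -> R) (q : M) : R :=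
  if `[< chart_dom c q /\ h (c q) <= 1 >] then h (c q) else 1.

(* As the manifold is Hausdorff, the compact set [h <= 1] of the chart is closed in
   the whole manifold. *)
Lemma cutoff_cases (c : chart R m M) (h : E -> R) (q : M) :
  compact [set y | h y <= 1] -> [set y | h y <= 1] `<=` c @` chart_dom c ->
  [/\ chart_dom c q, h (c q) <= 1 &
    \forall q' \near q, cutoff c h q' = Num.min (h (c q')) 1] \/
  (\forall q' \near q, cutoff c h q' = 1).
Proof.
move=> Qc Qsub; pose Q := chart_inv c @` [set y | h y <= 1].
have Qcl : closed Q.
  apply: compact_closed; first exact: manifold_hausdorff.
  apply: continuous_compact => //; apply: continuous_in_subspaceT => y /set_mem hy.
  exact: chart_inv_cts (Qsub _ hy).
have [[y hy yq]|nQ] := pselect (Q q).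
  left; have [q' cq' qy] := Qsub y hy.
  move: yq; rewrite -qy chart_mapK // => <-; split=> //; first by rewrite qy.
  have nd : \forall q \near q', chart_dom c q.
    by apply: open_nbhs_nbhs; split; [exact: chart_dom_open|].
  apply: filterS nd => p cp; rewrite /cutoff.
  case: asboolP => [[_ hp]|np]; first by rewrite (min_idPl hp).
  by case: (leP (h (c p)) 1) => // hp; case: np.
right; have nq : \forall q' \near q, (~` Q) q'.
  by apply: open_nbhs_nbhs; split => //; exact: closed_openC.
apply: filterS nq => q' nQ'; rewrite /cutoff; case: asboolP => // -[cq hq].
by case: nQ'; exists (c q') => //; rewrite chart_mapK.
Qed.

Lemma cutoff_bounds (c : chart R m M) (h : E -> R) q : (forall y, 0 <= h y) ->
  0 <= cutoff c h q <= 1.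
Proof.
by move=> h0; rewrite /cutoff; case: asboolP => [[_ ->]|_]; rewrite ?h0 ?ler01 /=.
Qed.

Lemma cutoff_continuous (V : topologicalType) (f : V -> M) (z : V)
    (c : chart R m M) (h : E -> R) :
  compact [set y | h y <= 1] -> [set y | h y <= 1] `<=` c @` chart_dom c ->
  continuous h -> {for z, continuous f} ->
  {for z, continuous (cutoff c h \o f)}.
Proof.
move=> Qc Qsub hc fc; have [[cz _ nT]|nT] := cutoff_cases (f z) Qc Qsub.
  have nz := near_comp fc nT.
  apply: (@continuous_near_eq _ _ (fun z' => Num.min (h (c (f z'))) 1)).
    by apply: filterS nz => z' /= ->.
  have hcf : {for z, continuous (fun z' => h (c (f z')))}.
    apply: (continuous_comp (f := f) (g := h \o c)) => //.
    apply: (continuous_comp (f := c) (g := h)); last exact: hc.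
    exact: chart_map_cts.
  have cc : {for z, continuous (fun=> 1 : R)} by exact: cst_continuous.
  exact: (continuous_min hcf cc).
have nz := near_comp fc nT.
apply: (@continuous_near_eq _ R (fun=> 1)); last exact: cst_continuous.
by apply: filterS nz => z' /= ->.
Qed.

Lemma norm_le_dotp (v : E) (s : R) : 0 <= s -> dotp v v <= s ^+ 2 -> `|v| <= s.
Proof.
move=> s0 vs; rewrite [leLHS]/Num.Def.normr/= mx_normrE.
apply: bigmax_le => // -[i j] _ /=; rewrite ord1.
rewrite -(@ler_pXn2r _ 2) ?nnegrE // real_normK ?num_real //.
exact: le_trans (sqr_coord_le v j) vs.
Qed.

Lemma hnorm2_continuous (B : 'M[R]_m) (y0 : E) : continuous (fun y : E => hnorm2 B (y - y0)).
Proof.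
have ce j : continuous (fun y : E => (y - y0) 0 j).
  move=> y; apply: (@continuous_near_eq _ _ (fun y : E => y 0 j - y0 0 j)).
    by apply: near_all => y'; rewrite !mxE.
  by apply: continuous_sub; [exact: entry_continuous|exact: cst_continuous].
have cB j : continuous (fun y : E => ((y - y0) *m B) 0 j).
  move=> y; apply: (@continuous_near_eq _ _ (fun y : E => \sum_k (y - y0) 0 k * B k j)).
    by apply: near_all => y'; rewrite mxE.
  apply: continuous_sum_ord => k; apply: continuous_mul; first exact: ce.
  exact: cst_continuous.
move=> y; apply: (@cvgD _ _ _ (nbhs y)); apply: continuous_sum_ord => j.
  by apply: continuous_mul; exact: ce.
by apply: continuous_mul; exact: cB.
Qed.

Lemma dotp_le_hnorm2 (B : 'M[R]_m) (v : E) : dotp v v <= hnorm2 B v.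
Proof. by rewrite /hnorm2 /hip lerDl dotp_ge0. Qed.

End Cutoff.

Section DiscCoordinates.
Context {R : realType} {m : nat} {M : manifold R m} (J : almost_complex M).
Let E := 'rV[R]_m.
Implicit Types (c : chart R m M) (p : M).
Variable f : R * R -> M.
Hypothesis hf : J_holomorphic_disc J f.

(** This is [laplacian_comp] for the coordinate functions: the second-order term is quadratic in the
    velocity [w], and would vanish for a constant structure. *)
Lemma disc_rjet c z : atlas c -> unit_disc z -> chart_dom c (f z) ->
  let w := 'D_(1, 0) (c \o f) z in let y := c (f z) in
  rjet (c \o f) z w (w *m Jmx J c y)
    (\row_i curl (Jdiff (Jmx J c) (fun y => y 0 i)) y w (w *m Jmx J c y)).
Proof.
move=> ac zd cz w y i.
pose O := @unit_disc R `&` f @^-1` chart_dom c.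
have Oo : open O by apply: (open_disc_dom hf); exact: chart_dom_open.
pose Y := c @` chart_dom c.
have Yo : open Y by exact: chart_cod_open.
have CA j := Ck1_Jdiff j Yo (fun a b => Ck1_Jmx J a b ac) (Ck2_coord Y i).
have dcoord (y' : E) : differentiable (fun y : E => y 0 i) y'.
  exact: differentiable_coord.
have h1 z' : O z' -> Y ((c \o f) z') by move=> [_ fz]; exists (f z').
have h2 z' : O z' -> 'D_(0, 1) (c \o f) z' =
    'D_(1, 0) (c \o f) z' *m Jmx J c ((c \o f) z').
  by move=> [zd' cz']; exact: disc_holomorphic.
have := laplacian_comp (F := c \o f) (J := Jmx J c) Oo h1 (hf.1.2 c ac 2) h2
  (fun y' => @Jmx_sqr _ _ _ J c y' ac) (fun y' _ => dcoord y')
  (fun j => (CA j).1) (conj zd cz : O z).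
have dE (v y' : E) : 'd (fun y : E => y 0 i) y' v = v 0 i.
  by rewrite -deriveE ?derive_coord.
by rewrite /= !dE mxE.
Qed.

Lemma disc_comp_continuous (U : set M) (u : M -> R) z : open U -> Ck_fun 2 U u ->
  unit_disc z -> U (f z) -> {for z, continuous (u \o f)}.
Proof.
move=> Uo Cu zd Uz; pose c := chart_at (f z).
have ac : atlas c by exact: chart_at_atlas.
have cz : chart_dom c (f z) by exact: chart_at_dom.
have du := Ck_fun_differentiable Cu ac cz Uz.
have dc := disc_differentiable hf ac zd cz.
have nd : \forall z' \near z, chart_dom c (f z').
  apply: (near_comp (disc_continuous hf zd)).
  by apply: open_nbhs_nbhs; split; [exact: chart_dom_open|].
apply: (@continuous_near_eq _ _ ((u \o chart_inv c) \o (c \o f))).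
  by apply: filterS nd => z' cz'; rewrite /= chart_mapK.
exact: differentiable_continuous (differentiable_comp dc du).
Qed.

(** The constant depends on the disc and disappears from the final estimate: it only keeps
    [ln T - ln (sqdist a)] bounded above at the pole. *)
Lemma near_dotp_le (F : R * R -> E) (a : R * R) : differentiable F a ->
  exists2 C : R, 0 <= C &
    \forall z \near a, dotp (F z - F a) (F z - F a) <= C * sqdist a z.
Proof.
move=> dF.
have [k k0 Hk] : exists2 k : 'I_m -> R, (forall j, 0 <= k j) &
    forall j, \forall z \near a, `|F z 0 j - F a 0 j| ^+ 2 <= k j * sqdist a z.
  pose k j := (`|'D_(1, 0) (fun z => F z 0 j) a| + `|'D_(0, 1) (fun z => F z 0 j) a| + 1) ^+ 2.
  exists k => [j|j]; first exact: sqr_ge0.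
  have := differentiable_linear_approx (differentiable_row j dF) ltr01.
  move=> [d d0 Hd].
  apply/nbhs_ballP; exists d => // z; rewrite -ball_normE /= => zd.
  have {}zd : `|z - a| < d by rewrite distrC.
  pose s := `|z - a|.
  have h1 : `|z.1 - a.1| <= s by rewrite /s prod_normE le_max lexx.
  have h2 : `|z.2 - a.2| <= s by rewrite /s prod_normE le_max lexx orbT.
  have s2 : s ^+ 2 <= sqdist a z.
    rewrite /s prod_normE /= /sqdist.
    case: (leP `|z.1 - a.1| `|z.2 - a.2|) => _; rewrite real_normK ?num_real //.
      by rewrite lerDr sqr_ge0.
    by rewrite lerDl sqr_ge0.
  have := Hd (z.1 - a.1) (z.2 - a.2) s zd h1 h2.
  rewrite !subrKC -surjective_pairing mul1r.
  set al := 'D_(1, 0) _ a; set be := 'D_(0, 1) _ a => b.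
  have s0 : 0 <= s by exact: normr_ge0.
  have b1 : `|al * (z.1 - a.1)| <= `|al| * s by rewrite normrM ler_wpM2l.
  have b2 : `|be * (z.2 - a.2)| <= `|be| * s by rewrite normrM ler_wpM2l.
  have le : `|F z 0 j - F a 0 j| <= (`|al| + `|be| + 1) * s.
    rewrite !mulrDl mul1r; move: b b1 b2.
    move: (F z 0 j) (F a 0 j) (al * _) (be * _) (`|al| * s) (`|be| * s).
    move=> x1 x2 x3 x4 x5 x6.
    rewrite !ler_norml => /andP[? ?] /andP[? ?] /andP[? ?].
    by apply/andP; split; lra.
  apply: (@le_trans _ _ (k j * s ^+ 2)); last by apply: ler_wpM2l => //; exact: sqr_ge0.
  rewrite /k -/al -/be -exprMn ler_pXn2r // nnegrE.
  by rewrite mulr_ge0 // !addr_ge0.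
exists (\sum_j k j); first by apply: sumr_ge0.
apply: filterS (filter_forall _ Hk) => z H.
rewrite mulr_suml; apply: ler_sum => j _; have := H j.
by rewrite real_normK ?num_real // !mxE -expr2.
Qed.

Lemma difference_quotient (F : R * R -> E) (a : R * R) (B : 'M[R]_m) (tau : R) :
  differentiable F a -> tau < hnorm2 B ('D_(1, 0) F a) ->
  forall e, 0 < e -> exists2 x : R, 0 < x < e &
    tau * x ^+ 2 <= hnorm2 B (F (a.1 + x, a.2) - F a).
Proof.
move=> dF tw e e0; pose w := 'D_(1, 0) F a.
have dw : (fun h : R => h^-1 *: (F (h *: (1, 0) + a) - F a)) @ 0^' --> w.
  exact: (diff_derivable dF : derivable F a (1, 0)).
have hc : {for w, continuous (hnorm2 B)}.
  have := @hnorm2_continuous R m B 0 w.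
  by congr (continuous_at _ _); apply/funext => y; rewrite subr0.
have nw : \forall y \near w, tau < hnorm2 B y by exact: (near_gt hc).
have [d /= d0 Hd] := dw _ nw.
pose x := Num.min d e / 2.
have x0 : 0 < x by rewrite divr_gt0 // lt_min d0 e0.
have xm : x < Num.min d e by rewrite /x; move: x0; rewrite /x; lra.
have [xd xe] : x < d /\ x < e by move: xm; rewrite lt_min => /andP.
exists x; first by rewrite x0.
have := Hd x; rewrite /ball /= sub0r normrN gtr0_norm // => /(_ xd).
rewrite gt_eqF // => /(_ isT) /ltW.
have -> : x *: ((1 : R), (0 : R)) + a = (a.1 + x, a.2).
  by apply: injective_projections; rewrite /= ?scaler0 ?add0r // /GRing.scale /= mulr1 addrC.
rewrite /hnorm2 hipZl hipZr mulrA -invfM -expr2 => H.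
by rewrite mulrC -ler_pdivlMl ?exprn_gt0.
Qed.

End DiscCoordinates.

Section DiscEstimate.
Context {R : realType} {m : nat} {M : manifold R m} (J : almost_complex M).
Let E := 'rV[R]_m.

Lemma levi0 (u : M -> R) (p : M) : levi J u (0 : tangent p) = 0.
Proof.
have J0 : J p 0 = 0 := linear0 (J p).
by rewrite /levi /ext_deriv J0 !derive0 subrr oppr0.
Qed.

Variables (U : set M) (rho : M -> R).
Hypotheses (Uo : open U) (Cu : Ck_fun 2 U rho).
Hypothesis psh : forall p, U p -> forall v : tangent p, v <> 0 -> 0 < levi J rho v.
Variables (c : chart R m M) (y0 : E) (r e K : R).
Hypothesis ac : atlas c.
Hypothesis lb : local_bounds (Jmx J c) (rho \o chart_inv c) y0 r e K.
Hypothesis sub : forall y, `|y - y0| < r -> (c @` (chart_dom c `&` U)) y.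

(** [c1] compares the adapted norm with the Euclidean one, [C] is the error constant of
    [hnorm2_almost_holomorphic] for [c = c1], and [eps] is the lower Levi bound measured in the
    adapted norm. *)
Let c1 : R := 1 + K.
Let C : R := 2 * c1 + c1 ^+ 2.
Let eps : R := e / c1.

Let K0 : 0 <= K := lb_K lb.
Let e0 : 0 < e := lb_e lb.
Let c10 : 0 < c1. Proof. by rewrite /c1 ltr_wpDr. Qed.
Let C0 : 0 <= C. Proof. by rewrite addr_ge0 ?mulr_ge0 ?exprn_ge0 // ltW. Qed.
Let eps0 : 0 < eps. Proof. by rewrite divr_gt0. Qed.

Lemma hnorm2_le (yp v : E) : `|yp - y0| < r ->
  hnorm2 (Jmx J c yp) v <= c1 * dotp v v.
Proof.
move=> ypr; have := lb_J lb v ypr.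
by rewrite /hnorm2 /hip /c1 mulrDl mul1r lerD2l.
Qed.

Lemma chart_estimate (y yp w q : E) : `|y - y0| < r -> `|yp - y0| < r ->
  (forall i, q 0 i = curl (Jdiff (Jmx J c) (fun y => y 0 i)) y w (w *m Jmx J c y)) ->
  let B := Jmx J c yp in let x := y - yp in hnorm2 B x <= 1 ->
  4 * hnorm2 B w * (1 - C * Num.sqrt (hnorm2 B x)) <=
    2 * hnorm2 B w + 2 * hnorm2 B (w *m Jmx J c y) + 2 * hip B x q /\
  (2 * hip B x w) ^+ 2 + (2 * hip B x (w *m Jmx J c y)) ^+ 2 <=
    4 * hnorm2 B x * hnorm2 B w * (1 + C * Num.sqrt (hnorm2 B x)).
Proof.
move=> yr ypr qE B x x1.
have hB v := hnorm2_le v ypr.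
have dB v : dotp v v <= hnorm2 B v := dotp_le_hnorm2 B v.
have c1K : c1 * K <= c1 ^+ 2.
  by rewrite expr2; apply: ler_wpM2l; [exact: ltW|rewrite /c1 lerDr].
have BB : B *m B = - 1%:M.
  apply: Jmx_sqr => //; have [p [cp _] pe] := sub ypr; by exists p.
apply: (hnorm2_almost_holomorphic BB (ltW c10) x1).
- apply: (le_trans (hB _)).
  apply: (@le_trans _ _ (c1 * (K * dotp w w * dotp x x))).
    by apply: ler_wpM2l; [exact: ltW|exact: (lb_Jlip lb w yr ypr)].
  rewrite (_ : c1 * _ = c1 * K * (dotp x x * dotp w w)); last by ring.
  rewrite -[leRHS]mulrA; apply: ler_pM => //; last by apply: ler_pM; rewrite ?dotp_ge0.
    by apply: mulr_ge0 => //; exact: ltW.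
  by rewrite mulr_ge0 ?dotp_ge0.
- apply: (le_trans (hB _)).
  apply: (@le_trans _ _ (c1 * (K * dotp w w ^+ 2))).
    by apply: ler_wpM2l; [exact: ltW|exact: (lb_acc lb yr)].
  rewrite mulrA; apply: ler_pM => //; last by rewrite ler_pXn2r // ?nnegrE ?dotp_ge0 ?hnorm2_ge0.
    by apply: mulr_ge0 => //; exact: ltW.
  exact: sqr_ge0.
Qed.

Variable f : R * R -> M.
Hypothesis hf : J_holomorphic_disc J f.
Hypothesis fU : forall z, unit_disc z -> U (f z) /\ rho (f z) < 0.
Variables (a : R * R) (rd mrho : R).
Hypotheses (rd0 : 0 < rd) (mrho0 : 0 < mrho).
Hypothesis ad : forall z, sqdist a z <= rd ^+ 2 -> unit_disc z.
Hypotheses (ca : chart_dom c (f a)) (yar : `|c (f a) - y0| < r / 2).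
Hypothesis rhoa : - rho (f a) <= mrho.

(** [r1] bounds the cut-off radius, which keeps the support in the ball of the local bounds; [kap]
    is the ratio of the squared radius to [- rho (f a)]. *)
Let r1 : R := Num.min r 1 / 4.
Let kap : R := r1 ^+ 2 / mrho.
Let B0 : R := 4 * (1 + 6 * C + 6 * C ^+ 2).

Lemma disc_estimate (w := 'D_(1, 0) (c \o f) a) :
  dotp w w * rd ^+ 2 <= kap * expR (8 * C + 1 + B0 / (eps * kap)) * (- rho (f a)).
Proof.
have r0 : 0 < r := lb_r lb.
have saa : sqdist a a = 0 by rewrite /sqdist !subrr expr0n /= addr0.
have ua : unit_disc a by apply: ad; rewrite saa sqr_ge0.
have [Ua rhoa0] := fU ua.
have m0 : 0 < Num.min r 1 by rewrite lt_min r0 ltr01.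
have r10 : 0 < r1 by rewrite divr_gt0.
have [r1r r11] : r1 < r / 2 /\ r1 <= 1.
  have : Num.min r 1 <= r by rewrite ge_min lexx.
  have : Num.min r 1 <= 1 by rewrite ge_min lexx orbT.
  by rewrite /r1; split; lra.
pose del := - rho (f a).
have del0 : 0 < del by rewrite /del oppr_gt0.
have kap0 : 0 < kap by rewrite divr_gt0 // exprn_gt0.
pose s := r1 * Num.sqrt (del / mrho).
have dm : 0 < del / mrho by rewrite divr_gt0.
have s0 : 0 < s by rewrite mulr_gt0 // sqrtr_gt0.
have s2 : s ^+ 2 = kap * del.
  by rewrite exprMn sqr_sqrtr ?(ltW dm) // /kap; field; rewrite gt_eqF.
have sr1 : s <= r1.
  by rewrite ler_piMr ?(ltW r10) // -sqrtr1 ler_sqrt // ler_pdivrMr // mul1r.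
have s20 : 0 < s ^+ 2 by rewrite exprn_gt0.
have rhs0 : 0 <= kap * expR (8 * C + 1 + B0 / (eps * kap)) * (- rho (f a)).
  by apply: mulr_ge0 (ltW del0); apply: mulr_ge0 (ltW kap0) (expR_ge0 _).
(* A disc stationary at [a] is set apart, as [sibony_estimate] requires [0 < tau]. *)
have [w0|w0] := eqVneq (dotp w w) 0; first by rewrite w0 mul0r.
have dw0 : 0 < dotp w w by rewrite lt_neqAle dotp_ge0 andbT eq_sym.
pose yp := c (f a); pose B := Jmx J c yp.
have ypr : `|yp - y0| < r by apply: (lt_trans yar); lra.
pose N0 := hnorm2 B w.
have dwN : dotp w w <= N0 := dotp_le_hnorm2 B w.
have N00 : 0 < N0 by exact: lt_le_trans dwN.
pose h (y : E) := s ^- 2 * hnorm2 B (y - yp).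
have is0 : 0 < s ^- 2 by rewrite invr_gt0.
have h0 y : 0 <= h y by rewrite mulr_ge0 ?hnorm2_ge0 // ltW.
have hc : continuous h.
  move=> y; have cc : {for y, continuous (fun _ : E => s ^- 2)} by exact: cst_continuous.
  exact: (continuous_mul cc (@hnorm2_continuous R m B yp y)).
have h1E y : h y <= 1 -> hnorm2 B (y - yp) <= s ^+ 2.
  by rewrite /h mulrC ler_pdivrMr // mul1r.
have hr y : h y <= 1 -> `|y - y0| < r.
  move=> /h1E hy; have : `|y - yp| <= s.
    by apply: norm_le_dotp; [exact: ltW|exact: le_trans (dotp_le_hnorm2 B _) hy].
  move=> ys; rewrite -(subrKA yp); apply: (le_lt_trans (ler_normD _ _)).
  by move: yar; rewrite -/yp; lra.
have Qsub : [set y | h y <= 1] `<=` c @` chart_dom c.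
  by move=> y /hr /sub [p [cp _] <-]; exists p.
have Qc : compact [set y | h y <= 1].
  apply: bounded_closed_compact; last exact: (closed_sublevel hc).
  exists (`|y0| + r); split=> [|t ty y /hr yr]; first exact: num_real.
  apply: (le_trans _ (ltW ty)); rewrite -(subrK y0 y).
  by apply: (le_trans (ler_normD _ _)); lra.
pose T := cutoff c h \o f; pose u := rho \o f.
have hya : h yp = 0.
  by rewrite /h /hnorm2 subrr /hip mul0mx /dotp big1 ?addr0 ?mulr0 // => i _; rewrite mxE mul0r.
have Ta : T a = 0.
  rewrite /T /= /cutoff; case: asboolP => [_|]; first exact: hya.
  by case; split=> //; rewrite -/yp hya.
have nT : \forall z \near a, T z = h (c (f z)).
  have [[_ _ n1]|n1] := cutoff_cases (f a) Qc Qsub; last first.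
    by move: Ta; rewrite /T /= (nbhs_singleton n1) => /eqP; rewrite oner_eq0.
  have hcf : {for a, continuous (fun z => h (c (f z)))}.
    apply: (continuous_comp (f := f) (g := h \o c)); first exact: (disc_continuous hf ua).
    apply: (continuous_comp (f := c) (g := h)); last exact: hc.
    exact: chart_map_cts.
  have hlt : h (c (f a)) < 1 by rewrite -/yp hya.
  apply: filterS (filterI (near_comp (disc_continuous hf ua) n1) (near_lt hcf hlt)).
  by move=> z [+ /ltW hz]; rewrite /T /= => ->; exact/min_idPl.
have dF : differentiable (c \o f) a by exact: (disc_differentiable hf ac ua ca).
have reg z : sqdist a z <= rd ^+ 2 ->
    [/\ {for z, continuous T}, {for z, continuous u}, 0 <= T z <= 1 & u z <= 0].
  move=> /ad zd; have [Uz rz] := fU zd; split.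
  - by apply: (cutoff_continuous Qc Qsub hc); exact: (disc_continuous hf zd).
  - exact: (disc_comp_continuous hf Uo Cu zd Uz).
  - exact: cutoff_bounds.
  - exact: ltW.
(* Near [a], differentiability bounds [T] quadratically; farther away, [T <= 1] is absorbed by
   [d ^- 2 * sqdist a z]. *)
have [Cst TC] : exists Cst, forall z, sqdist a z <= rd ^+ 2 -> T z <= Cst * sqdist a z.
  have [k k0 Hk] := near_dotp_le dF.
  have [d /= d0 Hd] := (nbhs_ballP _ _).1 (filterI nT Hk).
  exists (s ^- 2 * (c1 * k) + d ^- 2) => z zr; rewrite mulrDl.
  have id0 : 0 <= d ^- 2 by rewrite invr_ge0 sqr_ge0.
  have z0 := sqdist_ge0 a z.
  have kk0 : 0 <= s ^- 2 * (c1 * k) by rewrite mulr_ge0 ?mulr_ge0 ?(ltW is0) ?(ltW c10).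
  have [zd|dz] := ltP `|z - a| d.
    have zb : ball a d z by rewrite -ball_normE /= distrC.
    have [Tz dk] := Hd z zb; rewrite Tz.
    apply: (@le_trans _ _ (s ^- 2 * (c1 * k) * sqdist a z)); last by rewrite lerDl mulr_ge0.
    rewrite -!mulrA ler_pM2l //.
    apply: (le_trans (hnorm2_le _ ypr)); rewrite ler_pM2l //.
  have [_ _ /andP[_ T1] _] := reg z zr; apply: (le_trans T1).
  have : 1 <= d ^- 2 * sqdist a z.
    rewrite mulrC ler_pdivlMr ?exprn_gt0 // mul1r.
    have dn : 0 <= d by exact: ltW.
    apply: (@le_trans _ _ (`|z - a| ^+ 2)); first by rewrite ler_pXn2r // ?nnegrE.
    rewrite prod_normE /= /sqdist.
    case: (leP `|z.1 - a.1| `|z.2 - a.2|) => _; rewrite real_normK ?num_real //.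
      by rewrite lerDr sqr_ge0.
    by rewrite lerDl sqr_ge0.
  by move=> /le_trans; apply; rewrite lerDr mulr_ge0.
have Ttau tau' e' : tau' < s ^- 2 * N0 -> 0 < e' ->
    exists2 x, 0 < x < e' & tau' * x ^+ 2 <= T (a.1 + x, a.2).
  move=> tt e'0; have [d /= d0 Hd] := (nbhs_ballP _ _).1 (near_row nT).
  have dm0 : 0 < Num.min d e' by rewrite lt_min d0 e'0.
  have tt' : s ^+ 2 * tau' < N0 by rewrite -ltr_pdivlMl.
  have [x /andP[x0]] := difference_quotient dF tt' dm0.
  rewrite lt_min => /andP[xd xe] H; exists x; first by rewrite x0.
  rewrite Hd; last by rewrite /ball /= opprD addrA subrr sub0r normrN gtr0_norm.
  by rewrite /h ler_pdivlMl // mulrA.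
have tau0 : 0 < s ^- 2 * N0 by rewrite mulr_gt0.
have s01 : 0 < s <= 1 by rewrite s0 (le_trans sr1).
have test z : 0 < sqdist a z < rd ^+ 2 -> 0 < T z -> exists ux uy lu,
   [/\ pjet u z ux uy lu, 0 <= lu &
   (\forall z' \near z, T z' = 1) \/
   exists (t : R * R -> R) gx gy l N,
     [/\ (\forall z' \near z, T z' = Num.min (t z') 1), t z <= 1,
         pjet t z gx gy l, 0 <= N & [/\ eps * s ^+ 2 * N <= lu,
         4 * N * (1 - C * s * Num.sqrt (t z)) <= l &
         gx ^+ 2 + gy ^+ 2 <= 4 * t z * N * (1 + C * s * Num.sqrt (t z))]]].
  move=> /andP[_ /ltW /ad zd] _; have [Uz rz] := fU zd.
  have [[cz hz n1]|n1] := cutoff_cases (f z) Qc Qsub; last first.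
    do 3!eexists; split; first exact: (disc_levi hf Uo Cu zd Uz).
      have [->|v0] := pselect (dmap f z (1, 0) = 0); first by rewrite levi0.
      by apply: ltW; exact: psh.
    by left; exact: (near_comp (disc_continuous hf zd) n1).
  pose y := c (f z); pose wz := 'D_(1, 0) (c \o f) z.
  have yr : `|y - y0| < r by exact: hr.
  have /andP[lb1 _] := lb_curl lb wz yr.
  have dwz : 0 <= dotp wz wz by exact: dotp_ge0.
  do 3!eexists; split; first exact: (disc_laplacian hf Uo Cu ac zd cz Uz).
    by apply: le_trans lb1; rewrite mulr_ge0 // ltW.
  right; pose q : E := \row_i curl (Jdiff (Jmx J c) (fun y => y 0 i)) y wz (wz *m Jmx J c y).
  have qE i : q 0 i = curl (Jdiff (Jmx J c) (fun y => y 0 i)) y wz (wz *m Jmx J c y).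
    by rewrite mxE.
  have hs := h1E _ hz; rewrite -/y in hs.
  have hx1 : hnorm2 B (y - yp) <= 1.
    apply: (le_trans hs); rewrite -(expr1n _ 2) ler_pXn2r // ?nnegrE ?(ltW s0) //.
    by case/andP: s01.
  have [D1 D2] := chart_estimate yr ypr qE hx1.
  have jt := pjetZ (s ^- 2) (pjet_hnorm2 B (rjet_sub yp (disc_rjet hf ac zd cz))).
  have sq : s * Num.sqrt (h y) = Num.sqrt (hnorm2 B (y - yp)).
    rewrite /h sqrtrM ?(ltW is0) // sqrtrV ?(ltW s20) // sqrtr_sqr gtr0_norm //.
    by rewrite mulrA divff ?mul1r // gt_eqF.
  have sC : C * s * Num.sqrt (h y) = C * Num.sqrt (hnorm2 B (y - yp)).
    by rewrite -mulrA sq.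
  exists (fun z => h (c (f z))).
  do 3!eexists; exists (s ^- 2 * hnorm2 B wz); split.
  - exact: (near_comp (disc_continuous hf zd) n1).
  - exact: hz.
  - exact: jt.
  - by rewrite mulr_ge0 ?hnorm2_ge0 // ltW.
  split.
  - apply: le_trans lb1.
    rewrite /eps (_ : _ * _ = e * (hnorm2 B wz / c1)); last first.
      by field; rewrite !gt_eqF.
    rewrite ler_pM2l // ler_pdivrMr // [leRHS]mulrC.
    exact: (hnorm2_le wz ypr).
  - rewrite sC (_ : 4 * _ * _ = s ^- 2 * (4 * hnorm2 B wz *
      (1 - C * Num.sqrt (hnorm2 B (y - yp))))); last by ring.
    by rewrite ler_pM2l.
  - rewrite sC -/y.
    rewrite (_ : 4 * h y * _ * _ = s ^- 2 ^+ 2 * (4 * hnorm2 B (y - yp) * hnorm2 B wz *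
      (1 + C * Num.sqrt (hnorm2 B (y - yp))))); last by rewrite /h; ring.
    rewrite !(exprMn _ (s ^- 2)) -mulrDr.
    by apply: ler_wpM2l; [exact: sqr_ge0|exact: D2].
have := sibony_estimate rd0 tau0 C0 s01 eps0 reg TC Ttau test.
(* Since [u a = - del] and [s ^+ 2 = kap * del], the factor [del] cancels: the exponent does not see
   how close [f a] is to the boundary. *)
have -> : 8 * C + 1 - 4 * (1 + 6 * C + 6 * C ^+ 2) / (eps * s ^+ 2) * u a =
    8 * C + 1 + B0 / (eps * kap).
  rewrite s2 (_ : u a = - del) /B0; last by rewrite /del opprK.
  by field; rewrite !gt_eqF.
move=> H; apply: (@le_trans _ _ (N0 * rd ^+ 2)).
  by apply: ler_wpM2r => //; exact: sqr_ge0.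
have -> : N0 * rd ^+ 2 = s ^- 2 * N0 * rd ^+ 2 * s ^+ 2 by field; rewrite gt_eqF.
apply: (le_trans (ler_wpM2r (ltW s20) H)).
by rewrite s2 mulrCA mulrA.
Qed.

End DiscEstimate.

(** * The estimate of the metric *)

Section Uniform.
Context {R : realType} {m : nat} {M : manifold R m} (J : almost_complex M).
Context (g : riemannian_metric M).
Let E := 'rV[R]_m.
Variables (U D : set M) (rho : M -> R).
Hypotheses (Uo : open U) (DU : closure D `<=` U) (Cu : Ck_fun 2 U rho).
Hypothesis psh : forall p, U p -> forall v : tangent p, v <> 0 -> 0 < levi J rho v.
Hypothesis Dneg : forall p, D p -> rho p < 0.
Hypothesis Dc : compact (closure D).

Lemma metric_qform (c : chart R m M) p (v : tangent p) : atlas c -> chart_dom c p ->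
  g p v v = qform (fun i j => g p (of_chart c p (delta_mx 0 i))
                                  (of_chart c p (delta_mx 0 j))) (to_chart c v).
Proof.
move=> ac cp; pose w := to_chart c v.
have gl (a : R) (x y z : tangent p) : g p (a *: x + y) z = a * g p x z + g p y z.
  exact: metric_linear.
have g0 z : g p 0 z = 0.
  by have := gl (-1) 0 0 z; rewrite scaler0 add0r mulN1r addNr.
have gD x y z : g p (x + y) z = g p x z + g p y z.
  by have := gl 1 x y z; rewrite scale1r mul1r.
have gZ a x z : g p (a *: x) z = a * g p x z.
  by have := gl a x 0 z; rewrite !addr0 g0 addr0.
have vE : v = \sum_i w 0 i *: of_chart c p (delta_mx 0 i).
  rewrite -[LHS](to_chartK v ac cp) -/w.
  exact: (@row_expansion R m (fun w : E => of_chart c p w) w (of_chart_linear c p)).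
have gsum (h : 'I_m -> tangent p) z : g p (\sum_i h i) z = \sum_i g p (h i) z.
  exact: (big_morph (fun x => g p x z) (fun x y => gD x y z) (g0 z)).
rewrite {1}vE gsum; apply: eq_bigr => i _; rewrite gZ Defs.metric_sym {1}vE gsum mulr_sumr.
by apply: eq_bigr => j _; rewrite gZ Defs.metric_sym mulrA.
Qed.

(** The tangential estimate with the scaling of Schwarz's lemma: [rd] is the room left around [a] in
    the unit disc, so that the bound applies at centres other than the origin. *)
Definition disc_bound (K : R) (q : M) : Prop := forall f (a : R * R) (rd : R),
  J_holomorphic_disc J f -> (forall z, unit_disc z -> D (f z)) -> 0 < rd ->
  (forall z, sqdist a z <= rd ^+ 2 -> unit_disc z) -> f a = q ->
  let X := dmap f a (1, 0) in
  (exists lu, [/\ pjet (rho \o f) a (dfun rho X) (dfun rho (J (f a) X)) lu, 0 <= lu &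
     lu * rd ^+ 2 <= K * (- rho (f a))]) /\
  g (f a) X X * rd ^+ 2 <= K * (- rho (f a)).

Lemma subDU p : D p -> U p.
Proof. by move=> Dp; apply: DU; exact: subset_closure. Qed.

(** The constants come from a chart around [p0], possibly a boundary point, and from a bound [mrho]
    for [- rho] nearby. Allowing every larger [K] lets compactness combine them. *)
Lemma local_disc_bound p0 : closure D p0 ->
  exists2 K0 : R, 0 <= K0 &
    \forall q \near p0, forall K, K0 <= K -> disc_bound K q.
Proof.
move=> /DU Up0; pose c := chart_at p0.
have ac : atlas c by exact: chart_at_atlas.
have cp : chart_dom c p0 by exact: chart_at_dom.
pose y0 := c p0; pose Y := c @` (chart_dom c `&` U).
have Yo : open Y by exact: open_chart_image.
have Yy0 : Y y0 by exists p0.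
have dA j : differentiable (Jdiff (Jmx J c) (rho \o chart_inv c) j) y0.
  by apply: (Ck1_Jdiff_chart J j Uo Cu ac).1.
have pos (v : E) : v <> 0 ->
    0 < curl (Jdiff (Jmx J c) (rho \o chart_inv c)) y0 v (v *m Jmx J c y0).
  move=> v0; rewrite -(levi_curl (v : tangent p0) Uo Cu Up0 dA).
  exact: psh.
have [r [e [K1 [lb sub]]]] := exists_local_bounds Yo Yy0
  (fun i k => Ck1_Jmx_sub J U i k ac) (Cu ac) pos.
pose hG (ij : 'I_m * 'I_m) (y : E) := g (chart_inv c y)
  (of_chart c (chart_inv c y) (delta_mx 0 ij.1)) (of_chart c (chart_inv c y) (delta_mx 0 ij.2)).
have cG ij : {for y0, continuous (hG ij)}.
  by apply: (metric_smooth g ac (delta_mx 0 ij.1) (delta_mx 0 ij.2) 0); exists p0.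
have [KG KG0 nG] := near_bounded cG.
have r0 : 0 < r := lb_r lb.
pose mrho := `|rho p0| + 1.
have mrho0 : 0 < mrho by rewrite ltr_wpDl.
have nrho : \forall y \near y0, - mrho < (rho \o chart_inv c) y.
  apply: (near_gt (differentiable_continuous (Ck_fun_differentiable Cu ac cp Up0))).
  rewrite /= chart_mapK // /mrho.
  by have := ler_norm (- rho p0); rewrite normrN; lra.
have nr : \forall y \near y0, `|y - y0| < r / 2.
  apply/nbhs_ballP; exists (r / 2); first by rewrite /= divr_gt0.
  by move=> y; rewrite -ball_normE /= distrC.
have nq : \forall q \near p0, [/\ chart_dom c q, `|c q - y0| < r / 2,
    - mrho < rho q & forall ij, `|hG ij (c q)| <= KG].
  have nd : \forall q \near p0, chart_dom c q.
    by apply: open_nbhs_nbhs; split; [exact: chart_dom_open|].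
  have nc : \forall q \near p0, `|c q - y0| < r / 2 /\
      (- mrho < (rho \o chart_inv c) (c q) /\ forall ij, `|hG ij (c q)| <= KG).
    exact: (near_comp (@chart_map_cts _ _ _ c p0 cp) (filterI nr (filterI nrho nG))).
  apply: filterS (filterI nd nc) => q [cq [qr [qrho qG]]]; split=> //.
  by move: qrho; rewrite /= chart_mapK.
pose r1 : R := Num.min r 1 / 4.
pose kap : R := r1 ^+ 2 / mrho.
pose C : R := 2 * (1 + K1) + (1 + K1) ^+ 2.
pose B0 : R := 4 * (1 + 6 * C + 6 * C ^+ 2).
pose eps : R := e / (1 + K1).
pose K2 := kap * expR (8 * C + 1 + B0 / (eps * kap)).
have K10 : 0 <= K1 := lb_K lb.
have K20 : 0 <= K2.
  by rewrite mulr_ge0 ?expR_ge0 // divr_ge0 ?sqr_ge0 // ltW.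
pose K3 := m%:R ^+ 2 * KG.
have K30 : 0 <= K3 by rewrite mulr_ge0 ?sqr_ge0.
(* [K2] bounds the squared velocity in the chart; [K1] converts it into the Laplacian, [K3] into the
   metric. *)
exists ((K1 + K3) * K2); first by rewrite mulr_ge0 // addr_ge0.
apply: filterS nq => q [cq qr qrho qG] K KK f a rd hf fD rd0 ad fa X.
have ua : unit_disc a by apply: ad; rewrite /sqdist !subrr expr0n /= addr0 sqr_ge0.
have Da := fD a ua; have del0 : 0 < - rho (f a) by rewrite oppr_gt0 Dneg.
have fU z : unit_disc z -> U (f z) /\ rho (f z) < 0.
  by move=> /fD Dz; split; [exact: subDU|exact: Dneg].
have ca : chart_dom c (f a) by rewrite fa.
have ar : `|c (f a) - y0| < r / 2 by rewrite fa.
have rhoa : - rho (f a) <= mrho by rewrite fa lerNl ltW.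
have de := disc_estimate Uo Cu psh ac lb sub hf fU rd0 mrho0 ad ca ar rhoa.
rewrite -/r1 -/kap -/K2 in de.
have Xw := disc_to_chart hf (1, 0) ac ua ca.
pose w := 'D_(1, 0) (c \o f) a.
have {}de : dotp w w * rd ^+ 2 <= K2 * (- rho (f a)) by exact: de.
have arr : `|c (f a) - y0| < r by lra.
have fin (k : R) t : 0 <= k -> k <= K1 + K3 -> t <= k * dotp w w ->
    t * rd ^+ 2 <= K * (- rho (f a)).
  move=> k0 kK tk; apply: (@le_trans _ _ (k * (K2 * (- rho (f a))))).
    apply: (@le_trans _ _ (k * dotp w w * rd ^+ 2)).
      by apply: ler_wpM2r => //; exact: sqr_ge0.
    by rewrite -mulrA; apply: ler_wpM2l.
  apply: (@le_trans _ _ ((K1 + K3) * K2 * (- rho (f a)))).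
    by rewrite mulrA; apply: ler_wpM2r; [exact: ltW|exact: ler_wpM2r].
  by apply: ler_wpM2r => //; exact: ltW.
split.
  have /andP[l1 l2] := lb_curl lb w arr.
  eexists; split; first exact: (disc_laplacian hf Uo Cu ac ua ca (subDU Da)).
    by apply: le_trans l1; rewrite mulr_ge0 ?dotp_ge0 // ltW // (lb_e lb).
  by apply: (fin K1) => //; rewrite lerDl.
apply: (fin K3) => //; first by rewrite lerDr.
rewrite (metric_qform X ac ca) Xw -/w.
apply: (le_trans (ler_norm _)); apply: qform_bound => i j.
by have := qG (i, j); rewrite /hG -fa chart_mapK.
Qed.

(** Compactness in near-covering form, along the filter of large [K], replaces the extraction of a
    finite subcover. *)
Lemma uniform_disc_bound : exists2 K : R, 0 < K & forall q, closure D q -> disc_bound K q.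
Proof.
have near_cov x : closure D x ->
    \forall x' \near x & K \near +oo%R, disc_bound K x'.
  move=> /local_disc_bound [K0 K00 nK].
  exists ([set q | forall K, K0 <= K -> disc_bound K q], [set K | K0 <= K]) => /=.
    by split=> //; exact: (nbhs_pinfty_ge (num_real K0)).
  by move=> [q K] /= [H KK]; exact: (H K KK).
have nD : \forall K \near +oo%R, closure D `<=` disc_bound K.
  exact: ((compact_near_coveringP (closure D)).1 Dc R (pinfty_nbhs R) disc_bound _ near_cov).
have [K [K1 HK]] : exists K, 1 <= K /\ closure D `<=` disc_bound K.
  have [K HK] := filter_ex (filterI (nbhs_pinfty_ge (num_real 1)) nD).
  by exists K.
by exists K => //; exact: lt_le_trans K1.
Qed.

End Uniform.

Section Kobayashi.
Context {R : realType} {m : nat} {M : manifold R m} (J : almost_complex M).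
Context (g : riemannian_metric M).

Lemma dfunN (u : M -> R) p (v : tangent p) : dfun u (- v) = - dfun u v.
Proof. exact: linearN. Qed.

Lemma dfunZ (u : M -> R) p (a : R) (v : tangent p) : dfun u (a *: v) = a * dfun u v.
Proof. exact: linearZ. Qed.

(** The vector [v - i J v] is of type (1,0), as [J] maps it to [J v + i v]; on it the (1,0)-part
    agrees with the differential, whose value is [du(v) - i du(J v)]. *)
Lemma normc_dJ (u : M -> R) p (v : tangent p) :
  ComplexField.Normc.normc (dJ J u (v_sub_iJv J v)) ^+ 2 =
  dfun u v ^+ 2 + dfun u (J p v) ^+ 2.
Proof.
have -> : dJ J u (v_sub_iJv J v) = (dfun u v +i* (- dfun u (J p v)))%C.
  have JN : J p (- J p v) = v.
    have := linearN (J p) (J p v); rewrite (acs_sqr J v) opprK; exact.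
  rewrite /dJ /cdfun /cJ /v_sub_iJv /= JN dfunN.
  have two : (2 : R[i]) != 0 by rewrite pnatr_eq0.
  apply: (mulfI two); rewrite mulVKf //.
  by rewrite mulr_natl mulr2n; apply/eqP; rewrite eq_complex /=; apply/andP; split;
    apply/eqP; ring.
by rewrite /ComplexField.Normc.normc sqr_sqrtr ?addr_ge0 ?sqr_ge0 // sqrrN.
Qed.

Lemma metric_ge0 p (v : tangent p) : 0 <= g p v v.
Proof.
have [->|v0] := pselect (v = 0); last by rewrite ltW // metric_pos.
have := metric_linear g (-1) (0 : tangent p) 0 0.
by rewrite scaler0 add0r mulN1r addNr => ->.
Qed.

Lemma tnorm_sqr p (v : tangent p) : tnorm g v ^+ 2 = g p v v.
Proof. by rewrite sqr_sqrtr // metric_ge0. Qed.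

Lemma metricZ p (a : R) (v : tangent p) : g p (a *: v) (a *: v) = a ^+ 2 * g p v v.
Proof.
have g0 z : g p 0 z = 0.
  have := metric_linear g (-1) (0 : tangent p) 0 z.
  by rewrite scaler0 add0r mulN1r addNr.
have gZ (x z : tangent p) : g p (a *: x) z = a * g p x z.
  by have := metric_linear g a x 0 z; rewrite !addr0 g0 addr0.
by rewrite gZ Defs.metric_sym gZ expr2 mulrA.
Qed.

Variables (U D : set M) (rho : M -> R).
Hypotheses (Uo : open U) (DU : closure D `<=` U) (Cu : Ck_fun 2 U rho).
Hypothesis Dneg : forall p, D p -> rho p < 0.

(* The Laplacian of [- rho o f] is controlled by [- rho o f] itself, so Harnack
   applies to it. *)
Lemma disc_gradient_bound K : 0 < K ->
  (forall q, closure D q -> disc_bound J g D rho K q) ->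
  exists2 C, 0 < C & forall f, J_holomorphic_disc J f ->
    (forall z, unit_disc z -> D (f z)) ->
    let X := dmap f (0, 0) (1, 0) in let p := f (0, 0) in
    [/\ `|dfun rho X| <= C * - rho p, `|dfun rho (J p X)| <= C * - rho p &
        g p X X <= C * - rho p].
Proof.
move=> K0 HK.
(* [64] comes from discs of radius [1 / 8] centred within [3 / 4] of the origin, and [4 * K] below
   from the metric bound on the disc of radius [1 / 2] at the origin. *)
have [C1 C10 HC1] := @positive_gradient R (64 * K) (mulr_ge0 (ler0n _ 64) (ltW K0)).
exists (C1 + 4 * K); first by rewrite addr_gt0 // mulr_gt0.
move=> f hf fD X p.
have discE z : sqdist (0, 0) z < 1 -> @unit_disc R z.
  by rewrite /unit_disc /= /sqdist /= !subr0.
have cD z : unit_disc z -> closure D (f z) by move=> /fD; exact: subset_closure.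
have bnd (a : R * R) (s rd : R) : 0 <= s -> 0 < rd -> s + rd < 1 ->
    sqdist (0, 0) a <= s ^+ 2 -> forall z, sqdist a z <= rd ^+ 2 -> unit_disc z.
  move=> s0 rd0 srd sa z az; apply: discE.
  apply: (le_lt_trans (sqdist_triangle_le s0 (ltW rd0) sa az)).
  by rewrite -(expr1n _ 2) ltr_pXn2r // ?nnegrE //; lra.
have O0 : sqdist (0, 0) ((0, 0) : R * R) = 0 by rewrite /sqdist !subrr expr0n /= addr0.
have u0 : @unit_disc R (0, 0) by apply: discE; rewrite O0.
have del0 : 0 < - rho p by rewrite oppr_gt0; apply: Dneg; exact: fD.
have Uz z : unit_disc z -> U (f z) by move=> /cD; exact: DU.
have [[lu [j _ _]] gX] : (exists lu, [/\ pjet (rho \o f) (0, 0) (dfun rho X)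
    (dfun rho (J p X)) lu, 0 <= lu & lu * (1 / 2) ^+ 2 <= K * (- rho p)]) /\
    g p X X * (1 / 2) ^+ 2 <= K * (- rho p).
  have h2 : 0 < 1 / 2 :> R by lra.
  apply: (HK _ (cD _ u0) f (0, 0) (1 / 2) hf fD h2 _ erefl).
  by apply: (bnd _ 0 _ (lexx 0) h2); [lra|rewrite O0 expr0n].
have hl z : sqdist (0, 0) z <= 9 / 16 ->
    harmonic_like (64 * K) (fun z => -1 * (rho \o f) z) z.
  move=> z9; have zd : unit_disc z by apply: discE; lra.
  have h8 : 0 < 1 / 8 :> R by lra.
  have [|[l [jl l0 lK]] _] := HK _ (cD _ zd) f z (1 / 8) hf fD h8 _ erefl.
    apply: (bnd _ (3 / 4) _ _ h8); [lra|lra|].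
    by rewrite (_ : (3 / 4 : R) ^+ 2 = 9 / 16) //; field.
  have rz : rho (f z) < 0 by apply: Dneg; exact: fD.
  split.
  - by rewrite mulN1r oppr_gt0.
  - have cc : {for z, continuous (fun _ : R * R => -1 : R)} by exact: cst_continuous.
    exact: (continuous_mul cc (disc_comp_continuous hf Uo Cu zd (Uz _ zd))).
  - do 3!eexists; split; first exact: (pjetZ (-1) jl).
      move: lK; rewrite (_ : (1 / 8 : R) ^+ 2 = 1 / 64); last by field.
      by rewrite /=; lra.
    by lra.
have [] := HC1 _ hl _ _ _ (pjetZ (-1) j).
rewrite /= !mulN1r !normrN => b1 b2.
have Kd : 0 < K * - rho p by rewrite mulr_gt0.
have Cd : 0 < C1 * - rho p by rewrite mulr_gt0.
move: gX; rewrite (_ : (1 / 2 : R) ^+ 2 = 1 / 4); last by field.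
by move=> gX; split; rewrite mulrDl -/p in b1 b2 *; lra.
Qed.

End Kobayashi.

Unset Implicit Arguments.

Theorem theorem1 (R : realType) (n : nat) (M : manifold R (2 * n))
    (J : almost_complex M) (g : riemannian_metric M)
    (D : set M) (rho : M -> R)
    (domD : relatively_compact_domain D)
    (defD : defining_function D rho)
    (pshD : strictly_psh_near_closure J D rho) :
  exists c : R, 0 < c /\
    forall (p : M) (v : tangent p), D p ->
      ((c * Num.sqrt
          (ComplexField.Normc.normc (dJ J rho (v_sub_iJv J v)) ^+ 2 / `|rho p| ^+ 2
           + tnorm g v ^+ 2 / `|rho p|))%:E
       <= kobayashi_royden J D v)%E.

Proof.
have [U1 [_ _ DE _ _]] := defD.
have [U [Uo DU [Cu psh]]] := pshD.
have [_ _ Dc] := domD.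
have Dneg p : D p -> rho p < 0 by rewrite DE => -[].
have [K K0 HK] := uniform_disc_bound g Uo DU Cu psh Dneg Dc.
have [C C0 HC] := disc_gradient_bound Uo DU Cu Dneg K0 HK.
(* For [v = al X], each of the two squared components of the gradient contributes [C ^+ 2] and the
   metric term [C], all times [al ^+ 2]; so the square root in the statement is at most [al * B]. *)
pose B := Num.sqrt (2 * C ^+ 2 + C).
have B20 : 0 < 2 * C ^+ 2 + C by rewrite addr_gt0 // mulr_gt0 // exprn_gt0.
have B0 : 0 < B by rewrite sqrtr_gt0.
exists B^-1; split; first by rewrite invr_gt0.
move=> p v Dp; apply: le_ereal_inf_tmp => _ [al [al0 [f [hf fD f0 fX]]] <-].
rewrite lee_fin mulrC ler_pdivrMr //.
have fD' z : unit_disc z -> D (f z) by move=> zd; apply: fD; exists z.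
have [] := HC f hf fD'.
(* Replaces [p] by [f (0, 0)], so that [v] and the derivative of [f] lie in the same tangent
   space. *)
case: _ / f0 v fX Dp => v fX Dp.
set q := f (0, 0); set X := dmap f (0, 0) (1, 0) => b1 b2 b3.
have XE : X = al^-1 *: v :> tangent q by exact: fX.
have del0 : 0 < - rho q by rewrite oppr_gt0 Dneg.
have ial : 0 < al^-1 by rewrite invr_gt0.
rewrite XE in b1 b2 b3.
have Jl : J q (al^-1 *: v) = al^-1 *: J q v := linearZ_LR (J q) _ _.
rewrite Jl in b2.
rewrite !dfunZ !normrM (gtr0_norm ial) in b1 b2.
rewrite !ler_pdivrMl // in b1 b2.
rewrite metricZ exprVn ler_pdivrMl ?exprn_gt0 // in b3.
rewrite normc_dJ tnorm_sqr (ltr0_norm (Dneg _ Dp)).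
set d := - rho q in del0 b1 b2 b3 *.
have alB : al * B = Num.sqrt (al ^+ 2 * (2 * C ^+ 2 + C)).
  by rewrite sqrtrM ?sqr_ge0 // sqrtr_sqr gtr0_norm.
rewrite -/q alB ler_sqrt; last exact: mulr_ge0 (sqr_ge0 _) (ltW B20).
have sq (t : R) : `|t| <= al * (C * d) -> t ^+ 2 <= (al * (C * d)) ^+ 2.
  move=> td; rewrite -(real_normK (num_real t)) ler_pXn2r // ?nnegrE //.
  exact: le_trans td.
have h1 : (dfun rho v ^+ 2 + dfun rho (J q v) ^+ 2) / d ^+ 2 <= 2 * (al ^+ 2 * C ^+ 2).
  rewrite ler_pdivrMr ?exprn_gt0 //.
  rewrite (_ : 2 * _ * _ = (al * (C * d)) ^+ 2 + (al * (C * d)) ^+ 2); last by ring.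
  by apply: lerD; exact: sq.
have h2 : g q v v / d <= al ^+ 2 * C.
  by rewrite ler_pdivrMr // -mulrA.
rewrite mulrDr (_ : al ^+ 2 * (2 * C ^+ 2) = 2 * (al ^+ 2 * C ^+ 2)); last by ring.
exact: lerD.
Qed.
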